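(* Let $p\in X$ be a point on a reduced complex space of dimension $n$. If the space germ $X_p$ is holomorphically contractible to (the germ at $p$ of) a subspace $Y\subset X$ of dimension $m$, then the sequence $$\Omega^{m}_h|_{X,p}\xrightarrow{d}\Omega^{m+1}_h|_{X,p}\xrightarrow{d}\cdots\xrightarrow{d}\Omega^{n}_h|_{X,p}\to 0$$ of stalks at $p$ of sheaves of $h$-differential forms is exact.
   Context: $h$-differential forms: let $X$ be a reduced complex space, $i\ge 0$. An $h$-differential form $\alpha$ of degree $i$ on $X$ is a family $\alpha=(\alpha_f)_f$ consisting of a holomorphic form $\alpha_f\in\Omega^i_M(M)$ for every holomorphic map $f:M\to X$ from a complex manifold $M$, such that $g^*\alpha_f=\alpha_{f\circ g}$ for every holomorphic map $g:M'\to M$ from another complex manifold. These form an $\mathcal{O}_X(X)$-module $\Omega^i_h(X)$; the exterior derivative is $(d\alpha)_f=d\alpha_f$; the sheaf $\Omega^i_h|_X$ is defined by $\Omega^i_h|_X(U)=\Omega^i_h(U)$ for $U\subset X$ open, and $\Omega^i_h|_{X,p}$ is its stalk. Holomorphic contractibility: let $X_p$ be a reduced complex space germ and $Y_p\subset X_p$ a reduced subgerm. $X_p$ is holomorphically contractible to $Y_p$ if there are representatives $X\supset Y\ni p$, an open neighborhood $U\subset X$ of $p$, a domain $T\subset\mathbb{C}$ containing $0$ and $1$, and a holomorphic map $\phi:U\times T\to X$ with $\phi(p,t)=p$ for all $t\in T$, and $\phi(x,1)=x$, $\phi(x,0)\in Y$ for all $x\in U$. *)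

(* Defs.v *)
From HB Require Import structures.
From mathcomp Require Import all_boot all_order all_algebra.
From mathcomp Require Import all_classical all_reals all_analysis.
From mathcomp Require Import complex.

Set Implicit Arguments.
Unset Strict Implicit.
Unset Printing Implicit Defensive.

Import Order.TTheory GRing.Theory Num.Theory.
Import numFieldNormedType.Exports.

Local Open Scope classical_set_scope.
Local Open Scope ring_scope.

(* The complex numbers, seen as a numFieldType so that the norm, the topology
   and the (C-linear) differential of MathComp-Analysis apply to them. *)
Definition CC (R : realType) : numFieldType := R[i]%C.

Lemma near_eq_differentiable (K : numFieldType) (V W : normedModType K)
  (f g : V -> W) (x : V) : (\forall y \near x, f y = g y) ->
  differentiable f x -> differentiable g x.
Proof.
move=> fg df.
have gE : g \o shift x = cst (g x) + 'd f x +o_ 0 id.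
  apply/eqaddoP => _/posnumP[e].
  have fg0 : \forall h \near 0, f (h + x) = g (h + x).
    by move: fg; rewrite (near_shift 0) subr0.
  have /eqaddoP/(_ e%:num (gt0 e)) fE := diff_locally df.
  apply: filterS2 fg0 fE => h eh.
  by rewrite -(nbhs_singleton fg) /= !fctE /= eh.
apply/diff_locallyP; have dE : 'd g x = 'd f x :> (V -> W).
  by apply: diff_unique => //; exact: diff_continuous.
by rewrite dE; split => //; exact: diff_continuous.
Unshelve. all: by end_near. Qed.

Section ComplexSpaces.
Variable R : realType.
Local Notation C := (CC R).

(* A reduced complex space is determined by its topology and its sheaf of
   holomorphic functions, which are genuine continuous C-valued functions.  The
   sheaf is given through its germs: [hol x f] says that f is holomorphic on
   some neighbourhood of x; the values of f far from x are irrelevant. *)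
Record fspace := FSpace {
  carrier :> topologicalType;
  hol : carrier -> (carrier -> C) -> Prop;
  hol_cont : forall (x : carrier) (f : carrier -> C),
    hol x f -> {for x, continuous f};
  hol_germ : forall (x : carrier) (f g : carrier -> C),
    (\forall y \near x, f y = g y) -> hol x f -> hol x g;
  hol_near : forall (x : carrier) (f : carrier -> C),
    hol x f -> \forall y \near x, hol y f }.

(* Holomorphic maps defined on an open subset A of X: continuous, and pulling
   holomorphic functions back to holomorphic functions. *)
Definition hol_on (X Z : fspace) (A : set X) (f : X -> Z) : Prop :=
  forall x, A x ->
    {for x, continuous f} /\ forall g, hol (f x) g -> hol x (g \o f).

Definition holomorphic (X Z : fspace) (f : X -> Z) : Prop := hol_on setT f.

Section Affine.
Variable V : normedModType C.

(* Holomorphy in several variables is taken to be complex (Frechet)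
   differentiability on an open set. *)
Definition affine_hol (x : V) (f : V -> C) : Prop :=
  \forall y \near x, differentiable (f : V -> C^o) y.

Lemma affine_hol_cont (x : V) (f : V -> C) :
  affine_hol x f -> {for x, continuous f}.
Proof. by move=> /nbhs_singleton /differentiable_continuous. Qed.

Lemma affine_hol_germ (x : V) (f g : V -> C) :
  (\forall y \near x, f y = g y) -> affine_hol x f -> affine_hol x g.
Proof.
move=> /near_join fg; apply: filterS2 fg => y fg.
exact: near_eq_differentiable.
Qed.

Lemma affine_hol_near (x : V) (f : V -> C) :
  affine_hol x f -> \forall y \near x, affine_hol y f.
Proof. exact: near_join. Qed.

Definition affine : fspace :=
  FSpace affine_hol_cont affine_hol_germ affine_hol_near.
End Affine.

Definition Cn (d : nat) : fspace := affine 'rV[C]_d.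
Definition Cline : fspace := affine C^o.

Section Product.
Variables X Z : fspace.

(* The structure sheaf of the product: f is holomorphic near (x, z) if it is a
   holomorphic function, in the sense of several complex variables, of finitely
   many holomorphic functions of x and finitely many holomorphic functions of z.
   On local models, this is the restriction of ambient holomorphic functions. *)
Definition prod_hol (u : X * Z) (f : X * Z -> C) : Prop :=
  exists (k l : nat) (a : X -> 'rV[C]_k) (b : Z -> 'rV[C]_l)
         (G : 'rV[C]_k * 'rV[C]_l -> C),
    [/\ forall j, hol u.1 (fun x => a x ord0 j),
        forall j, hol u.2 (fun z => b z ord0 j),
        affine_hol (a u.1, b u.2) G &
        \forall v \near u, f v = G (a v.1, b v.2)].

Lemma hol_row_cont (T : fspace) k (x : T) (a : T -> 'rV[C]_k) :
  (forall j, hol x (fun y => a y ord0 j)) -> {for x, continuous a}.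
Proof.
move=> ha A [P aP PA]; rewrite /= nbhs_filterE.
have : \forall y \near x, forall j, P ord0 j (a y ord0 j).
  by apply: filter_forall => j; exact: (hol_cont (ha j)) (aP ord0 j).
by apply: filterS => y Py; apply: PA => i j; rewrite ord1.
Qed.

Lemma prod_row_cont k l (u : X * Z) (a : X -> 'rV[C]_k) (b : Z -> 'rV[C]_l) :
  (forall j, hol u.1 (fun x => a x ord0 j)) ->
  (forall j, hol u.2 (fun z => b z ord0 j)) ->
  {for u, continuous (fun v : X * Z => (a v.1, b v.2))}.
Proof.
move=> ha hb.
have ca : (a \o fst) @ nbhs u --> a u.1.
  exact: (@cvg_comp _ _ _ fst a _ _ _ cvg_fst (hol_row_cont ha)).
have cb : (b \o snd) @ nbhs u --> b u.2.
  exact: (@cvg_comp _ _ _ snd b _ _ _ cvg_snd (hol_row_cont hb)).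
move=> S [[P Q] [/= aP bQ] PQS].
have aPu : \forall v \near u, P (a v.1) := ca _ aP.
have bQu : \forall v \near u, Q (b v.2) := cb _ bQ.
by apply: filterS2 aPu bQu => v Pv Qv; exact: (PQS (a v.1, b v.2)).
Qed.

Lemma prod_hol_cont (u : X * Z) (f : X * Z -> C) :
  prod_hol u f -> {for u, continuous f}.
Proof.
move=> [k [l [a [b [G [ha hb hG fE]]]]]].
have GC : (fun v : X * Z => G (a v.1, b v.2)) @ u --> f u.
  rewrite (nbhs_singleton fE).
  exact: (cvg_comp _ _ (prod_row_cont ha hb) (affine_hol_cont hG)).
apply: cvg_trans GC; apply: near_eq_cvg.
by apply: filterS fE => v ->.
Qed.

Lemma prod_hol_germ (u : X * Z) (f g : X * Z -> C) :
  (\forall v \near u, f v = g v) -> prod_hol u f -> prod_hol u g.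
Proof.
move=> fg [k [l [a [b [G [ha hb hG fE]]]]]].
exists k, l, a, b, G; split => //.
by apply: filterS2 fg fE => v <-.
Qed.

Lemma prod_hol_near (u : X * Z) (f : X * Z -> C) :
  prod_hol u f -> \forall v \near u, prod_hol v f.
Proof.
move=> [k [l [a [b [G [ha hb hG fE]]]]]].
have ha' : \forall v \near u, forall j, hol v.1 (fun x => a x ord0 j).
  apply: (filter_forall (F := nbhs u)) => j.
  exact: (@cvg_fst _ _ (nbhs u.1) (nbhs u.2) _ _ (hol_near (ha j))).
have hb' : \forall v \near u, forall j, hol v.2 (fun z => b z ord0 j).
  apply: (filter_forall (F := nbhs u)) => j.
  exact: (@cvg_snd _ _ (nbhs u.1) (nbhs u.2) _ _ (hol_near (hb j))).
have hG' : \forall v \near u, affine_hol (a v.1, b v.2) G.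
  exact: (prod_row_cont ha hb) (affine_hol_near hG).
have := near_join fE; apply: filterS3 (filterI ha' hb') hG' => v [? ?] ? ?.
by exists k, l, a, b, G; split.
Qed.

Definition prod_space : fspace :=
  FSpace prod_hol_cont prod_hol_germ prod_hol_near.
End Product.

(* A is a (closed) analytic subset of the open set D. *)
Definition analytic_in (X : fspace) (D A : set X) : Prop :=
  A `<=` D /\
  forall x, D x -> exists (k : nat) (h : 'I_k -> X -> C),
    (forall j, hol x (h j)) /\
    \forall y \near x, A y <-> forall j, h j y = 0.

(* An isomorphism e, with inverse s, from the open subset U of X onto an
   analytic subset A of an open subset D of C^N; the functions on A are locally
   the restrictions of holomorphic functions of the ambient space. *)
Definition local_model (X : fspace) (U : set X) (N : nat) (D A : set (Cn N))
    (e : X -> Cn N) (s : Cn N -> X) : Prop :=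
  [/\ open U /\ open D, analytic_in D A,
      forall x, U x -> A (e x) /\ s (e x) = x,
      forall a, A a -> U (s a) /\ e (s a) = a &
      hol_on U e /\
      forall a, A a ->
        s @ within A (nbhs a) --> s a /\
        forall g, hol (s a) g -> exists F : Cn N -> C,
          hol a F /\ \forall b \near a, A b -> F b = g (s b)].

Definition reduced_complex_space (X : fspace) : Prop :=
  hausdorff_space X /\
  forall p : X, exists (U : set X) (N : nat) (D A : set (Cn N))
    (e : X -> Cn N) (s : Cn N -> X), U p /\ local_model U D A e s.

(* Y contains a d-dimensional complex submanifold: s embeds the nonempty open
   subset W of C^d into Y.  The holomorphic retraction r says that s is a
   biholomorphism onto its image, with the structure induced from X. *)
Definition contains_submanifold (X : fspace) (Y : set X) (d : nat) : Prop :=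
  exists (W : set (Cn d)) (V : set X) (s : Cn d -> X) (r : X -> Cn d),
    [/\ open W /\ W !=set0, open V, hol_on W s, hol_on V r &
        forall w, W w -> [/\ V (s w), Y (s w) & r (s w) = w]].

(* The dimension of an analytic subset Y, as in Lojasiewicz, Introduction to
   Complex Analytic Geometry: the largest dimension of a complex submanifold
   contained in Y.  Equivalently, the largest dimension at a regular point. *)
Definition has_dim (X : fspace) (Y : set X) (n : nat) : Prop :=
  contains_submanifold Y n /\
  forall d, contains_submanifold Y d -> (d <= n)%N.

Record chart (M : fspace) := Chart {
  cdim : nat;
  cdom : set M;
  ccod : set (Cn cdim);
  cmap : M -> Cn cdim;
  cinv : Cn cdim -> M;
  cdom_open : open cdom;
  ccod_open : open ccod;
  cmapK : forall x, cdom x -> ccod (cmap x) /\ cinv (cmap x) = x;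
  cinvK : forall z, ccod z -> cdom (cinv z) /\ cmap (cinv z) = z;
  cmap_hol : hol_on cdom cmap;
  cinv_hol : hol_on ccod cinv }.

Arguments cdim {M} c.
Arguments cdom {M} c _.
Arguments ccod {M} c _.
Arguments cmap {M} c _.
Arguments cinv {M} c _.

Record manifold := Manifold {
  mspace :> fspace;
  manifold_hausdorff : hausdorff_space mspace;
  manifold_chart : forall x : mspace, exists c : chart mspace, cdom c x }.

(* The arguments of an i-linear form on C^d are the rows of a matrix. *)
Definition alternating_form (i d : nat) (w : 'M[C]_(i, d) -> C) : Prop :=
  (forall (A B D : 'M[C]_(i, d)) (k : 'I_i) (a : C),
     row k A = a *: row k B + row k D ->
     row' k A = row' k B -> row' k A = row' k D -> w A = a * w B + w D) /\
  (forall (A : 'M[C]_(i, d)) (k l : 'I_i),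
     k != l -> row k A = row l A -> w A = 0).

(* An i-form on M is given by its expressions in the charts c; only the values
   at the points of [ccod c] are relevant. *)
Definition form (M : fspace) (i : nat) :=
  forall c : chart M, 'rV[C]_(cdim c) -> 'M[C]_(i, cdim c) -> C.

Definition form_eq (M : fspace) (i : nat) (w w' : form M i) : Prop :=
  forall (c : chart M) z v, ccod c z -> w c z v = w' c z v.

Definition form_zero (M : fspace) (i : nat) : form M i := fun _ _ _ => 0.

(* w' = g^* w, for g : M' -> M holomorphic. *)
Definition is_pullback (M' M : fspace) (g : M' -> M) (i : nat)
    (w : form M i) (w' : form M' i) : Prop :=
  forall (c' : chart M') (c : chart M) (z : 'rV[C]_(cdim c'))
         (v : 'M[C]_(i, cdim c')),
    ccod c' z -> cdom c (g (cinv c' z)) ->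
    let G : 'rV[C]_(cdim c') -> 'rV[C]_(cdim c) :=
      fun y => cmap c (g (cinv c' y)) in
    w' c' z v = w c (G z) (\matrix_(k < i) 'd G z (row k v)).

(* Holomorphic forms; the pullback along the identity expresses that the local
   expressions agree under changes of coordinates. *)
Definition hol_form (M : fspace) (i : nat) (w : form M i) : Prop :=
  [/\ forall (c : chart M) z, ccod c z -> alternating_form (w c z),
      forall (c : chart M) z v, ccod c z -> affine_hol z (fun y => w c y v) &
      is_pullback idfun w w].

(* (dw)_z(v_0, .., v_i) = \sum_k (-1)^k D_{v_k} (w(v_0, .., ^v_k, .., v_i))(z) *)
Definition dform (M : fspace) (i : nat) (w : form M i) : form M i.+1 :=
  fun c z v => \sum_(k < i.+1)
    (-1) ^+ k * 'D_(row k v) (fun y => w c y (row' k v) : C^o) z.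

Section HForms.
Variable X : fspace.

Definition hfamily (i : nat) := forall M : manifold, (M -> X) -> form M i.

Definition maps_into (U : set X) (M : manifold) (f : M -> X) : Prop :=
  holomorphic f /\ forall x, U (f x).

(* a is an element of Omega^i_h(U); only the forms attached to holomorphic maps
   with image in the open set U are relevant. *)
Definition hform (U : set X) (i : nat) (a : hfamily i) : Prop :=
  (forall (M : manifold) (f : M -> X), maps_into U f -> hol_form (a M f)) /\
  (forall (M' M : manifold) (g : M' -> M) (f : M -> X),
     holomorphic g -> maps_into U f -> is_pullback g (a M f) (a M' (f \o g))).

Definition hzero (i : nat) : hfamily i := fun M _ => @form_zero M i.

Definition hd (i : nat) (a : hfamily i) : hfamily i.+1 :=
  fun M f => dform (a M f).

(* The elements of the stalk Omega^i_h|_{X,p} are represented by families a with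
   [hstalk p a], two such being identified by [hstalk_eq p]. *)
Definition hstalk (p : X) (i : nat) (a : hfamily i) : Prop :=
  exists U : set X, [/\ open U, U p & hform U a].

Definition hstalk_eq (p : X) (i : nat) (a b : hfamily i) : Prop :=
  exists V : set X, [/\ open V, V p &
    forall (M : manifold) (f : M -> X),
      maps_into V f -> form_eq (a M f) (b M f)].

(* The class of a is in the image of d from degree i to degree i + 1. *)
Definition hstalk_dimage (p : X) (i : nat) (a : hfamily i.+1) : Prop :=
  exists b : hfamily i, hstalk p b /\ hstalk_eq p (hd b) a.

(* Exactness of Omega^i -> Omega^{i+1} -> Omega^{i+2} at the middle term. *)
Definition hstalk_exact (p : X) (i : nat) : Prop :=
  forall a : hfamily i.+1, hstalk p a ->
    hstalk_eq p (hd a) (@hzero i.+2) <-> hstalk_dimage p a.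

(* Exactness of Omega^i -> Omega^{i+1} -> 0 at the middle term. *)
Definition hstalk_surjective (p : X) (i : nat) : Prop :=
  forall a : hfamily i.+1, hstalk p a -> hstalk_dimage p a.

(* The germ of X at p is holomorphically contractible to the germ of Y at p:
   X' and Y' are the representatives of the two germs. *)
Definition hol_contractible (p : X) (Y : set X) : Prop :=
  exists (X' Y' U : set X) (T : set Cline) (phi : prod_space X Cline -> X),
    [/\ [/\ open X', X' p, analytic_in X' Y', Y' p &
            \forall x \near p, Y' x <-> Y x],
        [/\ open U, U p & U `<=` X'],
        [/\ open T, connected T, T 0 & T 1],
        @hol_on (prod_space X Cline) X (U `*` T) phi /\
          (forall x t, U x -> T t -> X' (phi (x, t))) &
        (forall t, T t -> phi (p, t) = p) /\
        (forall x, U x -> phi (x, 1) = x /\ Y' (phi (x, 0)))].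

End HForms.

End ComplexSpaces.

(* Main.v *)
(* An h-form a on X is a compatible family of forms on all open subsets D of C^d
   with a holomorphic map D -> X, so that d, pullback and the homotopy operator
   can be computed in coordinates.  A form of degree larger than m vanishes on
   every holomorphic map f : D -> Y, dim Y <= m: by the constant rank theorem, f
   factors near a point of maximal rank through a submanifold of Y of dimension
   at most m.  Now let a be closed of degree i + 1 > m.  Integrating the
   contraction of phi^* a with d/dt along a short segment from t1 to t2 gives a
   primitive of phi_t2^* a - phi_t1^* a near p; as T is connected,
   a - phi_0^* a = phi_1^* a - phi_0^* a is exact at p.  Since phi_0 maps into Y,
   phi_0^* a = 0.  In top degree n = dim X, da has degree n + 1 and vanishes for
   the same reason, so every form is closed. *)

Require Import Defs.
From HB Require Import structures.
From mathcomp Require Import all_boot all_order fingroup perm all_algebra.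
From mathcomp Require Import all_classical all_reals all_analysis.
From mathcomp Require Import complex ring lra.

Set Implicit Arguments.
Unset Strict Implicit.
Unset Printing Implicit Defensive.

Import Order.TTheory GRing.Theory Num.Theory.
Import numFieldNormedType.Exports.

Local Open Scope classical_set_scope.
Local Open Scope ring_scope.

(** * Real-valued norms and limits *)

Section RealNorm.
Variable R : realType.
Local Notation C := (CC R).

(** Holomorphy is defined as complex differentiability on an open set, whereas d, the relation d d =
    0 and differentiation under the integral sign call for derivatives that are again
    differentiable. This regularity is derived from Goursat's theorem through a second-order Cauchy
    estimate. Integration is restricted to line segments, as limits of trapezoid sums; the contour
    is the square with vertices 1, i, -1, -i, and compactness arguments become Cousin-type
    subdivisions.

    The exterior derivative is, up to a nonzero factor, the antisymmetrization of its first term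
    over all permutations of the arguments. It is therefore skew by construction, and every
    contribution that is symmetric in two arguments, such as a second derivative, drops out; this
    gives both d d = 0 and naturality under pullback.

    The homotopy phi maps a neighbourhood of p into the domain of a only locally in t, and that
    neighbourhood depends on t. Hence primitives are built inside a disc around each parameter and
    added as germs at p; the set of parameters reached from a given one and its complement in T are
    both open. *)

Definition rc (x : R) : C := (x%:C)%C.

(* The norm of a complex normed module takes its values in C; [nm] is the same
   norm with values in the ordered field R. *)
Definition nm (V : normedModType C) (x : V) : R := complex.Re (`|x| : C).

Lemma rc_le (x y : R) : (rc x <= rc y) = (x <= y).
Proof. exact: lecR. Qed.

Lemma rc_lt (x y : R) : (rc x < rc y) = (x < y).
Proof. exact: ltcR. Qed.

Lemma rcD x y : rc (x + y) = rc x + rc y.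
Proof. exact: (rmorphD (real_complex R)). Qed.

Lemma rcB x y : rc (x - y) = rc x - rc y.
Proof. exact: (rmorphB (real_complex R)). Qed.

Lemma rcM x y : rc (x * y) = rc x * rc y.
Proof. exact: (rmorphM (real_complex R)). Qed.

Lemma rcV x : rc (x^-1) = (rc x)^-1.
Proof. exact: (fmorphV (real_complex R)). Qed.

Lemma rc0 : rc 0 = 0. Proof. by []. Qed.
Lemma rc1 : rc 1 = 1. Proof. by []. Qed.

Lemma rcX x n : rc (x ^+ n) = rc x ^+ n.
Proof. exact: (rmorphXn (real_complex R)). Qed.

Lemma rc_nat n : rc n%:R = n%:R.
Proof. exact: (rmorph_nat (real_complex R)). Qed.

Lemma rc_eq0 x : (rc x == 0) = (x == 0).
Proof. exact: (fmorph_eq0 (real_complex R)). Qed.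

Lemma gt0_rc (e : C) : 0 < e -> exists2 x : R, 0 < x & e = rc x.
Proof.
move=> e0; exists (complex.Re (e : R[i])).
  by move: e0; rewrite (@ltcE R 0 e) /= => /andP[].
rewrite /rc RRe_real //; exact: gtr0_real.
Qed.

Lemma nmE (V : normedModType C) (x : V) : `|x| = rc (nm x).
Proof. by rewrite /rc /nm RRe_real //; exact: normr_real. Qed.

Lemma nm_ge0 (V : normedModType C) (x : V) : 0 <= nm x.
Proof. by rewrite -rc_le -nmE rc0 normr_ge0. Qed.

Lemma nmD (V : normedModType C) (x y : V) : nm (x + y) <= nm x + nm y.
Proof. by rewrite -rc_le rcD -!nmE ler_normD. Qed.

Lemma nmN (V : normedModType C) (x : V) : nm (- x) = nm x.
Proof. by rewrite /nm normrN. Qed.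

Lemma nmB (V : normedModType C) (x y : V) : nm (x - y) <= nm x + nm y.
Proof. by rewrite -(nmN y) nmD. Qed.

Lemma nm_dist (V : normedModType C) (x y : V) : nm (x - y) = nm (y - x).
Proof. by rewrite /nm distrC. Qed.

Lemma nm_tri (V : normedModType C) (y x z : V) :
  nm (x - z) <= nm (x - y) + nm (y - z).
Proof. by have := nmD (x - y) (y - z); rewrite addrA subrK. Qed.

Lemma nm0 (V : normedModType C) : nm (0 : V) = 0.
Proof. by rewrite /nm normr0. Qed.

Lemma nm_eq0 (V : normedModType C) (x : V) : (nm x == 0) = (x == 0).
Proof. by rewrite -[RHS]normr_eq0 nmE rc_eq0. Qed.

Lemma nm_le0 (V : normedModType C) (x : V) : nm x <= 0 -> x = 0.
Proof. by move=> h; apply/eqP; rewrite -nm_eq0 eq_le h nm_ge0. Qed.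

Lemma nm_gt0 (V : normedModType C) (x : V) : (0 < nm x) = (x != 0).
Proof. by rewrite lt_def nm_eq0 nm_ge0 andbT. Qed.

Lemma nmZ (V : normedModType C) (a : C) (x : V) : nm (a *: x) = nm a * nm x.
Proof.
have /complexI : rc (nm (a *: x)) = rc (nm a * nm x).
  by rewrite rcM -!nmE normrZ.
by [].
Qed.

Lemma nmM (a b : C) : nm (a * b) = nm a * nm b.
Proof.
have /complexI : rc (nm (a * b)) = rc (nm a * nm b).
  by rewrite rcM -!nmE normrM.
by [].
Qed.

Lemma nmV (a : C) : nm (a^-1) = (nm a)^-1.
Proof.
have /complexI : rc (nm (a^-1)) = rc ((nm a)^-1) by rewrite rcV -!nmE normfV.
by [].
Qed.

Lemma nmX (a : C) n : nm (a ^+ n) = nm a ^+ n.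
Proof.
have /complexI : rc (nm (a ^+ n)) = rc (nm a ^+ n) by rewrite rcX -!nmE normrX.
by [].
Qed.

Lemma nm_rc (x : R) : 0 <= x -> nm (rc x) = x.
Proof. by move=> x0; rewrite /nm ger0_norm // -rc0 rc_le. Qed.

Lemma nm1 : nm (1 : C) = 1.
Proof. by rewrite -rc1 nm_rc. Qed.

Lemma nm_nat n : nm (n%:R : C) = n%:R.
Proof. by rewrite -rc_nat nm_rc. Qed.

Lemma nm_sum (V : normedModType C) (I : finType) (P : pred I) (F : I -> V) :
  nm (\sum_(i | P i) F i) <= \sum_(i | P i) nm (F i).
Proof.
elim/big_ind2: _ => // [|x y u v xy uv]; first by rewrite nm0.
by apply: le_trans (nmD _ _) (lerD xy uv).
Qed.

Definition ii : C := ('i)%C.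

Lemma nm_ii : nm ii = 1.
Proof. by rewrite /nm normc_def /= expr0n add0r expr1n sqrtr1. Qed.

Lemma nm_le_ReIm (z : C) :
  nm z <= `|complex.Re (z : R[i])| + `|complex.Im (z : R[i])|.
Proof.
rewrite -rc_le -nmE {1}(complexE z) rcD.
apply: le_trans (ler_normD _ _) _; apply: lerD.
  by rewrite (@normc_def R (rc _)) /= expr0n addr0 sqrtr_sqr.
rewrite normrM (@normc_def R) /= expr0n add0r expr1n sqrtr1 mul1r.
by rewrite (@normc_def R (rc _)) /= expr0n addr0 sqrtr_sqr.
Qed.

Lemma Re_le_nm (z : C) : `|complex.Re (z : R[i])| <= nm z.
Proof.
rewrite -rc_le -nmE /rc; exact: normc_ge_Re.
Qed.

Lemma Im_le_nm (z : C) : `|complex.Im (z : R[i])| <= nm z.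
Proof.
have -> : nm z = nm (z * ii) by rewrite nmM nm_ii mulr1.
by have := Re_le_nm (z * ii); rewrite (ReiNIm z) normrN.
Qed.

Lemma nearP (V : normedModType C) (x : V) (P : V -> Prop) :
  (\forall y \near x, P y) <->
  exists2 d : R, 0 < d & forall y, nm (y - x) < d -> P y.
Proof.
split=> [/nbhs_normP[e /= /gt0_rc[d d0 ->] H]|[d d0 H]].
  exists d => // y yd; apply: H => /=.
  by rewrite distrC nmE rc_lt.
apply/nbhs_normP; exists (rc d) => /=; first by rewrite -rc0 rc_lt.
by move=> y; rewrite /= distrC nmE rc_lt; exact: H.
Qed.

Definition tends (V : normedModType C) (u : nat -> V) (l : V) :=
  forall e : R, 0 < e -> exists N, forall n, (N <= n)%N -> nm (u n - l) <= e.

Lemma tends_uniq (V : normedModType C) (u : nat -> V) l l' :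
  tends u l -> tends u l' -> l = l'.
Proof.
move=> ul ul'; apply/eqP; rewrite -subr_eq0 -nm_eq0 eq_le nm_ge0 andbT.
rewrite leNgt; apply/negP => h.
have h4 : 0 < nm (l - l') / 4 by rewrite divr_gt0.
have [N HN] := ul _ h4; have [N' HN'] := ul' _ h4.
have := HN (N + N')%N (leq_addr _ _); have := HN' (N + N')%N (leq_addl _ _).
by have := nm_tri (u (N + N')%N) l l'; rewrite (nm_dist l (u _)); lra.
Qed.

Lemma tends_cst (V : normedModType C) (l : V) : tends (fun _ => l) l.
Proof. by move=> e e0; exists 0 => n _; rewrite subrr nm0 ltW. Qed.

Lemma tendsD (V : normedModType C) (u v : nat -> V) l l' :
  tends u l -> tends v l' -> tends (fun n => u n + v n) (l + l').
Proof.
move=> ul vl e e0; have e2 : 0 < e / 2 by rewrite divr_gt0.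
have [N HN] := ul _ e2; have [N' HN'] := vl _ e2.
exists (N + N')%N => n nN; rewrite opprD addrACA.
have := HN n (leq_trans (leq_addr _ _) nN).
have := HN' n (leq_trans (leq_addl _ _) nN).
by have := nmD (u n - l) (v n - l'); lra.
Qed.

Lemma tendsZ (V : normedModType C) (a : C) (u : nat -> V) l :
  tends u l -> tends (fun n => a *: u n) (a *: l).
Proof.
move=> ul e e0.
have e1 : 0 < e / (nm a + 1) by rewrite divr_gt0 // ltr_wpDl ?nm_ge0.
have [N HN] := ul _ e1; exists N => n /HN.
rewrite -scalerBr nmZ ler_pdivlMr ?ltr_wpDl ?nm_ge0 //.
by have := nm_ge0 (u n - l); have := nm_ge0 a; nra.
Qed.

Lemma tendsN (V : normedModType C) (u : nat -> V) l :
  tends u l -> tends (fun n => - u n) (- l).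
Proof. by move=> /tendsZ-/(_ (-1)); rewrite scaleN1r; under eq_fun do rewrite scaleN1r. Qed.

Lemma tendsB (V : normedModType C) (u v : nat -> V) l l' :
  tends u l -> tends v l' -> tends (fun n => u n - v n) (l - l').
Proof. by move=> ul /tendsN; exact: tendsD. Qed.

Lemma tends_bound (V : normedModType C) (u : nat -> V) l c M :
  tends u l -> (exists N, forall n, (N <= n)%N -> nm (u n - c) <= M) ->
  nm (l - c) <= M.
Proof.
move=> ul [N' HN']; rewrite leNgt; apply/negP => h.
have h4 : 0 < (nm (l - c) - M) / 2 by rewrite divr_gt0 // subr_gt0.
have [N HN] := ul _ h4.
have := HN (N + N')%N (leq_addr _ _); have := HN' (N + N')%N (leq_addl _ _).
by have := nm_tri (u (N + N')%N) l c; rewrite (nm_dist l (u _)); lra.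
Qed.

Lemma tends_bound0 (V : normedModType C) (u : nat -> V) l M :
  tends u l -> (exists N, forall n, (N <= n)%N -> nm (u n) <= M) -> nm l <= M.
Proof.
move=> ul [N H]; rewrite -[l]subr0; apply: tends_bound ul _.
by exists N => n; rewrite subr0; exact: H.
Qed.

Lemma tends_shift (V : normedModType C) (u : nat -> V) l :
  tends (fun n => u n.+1) l <-> tends u l.
Proof.
split=> H e e0; have [N HN] := H e e0.
  by exists N.+1 => -[//|n] nN; exact: HN.
by exists N => n nN; apply: HN; rewrite ltnW.
Qed.

Lemma half_pow_small (M e : R) : 0 < e -> exists N, forall n, (N <= n)%N ->
  M / 2 ^+ n <= e.
Proof.
move=> e0; exists (Num.truncn `|M / e|).+1 => n nN.
rewrite ler_pdivrMr ?exprn_gt0 // mulrC -ler_pdivrMr //.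
apply: le_trans (ler_norm _) _; apply: le_trans (ltW (truncnS_gt _)) _.
apply: (@le_trans _ _ n%:R); first by rewrite ler_nat.
by rewrite -natrX ler_nat ltnW // ltn_expl.
Qed.

Definition cauchys (u : nat -> C) :=
  forall e : R, 0 < e -> exists N, forall n k, (N <= n)%N -> (N <= k)%N ->
    nm (u n - u k) <= e.

Lemma real_cauchy_lim (u : nat -> R) :
  (forall e : R, 0 < e -> exists N, forall n k, (N <= n)%N -> (N <= k)%N ->
    `|u n - u k| <= e) ->
  exists l, forall e : R, 0 < e -> exists N, forall n, (N <= n)%N ->
    `|u n - l| <= e.
Proof.
move=> H.
have /R_complete cu : cauchy (u @ \oo).
  apply/cauchyP => e e0; have e2 : 0 < e / 2 by rewrite divr_gt0.
  have [N HN] := H _ e2; exists (u N); exists N => // n /= nN.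
  by rewrite /ball /=; apply: le_lt_trans (HN _ _ _ nN) _ => //; lra.
have {}cu : cvgn u by exact: cu.
exists (limn u) => e e0.
have /cvgrPdist_le/(_ e e0)[N _ HN] := cu.
by exists N => n nN; rewrite distrC; exact: HN.
Qed.

Lemma cauchys_lim (u : nat -> C) : cauchys u -> exists l, tends u l.
Proof.
move=> cu.
have [a Ha] : exists l, forall e : R, 0 < e -> exists N, forall n, (N <= n)%N ->
    `|complex.Re (u n : R[i]) - l| <= e.
  apply: real_cauchy_lim => e e0; have [N HN] := cu e e0.
  exists N => n k nN kN; apply: le_trans (HN n k nN kN).
  apply: le_trans (Re_le_nm _).
  by rewrite (raddfB (@complex.Re R)).
have [b Hb] : exists l, forall e : R, 0 < e -> exists N, forall n, (N <= n)%N ->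
    `|complex.Im (u n : R[i]) - l| <= e.
  apply: real_cauchy_lim => e e0; have [N HN] := cu e e0.
  exists N => n k nN kN; apply: le_trans (HN n k nN kN).
  apply: le_trans (Im_le_nm _).
  by rewrite (raddfB (@complex.Im R)).
exists (a +i* b)%C => e e0; have e2 : 0 < e / 2 by rewrite divr_gt0.
have [N HN] := Ha _ e2; have [N' HN'] := Hb _ e2.
exists (N + N')%N => n nN.
have := HN n (leq_trans (leq_addr _ _) nN).
have := HN' n (leq_trans (leq_addl _ _) nN).
have := nm_le_ReIm (u n - (a +i* b)%C).
rewrite (raddfB (@complex.Re R)) (raddfB (@complex.Im R)) /=; lra.
Qed.

(* The distance is summed along the sequence, so the limit is within s 0. *)
Lemma geometric_lim (u : nat -> C) (s : nat -> R) :
  (forall n, s n.+1 <= s n / 2) ->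
  (forall n, nm (u n.+1 - u n) <= s n / 2) ->
  exists2 l, tends u l & forall n, nm (u n - l) <= s n.
Proof.
move=> s2 us.
have s0 n : 0 <= s n by have := us n; have := nm_ge0 (u n.+1 - u n); lra.
have key n k : nm (u (n + k)%N - u n) <= s n - s (n + k)%N.
  elim: k => [|k IH]; first by rewrite addn0 !subrr nm0.
  rewrite addnS; apply: le_trans (nm_tri (u (n + k)%N) _ _) _.
  by have := us (n + k)%N; have := s2 (n + k)%N; lra.
have spow n : s n <= s 0 / 2 ^+ n.
  elim: n => [|n IH]; first by rewrite expr0 divr1.
  by rewrite exprS invfM mulrA mulrAC; have := s2 n; lra.
have key2 n k : nm (u (n + k)%N - u n) <= s n.
  by have := key n k; have := s0 (n + k)%N; lra.
have [l ul] : exists l, tends u l.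
  apply: cauchys_lim => e e0; have e2 : 0 < e / 2 by rewrite divr_gt0.
  have [N HN] := half_pow_small (s 0) e2; exists N => n k nN kN.
  have := key2 N (n - N)%N; have := key2 N (k - N)%N.
  rewrite !subnKC //; have := HN N (leqnn _); have := spow N.
  by have := nm_tri (u N) (u n) (u k); rewrite (nm_dist (u N)); lra.
exists l => // n; rewrite nm_dist; apply: tends_bound ul _.
by exists n => k nk; rewrite -(subnKC nk).
Qed.

(* Cousin's lemma for cells that are subdivided into cells of half the size. *)
Lemma cousin (T : Type) (ok : T -> Prop) (ch : T -> T -> Prop)
    (s : T -> R) (x : T -> C) (P : T -> Prop) :
  (forall t, ok t -> (forall t', ch t t' -> P t') -> P t) ->
  (forall t t', ok t -> ch t t' ->
     [/\ ok t', s t' <= s t / 2 & nm (x t' - x t) <= s t / 2]) ->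
  (forall (t : nat -> T) z, (forall n, ok (t n)) ->
     tends (x \o t) z -> exists2 d : R, 0 < d &
       forall t, ok t -> nm (x t - z) <= s t -> s t < d -> P t) ->
  forall t, ok t -> P t.
Proof.
move=> Psub chP Ploc t0 ok0; apply: contrapT => nP0.
(* A cell on which P fails has a child on which P fails. Iterating this choice gives failing cells
   that shrink to a point z, where the local hypothesis is contradicted. *)
have step (t : T) : exists t', ok t /\ ~ P t -> [/\ ch t t', ok t' & ~ P t'].
  have [[okt nPt]|] := pselect (ok t /\ ~ P t); last by exists t.
  have [t' [cht nPt']] : exists t', ch t t' /\ ~ P t'.
    apply: contrapT => H; apply: nPt; apply: Psub => // t' cht.
    by apply: contrapT => nPt'; apply: H; exists t'.
  by exists t' => _; split => //; have [] := chP _ _ okt cht.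
have [g Hg] := choice step.
pose t n := iter n g t0.
have tP n : ok (t n) /\ ~ P (t n).
  by elim: n => [//|n IH]; have [] := Hg _ IH.
have cht n : ch (t n) (t n.+1) by have [] := Hg _ (tP n).
have ss n : s (t n.+1) <= s (t n) / 2 by have [] := chP _ _ (tP n).1 (cht n).
have xs n : nm (x (t n.+1) - x (t n)) <= s (t n) / 2.
  by have [] := chP _ _ (tP n).1 (cht n).
have [z xz xzs] := @geometric_lim (x \o t) (s \o t) ss xs.
have [d d0 Hd] := Ploc t z (fun n => (tP n).1) xz.
have [N HN] : exists N, s (t N) < d.
  have d2 : 0 < d / 2 by rewrite divr_gt0.
  have [N HN] := half_pow_small (s (t 0)) d2; exists N.
  have : s (t N) <= s (t 0) / 2 ^+ N.
    elim: {HN} N => [|n IH]; first by rewrite expr0 divr1.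
    by rewrite exprS invfM mulrA mulrAC; have := ss n; lra.
  by have := HN N (leqnn _); lra.
have [okN nPN] := tP N; case: nPN; apply: Hd => //; exact: xzs.
Qed.

End RealNorm.

(** * The complex line integral along segments *)

Section LineIntegral.
Variable R : realType.
Local Notation C := (CC R).
Implicit Types (f g : C -> C) (a b c z w : C) (D : C -> Prop).

Definition mid a b : C := (a + b) / 2.

(** The recursion by halves turns additivity at the midpoint into an identity between sums, and the
    trapezoid rule is exact on affine functions, which [goursat] relies on. *)
Fixpoint trap f n a b : C :=
  if n is n'.+1 then trap f n' a (mid a b) + trap f n' (mid a b) b
  else (f a + f b) / 2 * (b - a).

(** The trapezoid sums evaluate f only at points obtained from the end points by repeated midpoints.
    Sets that are closed under midpoints and under limits of sequences thus play the role of closed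
    convex sets. *)
Definition midclosed D := forall a b, D a -> D b -> D (mid a b).

Definition seqclosed D :=
  forall u l, (forall n, D (u n)) -> tends u l -> D l.

Definition contD D f := forall z, D z -> forall e : R, 0 < e ->
  exists2 d : R, 0 < d & forall w, D w -> nm (w - z) < d -> nm (f w - f z) <= e.

Definition diffD D f z l := forall e : R, 0 < e ->
  exists2 d : R, 0 < d & forall w, D w -> nm (w - z) < d ->
    nm (f w - f z - l * (w - z)) <= e * nm (w - z).

(* The limit of the trapezoid sums over the dyadic subdivisions of the segment
   [a, b], and 0 if they diverge. *)
Definition intg f a b : C := xget 0 [set l | tends (fun n => trap f n a b) l].

Lemma midBl a b : mid a b - a = (b - a) / 2.
Proof. by rewrite /mid; field. Qed.

Lemma midBr a b : b - mid a b = (b - a) / 2.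
Proof. by rewrite /mid; field. Qed.

Lemma midC a b : mid a b = mid b a.
Proof. by rewrite /mid addrC. Qed.

Lemma nm_half a : nm (a / 2) = nm a / 2.
Proof. by rewrite nmM nmV nm_nat. Qed.

Lemma midclosedI D D' :
  midclosed D -> midclosed D' -> midclosed (fun w => D w /\ D' w).
Proof. by move=> h h' a b [? ?] [? ?]; split; [exact: h|exact: h']. Qed.

Lemma seqclosedI D D' :
  seqclosed D -> seqclosed D' -> seqclosed (fun w => D w /\ D' w).
Proof.
by move=> h h' u l ul tl; split; [apply: h tl|apply: h' tl] => n; case: (ul n).
Qed.

Lemma midclosed_ball z (r : R) : midclosed (fun w => nm (w - z) < r).
Proof.
move=> a b az bz.
have -> : mid a b - z = (a - z) / 2 + (b - z) / 2.
  by rewrite /mid; field.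
by apply: le_lt_trans (nmD _ _) _; rewrite !nm_half; lra.
Qed.

Lemma midclosed_cball z (r : R) : midclosed (fun w => nm (w - z) <= r).
Proof.
move=> a b az bz.
have -> : mid a b - z = (a - z) / 2 + (b - z) / 2.
  by rewrite /mid; field.
by apply: le_trans (nmD _ _) _; rewrite !nm_half; lra.
Qed.

Lemma seqclosed_cball z (r : R) : seqclosed (fun w => nm (w - z) <= r).
Proof. by move=> u l ul tl; apply: tends_bound tl _; exists 0. Qed.

Lemma trap_bound D f c (e : R) n a b : midclosed D ->
  (forall w, D w -> nm (f w - c) <= e) -> D a -> D b ->
  nm (trap f n a b - c * (b - a)) <= e * nm (b - a).
Proof.
move=> mD fe; elim: n a b => [|n IH] a b Da Db /=.
  have -> : (f a + f b) / 2 * (b - a) - c * (b - a) =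
    ((f a - c) / 2 + (f b - c) / 2) * (b - a) by field.
  rewrite nmM; apply: ler_wpM2r; first exact: nm_ge0.
  apply: le_trans (nmD _ _) _; rewrite !nm_half.
  by have := fe a Da; have := fe b Db; lra.
have -> : trap f n a (mid a b) + trap f n (mid a b) b - c * (b - a) =
   (trap f n a (mid a b) - c * (mid a b - a)) +
   (trap f n (mid a b) b - c * (b - mid a b)) by ring.
apply: le_trans (nmD _ _) _.
have := IH a (mid a b) Da (mD _ _ Da Db).
have := IH (mid a b) b (mD _ _ Da Db) Db.
by rewrite midBl midBr nm_half; lra.
Qed.

Lemma trap_bound0 D f (e : R) n a b : midclosed D ->
  (forall w, D w -> nm (f w) <= e) -> D a -> D b ->
  nm (trap f n a b) <= e * nm (b - a).
Proof.
move=> mD fe Da Db; rewrite -[trap _ _ _ _]subr0 -[X in _ - X](mul0r (b - a)).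
by apply: trap_bound Da Db => // w; rewrite subr0; exact: fe.
Qed.

Lemma trap_anti f n a b : trap f n b a = - trap f n a b.
Proof.
elim: n a b => [|n IH] a b /=; first by ring.
by rewrite (midC b a) (IH (mid a b) b) (IH a) -opprD addrC.
Qed.

Lemma trap_lin f g k n a b :
  trap (fun w => k * f w + g w) n a b = k * trap f n a b + trap g n a b.
Proof. by elim: n a b => [|n IH] a b /=; [ring|rewrite !IH; ring]. Qed.

Lemma trap_affine (k l : C) n a b :
  trap (fun w => k + l * w) n a b = k * (b - a) + l * (b ^+ 2 - a ^+ 2) / 2.
Proof.
elim: n a b => [|n IH] a b /=; first by field.
by rewrite !IH; field.
Qed.

Lemma trap_scale f (p q : C) n a b :
  trap f n (p + q * a) (p + q * b) = trap (fun w => q * f (p + q * w)) n a b.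
Proof.
elim: n a b => [|n IH] a b /=; first by field.
have -> : mid (p + q * a) (p + q * b) = p + q * mid a b.
  by rewrite /mid; field.
by rewrite !IH.
Qed.

Lemma trap_ext D f g n a b : midclosed D -> (forall w, D w -> f w = g w) ->
  D a -> D b -> trap f n a b = trap g n a b.
Proof.
move=> mD fg; elim: n a b => [|n IH] a b Da Db /=; first by rewrite !fg.
by have Dm := mD _ _ Da Db; rewrite !IH.
Qed.

Lemma intgP f a b l : tends (fun n => trap f n a b) l -> intg f a b = l.
Proof.
rewrite /intg => tl; case: xgetP => [l' _ tl'|/(_ l)//].
exact: tends_uniq tl' tl.
Qed.

(** An instance of [cousin]: the children of a segment are its two halves, the size is its length
    and the base point is its first end. *)
Lemma cousin_seg D (P : C -> C -> Prop) : midclosed D -> seqclosed D ->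
  (forall a b, D a -> D b -> P a (mid a b) -> P (mid a b) b -> P a b) ->
  (forall z, D z -> exists2 d : R, 0 < d &
     forall a b, D a -> D b -> nm (a - z) <= nm (b - a) -> nm (b - a) < d ->
       P a b) ->
  forall a b, D a -> D b -> P a b.
Proof.
move=> mD sD Psub Ploc a b Da Db.
apply: (@cousin R (C * C)%type (fun t => D t.1 /\ D t.2)
  (fun t t' => t' = (t.1, mid t.1 t.2) \/ t' = (mid t.1 t.2, t.2))
  (fun t => nm (t.2 - t.1)) fst (fun t => P t.1 t.2) _ _ _ (a, b)) => //.
- move=> [u v] /= [Du Dv] H; apply: Psub => //.
    exact: (H (u, mid u v) (or_introl _ erefl)).
  exact: (H (mid u v, v) (or_intror _ erefl)).
- move=> [u v] t' /= [Du Dv] [->|->] /=; split; try by split; auto.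
  + by rewrite midBl nm_half.
  + by rewrite subrr nm0 divr_ge0 ?nm_ge0.
  + by rewrite midBr nm_half.
  + by rewrite midBl nm_half.
- move=> t z Dt tz; have Dz : D z by apply: sD tz => n; exact: (Dt n).1.
  have [d d0 Hd] := Ploc z Dz.
  by exists d => // -[u v] /= [Du Dv]; exact: Hd.
Qed.

(** The Cauchy bound is proportional to the length of the segment, so it adds up over the two
    halves; [cousin_seg] reduces it to short segments, on which f is nearly constant. *)
Lemma trap_tends D f a b : midclosed D -> seqclosed D -> contD D f ->
  D a -> D b -> tends (fun n => trap f n a b) (intg f a b).
Proof.
move=> mD sD cf Da Db.
have [l tl] : exists l, tends (fun n => trap f n a b) l; last by rewrite (intgP tl).
apply: cauchys_lim => e e0.
pose k := e / (nm (b - a) + 1).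
have k0 : 0 < k by rewrite divr_gt0 // ltr_wpDl ?nm_ge0.
have H : forall u v, D u -> D v -> exists N, forall n m, (N <= n)%N ->
    (N <= m)%N -> nm (trap f n u v - trap f m u v) <= k * nm (v - u).
  apply: (cousin_seg mD sD).
    move=> u v Du Dv [N HN] [N' HN']; exists (N + N').+1.
    move=> [//|n] [//|m] nN mN /=.
    have h := HN n m (leq_trans (leq_addr _ _) nN) (leq_trans (leq_addr _ _) mN).
    have := HN' n m (leq_trans (leq_addl _ _) nN) (leq_trans (leq_addl _ _) mN).
    move: h; rewrite midBl midBr nm_half opprD addrACA => h h'.
    by apply: le_trans (nmD _ _) _; lra.
  move=> z Dz; have k2 : 0 < k / 2 by rewrite divr_gt0.
  have [d d0 Hd] := cf z Dz _ k2; exists (d / 2); first by rewrite divr_gt0.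
  move=> u v Du Dv az bad; exists 0 => n m _ _.
  have mD' := midclosedI mD (@midclosed_ball z d).
  have bz : nm (v - z) < d.
    by apply: le_lt_trans (nm_tri u _ _) _; lra.
  have az' : nm (u - z) < d by lra.
  have B n' := @trap_bound _ f (f z) _ n' u v mD'
    (fun w Dw => Hd w Dw.1 Dw.2) (conj Du az') (conj Dv bz).
  have := B n; have := B m; have := nm_tri (f z * (v - u)) (trap f n u v) (trap f m u v).
  by rewrite (nm_dist (f z * (v - u))); lra.
have [N HN] := H a b Da Db; exists N => n m nN mN; apply: le_trans (HN n m nN mN) _.
rewrite /k mulrAC ler_pdivrMr ?ltr_wpDl ?nm_ge0 //.
by have := nm_ge0 (b - a); nra.
Qed.

Lemma intg_bound D f c (e : R) a b : midclosed D -> seqclosed D -> contD D f ->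
  (forall w, D w -> nm (f w - c) <= e) -> D a -> D b ->
  nm (intg f a b - c * (b - a)) <= e * nm (b - a).
Proof.
move=> mD sD cf fe Da Db; apply: tends_bound (trap_tends mD sD cf Da Db) _.
by exists 0 => n _; exact: trap_bound mD fe Da Db.
Qed.

(** Convergence of the sums comes from D, the bound from a second set D', such as the part of D in a
    small ball. Local estimates take this form. *)
Lemma intg_bound_sub D D' f c (e : R) a b :
  midclosed D -> seqclosed D -> contD D f -> midclosed D' ->
  (forall w, D' w -> nm (f w - c) <= e) -> D a -> D b -> D' a -> D' b ->
  nm (intg f a b - c * (b - a)) <= e * nm (b - a).
Proof.
move=> mD sD cf mD' fe Da Db D'a D'b.
apply: tends_bound (trap_tends mD sD cf Da Db) _.
by exists 0 => n _; exact: trap_bound mD' fe D'a D'b.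
Qed.

Lemma intg_bound0_sub D D' f (e : R) a b :
  midclosed D -> seqclosed D -> contD D f -> midclosed D' ->
  (forall w, D' w -> nm (f w) <= e) -> D a -> D b -> D' a -> D' b ->
  nm (intg f a b) <= e * nm (b - a).
Proof.
move=> mD sD cf mD' fe Da Db D'a D'b.
rewrite -[intg _ _ _]subr0 -[X in _ - X](mul0r (b - a)).
apply: (intg_bound_sub mD sD cf mD') => // w; rewrite subr0; exact: fe.
Qed.

Lemma intg_anti D f a b : midclosed D -> seqclosed D -> contD D f ->
  D a -> D b -> intg f b a = - intg f a b.
Proof.
move=> mD sD cf Da Db; apply: intgP; under eq_fun do rewrite trap_anti.
exact/tendsN/(trap_tends mD sD cf).
Qed.

Lemma intg_mid D f a b : midclosed D -> seqclosed D -> contD D f ->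
  D a -> D b -> intg f a b = intg f a (mid a b) + intg f (mid a b) b.
Proof.
move=> mD sD cf Da Db; have Dm := mD _ _ Da Db.
by apply: intgP; apply/tends_shift/tendsD; exact: (trap_tends mD sD cf).
Qed.

Lemma intg_lin D f g k a b : midclosed D -> seqclosed D ->
  contD D f -> contD D g -> D a -> D b ->
  intg (fun w => k * f w + g w) a b = k * intg f a b + intg g a b.
Proof.
move=> mD sD cf cg Da Db; apply: intgP; under eq_fun do rewrite trap_lin.
by apply: tendsD; [apply: tendsZ|]; exact: (trap_tends mD sD).
Qed.

Lemma intg_affine (k l : C) a b :
  intg (fun w => k + l * w) a b = k * (b - a) + l * (b ^+ 2 - a ^+ 2) / 2.
Proof.
by apply: intgP; under eq_fun do rewrite trap_affine; exact: tends_cst.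
Qed.

Lemma intg_scale f (p q : C) a b :
  intg f (p + q * a) (p + q * b) = intg (fun w => q * f (p + q * w)) a b.
Proof.
rewrite /intg; congr (xget _ _); apply/funext => l /=.
by congr (tends _ _); apply/funext => n; rewrite trap_scale.
Qed.

Lemma intg_ext D f g a b : midclosed D -> (forall w, D w -> f w = g w) ->
  D a -> D b -> intg f a b = intg g a b.
Proof.
move=> mD fg Da Db; rewrite /intg; congr (xget _ _); apply/funext => l /=.
by congr (tends _ _); apply/funext => n; exact: (trap_ext _ mD fg).
Qed.

Lemma le_eps_eq0 a (M : R) : (forall e : R, 0 < e -> nm a <= e * M) -> a = 0.
Proof.
move=> H; apply: nm_le0; rewrite leNgt; apply/negP => a0.
have M0 : 0 < M by have := H 1 ltr01; rewrite mul1r; lra.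
have e0 : 0 < nm a / (2 * M) by rewrite divr_gt0 // mulr_gt0.
have := H _ e0; rewrite invfM mulrA mulfVK ?gt_eqF //; lra.
Qed.

Lemma intg_ftc D (F f : C -> C) a b : midclosed D -> seqclosed D -> contD D f ->
  (forall z, D z -> diffD D F z (f z)) -> D a -> D b ->
  intg f a b = F b - F a.
Proof.
move=> mD sD cf dF Da Db; apply/eqP; rewrite -subr_eq0; apply/eqP.
(* The constant is 1 + 2 + 1: the variation of f along a short segment, and the errors of the
   first-order expansion of F at b and at a, where b and a are within 2 |b - a| and |b - a| of z. *)
apply: (@le_eps_eq0 _ (4 * nm (b - a))) => e e0; rewrite mulrA.
move: a b Da Db; apply: (cousin_seg mD sD) => [a b Da Db|z Dz].
  rewrite midBl midBr nm_half (intg_mid mD sD cf Da Db) => h1 h2.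
  have -> : intg f a (mid a b) + intg f (mid a b) b - (F b - F a) =
    intg f a (mid a b) - (F (mid a b) - F a) +
    (intg f (mid a b) b - (F b - F (mid a b))) by ring.
  by apply: le_trans (nmD _ _) _; lra.
have [d d0 Hd] := cf z Dz _ e0; have [d' d'0 Hd'] := dF z Dz _ e0.
exists (Num.min d d' / 2); first by rewrite divr_gt0 // lt_min d0.
move=> a b Da Db az; rewrite ltr_pdivlMr // lt_min => /andP[h1 h2].
have bz : nm (b - z) <= 2 * nm (b - a).
  by apply: le_trans (nm_tri a _ _) _; lra.
have mD' := midclosedI mD (@midclosed_ball z d).
have ad : nm (a - z) < d by lra.
have bd : nm (b - z) < d by lra.
have := @intg_bound_sub _ _ f (f z) _ a b mD sD cf mD'
  (fun w Dw => Hd w Dw.1 Dw.2) Da Db (conj Da ad) (conj Db bd).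
have h3 : nm (a - z) < d' by lra.
have h4 : nm (b - z) < d' by lra.
have := Hd' a Da h3; have := Hd' b Db h4.
set Xb := (F b - _ - _); set Xa := (F a - _ - _); set Y := (intg _ _ _ - _).
move=> hb ha hY.
have -> : intg f a b - (F b - F a) = Y - (Xb - Xa).
  by rewrite /Y /Xa /Xb; ring.
have := nmB Y (Xb - Xa); have := nmB Xb Xa; have := nm_ge0 (b - a).
nra.
Qed.

End LineIntegral.

(** * Goursat's theorem and Cauchy's estimates in one variable *)

Section Differentiable.
Variable R : realType.
Local Notation C := (CC R).

Lemma diff_eps (V W : normedModType C) (f : V -> W) z : differentiable f z ->
  forall e : R, 0 < e -> exists2 d : R, 0 < d & forall w, nm (w - z) < d ->
    nm (f w - f z - 'd f z (w - z)) <= e * nm (w - z).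
Proof.
move=> /diff_locallyP[_ /eqaddoP H] e e0.
have re0 : 0 < rc e by rewrite -rc0 rc_lt.
have /nearP[d d0 Hd] := H _ re0; exists d => // w wz.
have := Hd (w - z); rewrite subr0 => /(_ wz).
rewrite !fctE /= subrK opprD addrA [X in `|X|]/=.
by rewrite !nmE -rcM rc_le.
Qed.

Lemma eps_diff (V W : normedModType C) (f : V -> W) z (L : {linear V -> W})
    (k : R) : (forall v, nm (L v) <= k * nm v) ->
  (forall e : R, 0 < e -> exists2 d : R, 0 < d & forall w, nm (w - z) < d ->
    nm (f w - f z - L (w - z)) <= e * nm (w - z)) ->
  differentiable f z /\ 'd f z = L :> (V -> W).
Proof.
move=> Lk H.
have cL : continuous L.
  apply/(linear_bounded_continuous L)/linear_boundedP.
  exists (rc k); split; first exact/complex_realP/(ex_intro _ k).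
  move=> r kr v; apply: (@le_trans _ _ (rc k * `|v|)).
    by rewrite !nmE -rcM rc_le.
  by apply: ler_wpM2r; [exact: normr_ge0|exact: ltW].
have fE : f \o shift z = cst (f z) + L +o_ 0 id.
  apply/eqaddoP => _ /gt0_rc[e e0 ->]; have [d d0 Hd] := H e e0.
  apply/nearP; exists d => // h; rewrite subr0 => hd.
  have := Hd (h + z); rewrite addrK => /(_ hd).
  by rewrite !fctE /= opprD addrA !nmE -rcM rc_le.
have dE : 'd f z = L :> (V -> W) by apply: diff_unique.
split => //; apply/diff_locallyP; rewrite dE; split => //.
Qed.

Lemma differentiable_idfun (V : normedModType C) (z : V) :
  differentiable (fun w : V => w) z.
Proof. exact: (@ex_diff _ _ _ _ _ _ _ (is_diff_id z)). Qed.

Lemma nm3_le (V : normedModType C) (x y z : V) (k p q r : R) :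
  nm x <= k * p -> nm y <= k * q -> nm z <= k * r ->
  nm (x + y + z) <= k * (p + q + r).
Proof.
by move=> hx hy hz; have := nmD (x + y) z; have := nmD x y; lra.
Qed.

Lemma nm4_le (V : normedModType C) (x y z t : V) (k : R) :
  nm x <= k -> nm y <= k -> nm z <= k -> nm t <= k ->
  nm (x + y + z + t) <= 4 * k.
Proof.
move=> hx hy hz ht; have := nmD (x + y + z) t; have := nmD (x + y) z.
by have := nmD x y; lra.
Qed.

Lemma diff_contD (f : C -> C) (D : C -> Prop) :
  (forall z, D z -> differentiable (f : C -> C^o) z) -> contD D f.
Proof.
move=> df z Dz e e0.
have /differentiable_continuous/cvgrPdist_le H := df z Dz.
have re0 : 0 < rc e by rewrite -rc0 rc_lt.
have /nearP[d d0 Hd] := H _ re0; exists d => // w _ /Hd.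
by rewrite distrC nmE rc_le.
Qed.

Lemma diff_diffD (f : C -> C) (D : C -> Prop) z :
  differentiable (f : C -> C^o) z -> diffD D f z ('d (f : C -> C^o) z 1).
Proof.
move=> df e e0; have [d d0 Hd] := diff_eps df e0.
exists d => // w _ /Hd.
have -> : 'd (f : C -> C^o) z (w - z) = 'd (f : C -> C^o) z 1 * (w - z).
  rewrite -[X in 'd _ _ X]mulr1 -[_ * 1]/((w - z) *: (1 : C^o)) linearZ /=.
  by rewrite mulrC.
by [].
Qed.

End Differentiable.

(** * Goursat's theorem by subdivision of triangles *)

Section Cauchy.
Variable R : realType.
Local Notation C := (CC R).
Implicit Types (f g : C -> C) (a b c z w : C) (D : C -> Prop).

Definition holD D f := forall z, D z -> differentiable (f : C -> C^o) z.

Definition tri f a b c := intg f a b + intg f b c + intg f c a.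
Definition perim a b c : R := nm (b - a) + nm (c - b) + nm (a - c).

Lemma perim_ge0 a b c : 0 <= perim a b c.
Proof. by rewrite !addr_ge0 ?nm_ge0. Qed.

(** Goursat's subdivision as an instance of [cousin]: the children are the three corner triangles
    and the middle one, the size is the perimeter and the base point is the first vertex. *)
Lemma cousin_tri D (P : C -> C -> C -> Prop) : midclosed D -> seqclosed D ->
  (forall a b c, D a -> D b -> D c ->
     P a (mid a b) (mid c a) -> P (mid a b) b (mid b c) ->
     P (mid c a) (mid b c) c -> P (mid a b) (mid b c) (mid c a) -> P a b c) ->
  (forall z, D z -> exists2 d : R, 0 < d &
     forall a b c, D a -> D b -> D c -> nm (a - z) <= perim a b c ->
       perim a b c < d -> P a b c) ->
  forall a b c, D a -> D b -> D c -> P a b c.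
Proof.
move=> mD sD Psub Ploc a b c Da Db Dc.
pose sub (t : C * C * C) := let: (a, b, c) := t in
  [:: (a, mid a b, mid c a); (mid a b, b, mid b c); (mid c a, mid b c, c);
      (mid a b, mid b c, mid c a)].
apply: (@cousin R (C * C * C)%type (fun t => [/\ D t.1.1, D t.1.2 & D t.2])
  (fun t t' => t' \in sub t) (fun t => perim t.1.1 t.1.2 t.2) (fun t => t.1.1)
  (fun t => P t.1.1 t.1.2 t.2) _ _ _ (a, b, c)) => //.
- move=> [[x y] z] /= [Dx Dy Dz] H.
  apply: Psub => //.
  + by apply: (H (x, mid x y, mid z x)); rewrite !inE eqxx ?orbT.
  + by apply: (H (mid x y, y, mid y z)); rewrite !inE eqxx ?orbT.
  + by apply: (H (mid z x, mid y z, z)); rewrite !inE eqxx ?orbT.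
  + by apply: (H (mid x y, mid y z, mid z x)); rewrite !inE eqxx ?orbT.
- move=> [[x y] z] t' /= [Dx Dy Dz].
  have half (u v : C) : u * 2 = v \/ u * 2 = - v -> nm u = nm v / 2.
    by case=> h; [rewrite -h|rewrite -(nmN v) -h]; rewrite nmM nm_nat mulfK.
  have hp u v w u' v' w' : nm (v' - u') = nm (v - u) / 2 ->
      nm (w' - v') = nm (w - v) / 2 -> nm (u' - w') = nm (u - w) / 2 ->
      perim u' v' w' <= perim u v w / 2.
    by rewrite /perim => -> -> ->; lra.
  have hp' u v w u' v' w' : nm (v' - u') = nm (u - w) / 2 ->
      nm (w' - v') = nm (v - u) / 2 -> nm (u' - w') = nm (w - v) / 2 ->
      perim u' v' w' <= perim u v w / 2.
    by rewrite /perim => -> -> ->; lra.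
  have [h1 h2 h3] := And3 (nm_ge0 (y - x)) (nm_ge0 (z - y)) (nm_ge0 (x - z)).
  rewrite !inE => /or4P[]/eqP-> /=; split; try by split; auto.
  + by apply: hp; apply: half; rewrite /mid; left; field.
  + by rewrite subrr nm0 divr_ge0 // perim_ge0.
  + by apply: hp; apply: half; rewrite /mid; left; field.
  + by rewrite midBl nm_half /perim; lra.
  + by apply: hp; apply: half; rewrite /mid; left; field.
  + by rewrite -(nmN (_ - _)) opprB midBr nm_half /perim; lra.
  + by apply: hp'; apply: half; rewrite /mid; right; field.
  + by rewrite midBl nm_half /perim; lra.
- move=> t z Dt tz; have Dz : D z by apply: sD tz => n; have [] := Dt n.
  have [d d0 Hd] := Ploc z Dz.
  by exists d => // -[[u v] w] /= [Du Dv Dw]; exact: Hd.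
Qed.

Lemma tri_sub D f a b c : midclosed D -> seqclosed D -> contD D f ->
  D a -> D b -> D c ->
  tri f a b c = tri f a (mid a b) (mid c a) + tri f (mid a b) b (mid b c) +
    tri f (mid c a) (mid b c) c + tri f (mid a b) (mid b c) (mid c a).
Proof.
move=> mD sD cf Da Db Dc; rewrite /tri.
have [h1 h2 h3] := And3 (mD _ _ Da Db) (mD _ _ Db Dc) (mD _ _ Dc Da).
rewrite (intg_mid mD sD cf Da Db) (intg_mid mD sD cf Db Dc).
rewrite (intg_mid mD sD cf Dc Da) (intg_anti mD sD cf h1 h2).
rewrite (intg_anti mD sD cf h1 h3) (intg_anti mD sD cf h2 h3).
move: (intg f a _) (intg f _ b) (intg f b _) (intg f _ c) (intg f c _).
move: (intg f _ a) (intg f (mid a b) _) (intg f (mid a b) _) => *.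
move: (intg f _ _) => *; ring.
Qed.

Lemma tri_affine (k l : C) a b c : tri (fun w => k + l * w) a b c = 0.
Proof. by rewrite /tri !intg_affine; field. Qed.

(** Subtracting the first-order Taylor polynomial at z leaves the triangle integral unchanged, by
    [tri_affine], and the remainder r is at most 2 e p on a triangle of perimeter p close to z. The
    resulting bound is quadratic in p, so four triangles of perimeter p / 2 reproduce it exactly. *)
Lemma goursat D f a b c : midclosed D -> seqclosed D -> holD D f ->
  D a -> D b -> D c -> tri f a b c = 0.
Proof.
move=> mD sD df Da Db Dc; have cf := diff_contD df.
apply: (@le_eps_eq0 _ _ (2 * perim a b c ^+ 2)) => e e0.
move: a b c Da Db Dc; apply: (cousin_tri mD sD) => [a b c Da Db Dc|z Dz].
  rewrite (tri_sub mD sD cf Da Db Dc) => h1 h2 h3 h4.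
  have half (u v : C) : u * 2 = v \/ u * 2 = - v -> nm u = nm v / 2.
    by case=> h; [rewrite -h|rewrite -(nmN v) -h]; rewrite nmM nm_nat mulfK.
  have hp (u v w u' v' w' : C) : nm (v' - u') = nm (v - u) / 2 ->
      nm (w' - v') = nm (w - v) / 2 -> nm (u' - w') = nm (u - w) / 2 ->
      perim u' v' w' = perim u v w / 2.
    by rewrite /perim => -> -> ->; rewrite -!mulrDl.
  have hp' (u v w u' v' w' : C) : nm (v' - u') = nm (u - w) / 2 ->
      nm (w' - v') = nm (v - u) / 2 -> nm (u' - w') = nm (w - v) / 2 ->
      perim u' v' w' = perim u v w / 2.
    by rewrite /perim => -> -> ->; rewrite -!mulrDl -addrA [in LHS]addrC.
  move: h1 h2 h3 h4.
  rewrite (@hp a b c a (mid a b) (mid c a)); try by apply: half; rewrite /mid; left; field.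
  rewrite (@hp a b c (mid a b) b (mid b c)); try by apply: half; rewrite /mid; left; field.
  rewrite (@hp a b c (mid c a) (mid b c) c); try by apply: half; rewrite /mid; left; field.
  rewrite (@hp' a b c (mid a b) (mid b c) (mid c a)); try by apply: half; rewrite /mid; right; field.
  rewrite expr_div_n => h1 h2 h3 h4.
  apply: le_trans (nm4_le h1 h2 h3 h4) _.
  by move: (perim a b c) => p; rewrite le_eqVlt; apply/orP; left; apply/eqP; field.
have /(_ D)/(_ e e0)[d d0 Hd] := diff_diffD _ (df z Dz).
set l := 'd _ z 1 in Hd.
exists (d / 3); first by rewrite divr_gt0.
move=> a b c Da Db Dc; set p := perim a b c => az pd.
have p0 : 0 <= p := perim_ge0 a b c.
have mD' := midclosedI mD (@midclosed_cball R z (2 * p)).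
pose r w := f w - f z - l * (w - z).
have aff w : (f z - l * z) + l * w = - (r w) + f w by rewrite /r; ring.
have dr : holD D r.
  move=> w Dw; rewrite /r; apply: differentiableB.
    by apply: differentiableB; [exact: df|exact: differentiable_cst].
  apply: differentiableM; first exact: differentiable_cst.
  by apply: differentiableB; [exact: differentiable_idfun|exact: differentiable_cst].
have cr := diff_contD dr.
have fE u v : D u -> D v -> intg f u v = intg (fun w => f z - l * z + l * w) u v + intg r u v.
  move=> Du Dv.
  have -> : intg f u v = intg (fun w => 1 * (f z - l * z + l * w) + r w) u v.
    by apply: (intg_ext (D := D)) => // w _; rewrite /r; ring.
  rewrite (intg_lin 1 mD sD) ?mul1r //.
  have -> : (fun w => f z - l * z + l * w) = (fun w => f w - r w).
    by apply/funext => w; rewrite aff addrC.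
  by apply: diff_contD => w Dw; apply: differentiableB; [exact: df|exact: dr].
have -> : tri f a b c = tri r a b c.
  rewrite /tri (fE a b Da Db) (fE b c Db Dc) (fE c a Dc Da).
  have E (x1 y1 x2 y2 x3 y3 : C) :
    (x1 + y1) + (x2 + y2) + (x3 + y3) = (x1 + x2 + x3) + (y1 + y2 + y3) by ring.
  by rewrite E [X in X + _](tri_affine _ _ a b c) add0r.
have bz : nm (b - z) <= 2 * p.
  apply: le_trans (nm_tri a _ _) _; rewrite /p /perim in az *.
  by have := nm_ge0 (c - b); have := nm_ge0 (a - c); lra.
have cz : nm (c - z) <= 2 * p.
  apply: le_trans (nm_tri a _ _) _; rewrite /p /perim in az *.
  by have := nm_ge0 (c - b); have := nm_ge0 (b - a); rewrite (nm_dist c); lra.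
have az2 : nm (a - z) <= 2 * p by lra.
have rb w : D w /\ nm (w - z) <= 2 * p -> nm (r w) <= e * (2 * p).
  move=> [Dw wz]; apply: le_trans (Hd w Dw _) _; first by lra.
  by rewrite ler_pM2l.
have B := intg_bound0_sub mD sD cr mD' rb.
have -> : e * (2 * p ^+ 2) = e * (2 * p) * p by ring.
apply: nm3_le; exact: B.
Qed.

End Cauchy.

(** * Cauchy's integral formula on a square contour *)

Section CauchyFormula.
Variable R : realType.
Local Notation C := (CC R).
Implicit Types (f g : C -> C) (a b c z w u v : C) (D : C -> Prop).

Definition ReC z : R := complex.Re (z : R[i]).
Definition ImC z : R := complex.Im (z : R[i]).

Lemma ReCD z w : ReC (z + w) = ReC z + ReC w.
Proof. exact: (raddfD (@complex.Re R)). Qed.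

Lemma ReCB z w : ReC (z - w) = ReC z - ReC w.
Proof. exact: (raddfB (@complex.Re R)). Qed.

Lemma ReC_rc t z : ReC (rc t * z) = t * ReC z.
Proof. by rewrite /ReC; case: z => x y /=; rewrite mul0r subr0. Qed.

Lemma ReC_half z : ReC (z / 2) = ReC z / 2.
Proof. by rewrite mulrC -rc_nat -rcV ReC_rc mulrC. Qed.

Lemma ReC_nm z : ReC z <= nm z.
Proof. exact: le_trans (ler_norm _) (Re_le_nm z). Qed.

Lemma nm_sqr z : nm z ^+ 2 = ReC z ^+ 2 + ImC z ^+ 2.
Proof.
have /complexI : rc (nm z ^+ 2) = rc (ReC z ^+ 2 + ImC z ^+ 2).
  by rewrite rcX -nmE /rc (add_Re2_Im2 (z : R[i])).
by [].
Qed.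

Definition halfplane z u (k : R) w := k <= ReC ((w - z) * u).

Lemma midclosed_halfplane z u k : midclosed (halfplane z u k).
Proof.
move=> a b; rewrite /halfplane => ha hb.
have -> : (mid a b - z) * u = (a - z) * u / 2 + (b - z) * u / 2.
  by rewrite /mid; field.
by rewrite ReCD !ReC_half; lra.
Qed.

Lemma seqclosed_halfplane z u k : seqclosed (halfplane z u k).
Proof.
move=> x l Hx xl; rewrite /halfplane leNgt; apply/negP => h.
have e0 : 0 < (k - ReC ((l - z) * u)) / 2 / (nm u + 1).
  by rewrite !divr_gt0 ?subr_gt0 // ltr_wpDl ?nm_ge0.
have [N HN] := xl _ e0; have := HN N (leqnn _); have := Hx N.
rewrite /halfplane.
have -> : (x N - z) * u = (x N - l) * u + (l - z) * u by ring.
rewrite ReCD ler_pdivlMr ?ltr_wpDl ?nm_ge0 //.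
have := ReC_nm ((x N - l) * u); rewrite nmM.
by have := nm_ge0 (x N - l); have := nm_ge0 u; nra.
Qed.

(** The real functional w |-> Re (w [normal v]) takes the value 1 at v and at i v when |v| = 1, so
    its level line carries the side of the square from v to i v. *)
Definition normal v : C := (1 - ii R) / v.

Lemma iiM : ii R * ii R = - 1.
Proof. by rewrite -expr2; exact: (sqr_i R). Qed.

Lemma nm_normal v : nm v = 1 -> nm (normal v) <= 2.
Proof.
move=> v1; rewrite /normal nmM nmV v1 invr1 mulr1.
by apply: le_trans (nmB _ _) _; rewrite nm1 nm_ii.
Qed.

Lemma normal_l v : nm v = 1 -> ReC (v * normal v) = 1.
Proof.
move=> v1; have v0 : v != 0 by rewrite -nm_gt0 v1.
by rewrite /normal mulrC divfK // ReCB [ReC 1]/= [ReC (ii R)]/= subr0.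
Qed.

Lemma normal_r v : nm v = 1 -> ReC (ii R * v * normal v) = 1.
Proof.
move=> v1; have v0 : v != 0 by rewrite -nm_gt0 v1.
have -> : ii R * v * normal v = ii R * (1 - ii R) by rewrite /normal; field.
by rewrite mulrBr mulr1 iiM opprK ReCD [ReC 1]/= [ReC (ii R)]/= add0r.
Qed.

(** The piece of the closed unit disc beyond the chord from v to i v: a set containing that side of
    the square, closed under midpoints, and at a distance from all z near 0. *)
Definition cap v w := nm w <= 1 /\ halfplane 0 (normal v) 1 w.

Lemma midclosed_cap v : midclosed (cap v).
Proof.
apply: midclosedI; last exact: midclosed_halfplane.
by have := @midclosed_cball R 0 1; under eq_fun do rewrite subr0.
Qed.

Lemma seqclosed_cap v : seqclosed (cap v).
Proof.
apply: seqclosedI; last exact: seqclosed_halfplane.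
by have := @seqclosed_cball R 0 1; under eq_fun do rewrite subr0.
Qed.

Lemma cap_l v : nm v = 1 -> cap v v.
Proof. by move=> v1; rewrite /cap /halfplane subr0 v1 normal_l. Qed.

Lemma cap_r v : nm v = 1 -> cap v (ii R * v).
Proof.
by move=> v1; rewrite /cap /halfplane subr0 nmM nm_ii v1 mulr1 normal_r.
Qed.

(** As [normal v] has norm at most 2, Re ((w - z) [normal v]) is at most 2 |w - z| and at least 1 -
    2 |z|, hence at least 1 / 2. *)
Lemma cap_dist v w z : nm v = 1 -> nm z <= 1 / 4 -> cap v w ->
  1 / 4 <= nm (w - z).
Proof.
move=> v1 hz [_]; rewrite /halfplane subr0 => hw.
have := ReC_nm ((w - z) * normal v); rewrite nmM mulrBl ReCB.
have := ReC_nm (z * normal v); rewrite nmM.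
have := nm_normal v1; have := nm_ge0 z; have := nm_ge0 (w - z); nra.
Qed.

Lemma cap_neq v w z : nm v = 1 -> nm z <= 1 / 4 -> cap v w -> w - z != 0.
Proof.
by move=> v1 hz cw; rewrite -nm_gt0; apply: lt_le_trans (cap_dist v1 hz cw).
Qed.

Lemma nm_iiX k : nm (ii R ^+ k) = 1.
Proof. by rewrite nmX nm_ii expr1n. Qed.

(** The contour integral along the square with vertices 1, i, -1, -i, in place of the unit
    circle. *)
Definition diamond g := \sum_(k < 4) intg g (ii R ^+ k) (ii R ^+ k.+1).

(** There are four sides, each of length at most 2. *)
Lemma diamond_bound g (M : R) :
  (forall k, contD (cap (ii R ^+ k)) g) ->
  (forall k w, cap (ii R ^+ k) w -> nm (g w) <= M) -> nm (diamond g) <= 8 * M.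
Proof.
move=> cg gM; apply: le_trans (nm_sum _ _) _.
apply: (@le_trans _ _ (\sum_(k < 4) M * 2)); last first.
  by rewrite sumr_const card_ord -mulrnAr; rewrite (_ : 2 *+ 4 = 8); [rewrite mulrC|ring].
apply: ler_sum => k _; have n1 := nm_iiX k.
have cr : cap (ii R ^+ k) (ii R ^+ k.+1) by rewrite exprS; exact: cap_r.
have M0 : 0 <= M := le_trans (nm_ge0 _) (gM k _ cr).
apply: le_trans (intg_bound0_sub (@midclosed_cap _) (@seqclosed_cap _) (cg k)
  (@midclosed_cap _) (gM k) (cap_l n1) cr (cap_l n1) cr) _.
apply: ler_wpM2l => //; apply: le_trans (nmB _ _) _.
by rewrite !nm_iiX; lra.
Qed.

Lemma diamond_lin g h (k : C) :
  (forall k, contD (cap (ii R ^+ k)) g) -> (forall k, contD (cap (ii R ^+ k)) h) ->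
  diamond (fun w => k * g w + h w) = k * diamond g + diamond h.
Proof.
move=> cg ch; rewrite /diamond mulr_sumr -big_split /=.
apply: eq_bigr => j _; have n1 := nm_iiX j.
apply: (intg_lin k (@midclosed_cap _) (@seqclosed_cap _) (cg j) (ch j)).
  exact: cap_l.
by rewrite exprS; exact: cap_r.
Qed.

Lemma diamond_ext g h :
  (forall k w, cap (ii R ^+ k) w -> g w = h w) -> diamond g = diamond h.
Proof.
move=> gh; apply: eq_bigr => j _; have n1 := nm_iiX j.
apply: (intg_ext (@midclosed_cap _) (gh j)); first exact: cap_l.
by rewrite exprS; exact: cap_r.
Qed.

Lemma differentiable_kernel f z w : differentiable (f : C -> C^o) w ->
  w - z != 0 -> differentiable ((fun x => f x / (x - z)) : C -> C^o) w.
Proof.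
move=> df wz.
apply: (@differentiableM _ _ (f : C -> C^o) (fun x => (x - z)^-1 : C^o)).
  exact: df.
by apply: (@differentiableV _ _ (fun x : C => x - z : C^o)).
Qed.

(* One side of the diamond and its image under the homothety of ratio 1/2 at z. *)
Lemma side_shrink f z v (t : R) : nm v = 1 -> nm z <= 1 / 4 -> 0 < t <= 1 ->
  holD (fun w => nm w <= 1) f ->
  let h := fun w => f w / (w - z) in
  let p := fun s w => z + rc s * (w - z) in
  intg h (p t v) (p t (ii R * v)) =
  intg h (p t v) (p (t / 2) v) + intg h (p (t / 2) v) (p (t / 2) (ii R * v)) -
  intg h (p t (ii R * v)) (p (t / 2) (ii R * v)).
Proof.
move=> v1 hz /andP[t0 t1] df h p.
(* The quadrilateral between the side and its image lies in D, which avoids z, and is cut into two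
   triangles for [goursat]. The level t / 4 arises because Re ((w - z) [normal v]) is at least 1 / 2
   at v and i v and is scaled by a factor of at least t / 2. *)
pose D w := nm w <= 1 /\ halfplane z (normal v) (t / 4) w.
have mD : midclosed D.
  apply: midclosedI; last exact: midclosed_halfplane.
  by have := @midclosed_cball R 0 1; under eq_fun do rewrite subr0.
have sD : seqclosed D.
  apply: seqclosedI; last exact: seqclosed_halfplane.
  by have := @seqclosed_cball R 0 1; under eq_fun do rewrite subr0.
have hD : holD D h.
  move=> w [w1]; rewrite /halfplane => hw; apply: differentiable_kernel.
    exact: df.
  apply/eqP => wz; move: hw; rewrite wz mul0r [ReC 0]/= leNgt.
  by rewrite divr_gt0.
have ch := diff_contD hD.
have Dp s w : t / 2 <= s <= 1 -> nm w = 1 -> ReC (w * normal v) = 1 -> D (p s w).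
  move=> /andP[s0 s1] w1 wv; split.
    have -> : p s w = rc (1 - s) * z + rc s * w.
      by rewrite /p rcB rc1; ring.
    apply: le_trans (nmD _ _) _; rewrite !nmM !nm_rc; try lra.
    by rewrite w1; nra.
  rewrite /halfplane /p addrAC subrr add0r -mulrA ReC_rc mulrBl ReCB wv.
  have : ReC (z * normal v) <= 1 / 2.
    apply: le_trans (ReC_nm _) _; rewrite nmM.
    by have := nm_normal v1; have := nm_ge0 z; nra.
  by nra.
have lv := normal_l v1; have rv := normal_r v1.
have i1 : nm (ii R * v) = 1 by rewrite nmM nm_ii v1 mulr1.
have [T T2] : t / 2 <= t <= 1 /\ t / 2 <= t / 2 <= 1 by split; apply/andP; split => //; lra.
have [d1 d2] := conj (Dp t v T v1 lv) (Dp t _ T i1 rv).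
have [d3 d4] := conj (Dp (t / 2) v T2 v1 lv) (Dp (t / 2) _ T2 i1 rv).
have := goursat mD sD hD d1 d2 d3; have := goursat mD sD hD d3 d2 d4.
rewrite /tri (intg_anti mD sD ch d1 d3) (intg_anti mD sD ch d3 d4).
rewrite (intg_anti mD sD ch d3 d2).
have alg (x1 x2 x3 x4 x5 : C) : x5 + x4 - x3 = 0 -> x1 - x5 - x2 = 0 ->
    x1 = x2 + x3 - x4.
  move=> h1 h2; apply/eqP; rewrite -subr_eq0; apply/eqP.
  have -> : x1 - (x2 + x3 - x4) = (x1 - x5 - x2) + (x5 + x4 - x3) by ring.
  by rewrite h1 h2 addr0.
exact: alg.
Qed.

Lemma intg_homothety f z (t : R) a b : 0 < t ->
  intg (fun w => f w / (w - z)) (z + rc t * (a - z)) (z + rc t * (b - z)) =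
  intg (fun w => f (z + rc t * (w - z)) / (w - z)) a b.
Proof.
move=> t0; have rt : rc t != 0 by rewrite rc_eq0 gt_eqF.
have E w : z + rc t * (w - z) = z - rc t * z + rc t * w by ring.
rewrite !E intg_scale; congr (intg _ a b); apply/funext => w; rewrite -E.
rewrite (_ : z + rc t * (w - z) - z = rc t * (w - z)); last by ring.
by rewrite mulrCA invfM mulVKf.
Qed.

(** By [side_shrink] the homothety of ratio 1/2 at z does not change the integral. After
    sufficiently many of them, a change of variables brings the contour back to the square, with
    integrand f (z + t (w - z)) / (w - z) for a small t, which is close to f z / (w - z). *)
Lemma cauchy_formula f z : nm z <= 1 / 4 -> holD (fun w => nm w <= 1) f ->
  diamond (fun w => f w / (w - z)) = f z * diamond (fun w => 1 / (w - z)).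
Proof.
move=> hz df; set h := fun w => f w / (w - z).
pose p (s : R) w := z + rc s * (w - z).
pose J s := \sum_(k < 4) intg h (p s (ii R ^+ k)) (p s (ii R ^+ k.+1)).
have J2 s : 0 < s <= 1 -> J s = J (s / 2).
  move=> s01; pose A k := intg h (p s (ii R ^+ k)) (p (s / 2) (ii R ^+ k)).
  (* The integrals [A k] along the segments joining corresponding vertices telescope around the
     closed contour, since i^4 = 1. *)
  have -> : J s = \sum_(k < 4) (A k - A k.+1 +
      intg h (p (s / 2) (ii R ^+ k)) (p (s / 2) (ii R ^+ k.+1))).
    apply: eq_bigr => k _.
    have := side_shrink (nm_iiX k) hz s01 df; rewrite -exprS => ->.
    by rewrite addrAC.
  rewrite big_split /= !big_ord_recl big_ord0 /= /A.
  have -> : ii R ^+ 4 = 1 by rewrite -[4%N]/(2 * 2)%N exprM !expr2 !iiM mulrNN mulr1.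
  rewrite expr0 /J !big_ord_recl big_ord0 /= expr0 /bump /=.
  have -> : ii R ^+ 4 = 1 by rewrite -[4%N]/(2 * 2)%N exprM !expr2 !iiM mulrNN mulr1.
  rewrite -[RHS]add0r; congr (_ + _).
  move: (intg _ _ _) (intg _ _ _) (intg _ _ _) (intg _ _ _) => x1 x2 x3 x4.
  by ring.
have JX n : J 1 = J (1 / 2 ^+ n).
  elim: n => [|n IH]; first by rewrite expr0 divr1.
  rewrite IH J2 ?divr_gt0 ?exprn_gt0 //=; last first.
    by rewrite ler_pdivrMr ?exprn_gt0 // mul1r exprn_ege1 // ler1n.
  by congr J; rewrite exprSr invfM mulrA.
have -> : diamond h = J 1.
  apply: eq_bigr => k _; congr intg; rewrite /p rc1; ring.
(* The factor 32 is 8 from [diamond_bound] times 4, the bound of 1 / |w - z| on the contour. *)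
apply/eqP; rewrite -subr_eq0; apply/eqP; apply: (@le_eps_eq0 _ _ 32) => e e0.
have cz : nm z <= 1 by lra.
have /diff_contD/(_ z cz e e0)[d d0 Hd] := df.
have d2 : 0 < d / 4 by rewrite divr_gt0.
have [n0 Hn] := half_pow_small 1 d2.
pose t : R := 1 / 2 ^+ n0.
have t0 : 0 < t by rewrite divr_gt0 // exprn_gt0.
have t1 : t <= 1.
  by rewrite ler_pdivrMr ?exprn_gt0 // mul1r exprn_ege1 // ler1n.
have td : t <= d / 4 := Hn _ (leqnn _).
pose ft w := f (z + rc t * (w - z)).
have pw w : nm w <= 1 -> nm (z + rc t * (w - z)) <= 1.
  move=> w1.
  have -> : z + rc t * (w - z) = rc (1 - t) * z + rc t * w by rewrite rcB rc1; ring.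
  apply: le_trans (nmD _ _) _; rewrite !nmM !nm_rc ?subr_ge0 //; last exact: ltW.
  by nra.
have dft : holD (fun w => nm w <= 1) ft.
  move=> w w1; apply: (@differentiable_comp _ _ _ _ (fun w => z + rc t * (w - z))).
    by [].
  exact: df (pw w w1).
rewrite (JX n0) -/t /J; under eq_bigr do rewrite intg_homothety //.
have dk g k : holD (fun w => nm w <= 1) g ->
    contD (cap (ii R ^+ k)) (fun w => g w / (w - z)).
  move=> dg; apply: diff_contD => w cw; apply: differentiable_kernel.
    by case: cw => /dg.
  exact: (cap_neq (nm_iiX k)) cw.
rewrite -[X in X - _]/(diamond (fun w => ft w / (w - z))) -mulNr addrC.
rewrite -diamond_lin //; try by move=> k; apply: dk => // w _; exact: differentiable_cst.
have -> : e * 32 = 8 * (e * 4) by ring.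
apply: diamond_bound => k.
  rewrite (_ : (fun w => _) = (fun w => (ft w - f z) / (w - z))); last first.
    by apply/funext => w; ring.
  apply: dk => w w1; apply: differentiableB; first exact: dft.
  exact: differentiable_cst.
move=> w cw.
have -> : - f z * (1 / (w - z)) + ft w / (w - z) = (ft w - f z) / (w - z) by ring.
have wz := cap_dist (nm_iiX k) hz cw.
have wz0 : 0 < nm (w - z) by lra.
rewrite nmM nmV ler_pdivrMr //.
have w1 : nm w <= 1 by case: cw.
have : nm (ft w - f z) <= e.
  apply: Hd; first exact: pw.
  rewrite addrAC subrr add0r nmM nm_rc; last exact: ltW.
  by have := nmB w z; have := nm_ge0 (w - z); nra.
by nra.
Qed.

End CauchyFormula.

(** * A second-order Cauchy estimate on the unit disc *)

Section CauchyEstimate.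
Variable R : realType.
Local Notation C := (CC R).
Implicit Types (f g : C -> C) (z w v : C).

Lemma kernel_contD f z k : nm z <= 1 / 4 -> holD (fun w => nm w <= 1) f ->
  contD (cap (ii R ^+ k)) (fun w => f w / (w - z)).
Proof.
move=> hz df; apply: diff_contD => w cw; apply: differentiable_kernel.
  by case: cw => /df.
exact: (cap_neq (nm_iiX _ k)) cw.
Qed.

(* On the side from 1 to i, 1 / w stays at distance at most 4/5 from
   3/4 (1 - i), which has norm greater than 1. *)
Lemma diamond_inv_neq0 : diamond (fun w : C => 1 / (w - 0)) != 0.
Proof.
set g := fun w : C => _; set I := intg g 1 (ii R).
have c1 : holD (fun w : C => nm w <= 1) (fun w : C => 1).
  by move=> w _; exact: differentiable_cst.
have z4 : nm (0 : C) <= 1 / 4 by rewrite nm0; lra.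
(* The form dw / w is invariant under multiplication by i^k, so the four sides contribute
   equally. *)
have -> : diamond g = 4%:R * I.
  rewrite /diamond (eq_bigr (fun _ => I)) ?sumr_const ?card_ord ?mulr_natl // => k _.
  set v := ii R ^+ k; have v0 : v != 0 by rewrite -nm_gt0 nm_iiX.
  have := intg_scale g 0 v 1 (ii R); rewrite !add0r mulr1 exprSr => ->.
  congr (intg _ _ _); apply/funext => w.
  by rewrite /g add0r !subr0 mulrCA invfM mulVKf.
rewrite mulf_neq0 ?pnatr_eq0 //; apply/eqP => I0.
have cp : contD (cap (1 : C)) g by have := kernel_contD (k := 0%N) z4 c1; rewrite expr0.
have n1 : nm (1 : C) = 1 := nm1 R.
have cr : cap (1 : C) (ii R) by have := cap_r n1; rewrite mulr1.
pose c : C := rc (3 / 4) * (1 - ii R).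
have Rec (x y : R) : ReC (c * (x +i* y)%C) = 3 / 4 * (x + y).
  by rewrite /c -mulrA ReC_rc /ReC /=; congr (_ * _); ring.
have Imc (x y : R) : ImC (c * (x +i* y)%C) = 3 / 4 * (y - x).
  by rewrite /c -mulrA /ImC /=; ring.
have gb w : cap 1 w -> nm (g w - c) <= 4 / 5.
  move=> cw; have w0 : w != 0 by have := cap_neq n1 z4 cw; rewrite subr0.
  have wp : 0 < nm w by rewrite nm_gt0.
  have -> : g w - c = (1 - c * w) / w by rewrite /g subr0; field.
  rewrite nmM nmV ler_pdivrMr //.
  rewrite -(@ler_pXn2r _ 2) // ?nnegrE ?nm_ge0 ?mulr_ge0 ?nm_ge0 //.
  rewrite exprMn !nm_sqr.
  case: cw => cw1; have := exprn_ile1 2 (nm_ge0 w) cw1; rewrite nm_sqr.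
  rewrite /halfplane subr0 /normal divr1; move: {w0 wp cw1} w => [x y].
  have -> : ReC (1 - c * (x +i* y)%C) = 1 - 3 / 4 * (x + y).
    by rewrite ReCB Rec.
  have -> : ImC (1 - c * (x +i* y)%C) = - (3 / 4 * (y - x)).
    by rewrite -Imc /ImC (raddfB (@complex.Im R)) /= sub0r.
  rewrite /ReC /ImC /= => h1 h2.
  have {}h2 : 1 <= x + y by move: h2; lra.
  by nra.
have := intg_bound (@midclosed_cap R 1) (@seqclosed_cap R 1) cp gb (cap_l n1) cr.
rewrite -/I I0 sub0r nmN nmM ler_pM2r; last first.
  rewrite nm_gt0; apply/eqP => /(congr1 (@ReC R)).
  by rewrite ReCB /ReC /= => h; lra.
(* With I = 0, [intg_bound] has given |c| <= 4/5, whereas |c|^2 = 9/8. *)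
move=> h; have : nm c ^+ 2 <= (4 / 5) ^+ 2.
  by rewrite ler_pXn2r // ?nnegrE ?nm_ge0 //.
have := Rec 1 0; have := Imc 1 0.
rewrite -[(1 +i* 0)%C]/(1 : C) mulr1 nm_sqr => -> ->; lra.
Qed.

(** The substitution w |-> - w exchanges opposite sides and changes the sign of dw, so opposite
    sides cancel. *)
Lemma diamond_even g : (forall k, contD (cap (ii R ^+ k)) g) ->
  (forall w, g (- w) = g w) -> diamond g = 0.
Proof.
move=> cg ge.
have E k : intg g (ii R ^+ k.+2) (ii R ^+ k.+3) =
    - intg g (ii R ^+ k) (ii R ^+ k.+1).
  have n1 := nm_iiX R k.
  have cr : cap (ii R ^+ k) (ii R ^+ k.+1) by rewrite exprS; exact: cap_r.
  have i2 j : ii R ^+ j.+2 = 0 + -1 * ii R ^+ j.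
    by rewrite !exprS mulrA iiM add0r.
  rewrite !i2 intg_scale.
  rewrite (_ : (fun w => _) = (fun w => -1 * g w + (0 + 0 * w))); last first.
    by apply/funext => w; rewrite add0r !mulN1r ge mul0r !addr0.
  rewrite (intg_lin _ (@midclosed_cap _ _) (@seqclosed_cap _ _) (cg k)) //.
  - by rewrite intg_affine !mul0r !addr0 mulN1r.
  - apply: diff_contD => w _; rewrite (_ : (fun w => _) = cst 0).
      exact: differentiable_cst.
    by apply/funext => v; rewrite mul0r addr0.
  - exact: cap_l.
rewrite /diamond !big_ord_recl big_ord0 /= /bump /= !E addr0.
by rewrite -opprD addrA subrr.
Qed.

(** The expansion 1 / (w - z) = 1 / w + z / w^2 + z^2 / (w^2 (w - z)) is inserted on both sides of
    the Cauchy formula, for f and for the constant 1. For the constant 1 the coefficient of z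
    vanishes, 1 / w^2 being even; dividing by the nonzero number W leaves a Taylor expansion whose
    remainder is made of the integrals of [f2]. *)
Lemma cauchy_estimate : exists2 K : R, 0 < K & forall f (M : R),
  holD (fun w => nm w <= 1) f -> (forall w, nm w <= 1 -> nm (f w) <= M) ->
  exists2 l : C, nm l <= K * M & forall z, nm z <= 1 / 4 ->
    nm (f z - f 0 - l * z) <= K * M * nm z ^+ 2.
Proof.
set W := diamond (fun w : C => 1 / (w - 0)).
have W0 : W != 0 := diamond_inv_neq0.
have Wp : 0 < nm W by rewrite nm_gt0.
(* The integral of [f2] is at most 8 M times the cube of 4, which is 32 times 16 times M; the
   remainder contains two terms of this size. *)
exists (32 * 32 / nm W); first by rewrite divr_gt0 // mulr_gt0 // ltr0n.
move=> f M df fM.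
have z4 : nm (0 : C) <= 1 / 4 by rewrite nm0; lra.
have capd k w z : nm z <= 1 / 4 -> cap (ii R ^+ k) w -> 1 / 4 <= nm (w - z).
  by move=> hz; exact: cap_dist (nm_iiX _ k) hz.
have capi k w z : nm z <= 1 / 4 -> cap (ii R ^+ k) w -> nm ((w - z)^-1) <= 4.
  move=> hz /(capd _ _ _ hz) h; rewrite nmV -[4]invrK lef_pV2 ?posrE //; lra.
have capn k w z : nm z <= 1 / 4 -> cap (ii R ^+ k) w -> w - z != 0.
  by move=> hz; exact: (cap_neq (nm_iiX _ k)) hz.
pose f2 (g : C -> C) z w := g w / (w - 0) / (w - 0) / (w - z).
have cf2 g z k : nm z <= 1 / 4 -> holD (fun w => nm w <= 1) g ->
    contD (cap (ii R ^+ k)) (f2 g z).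
  move=> hz dg; apply: diff_contD => w cw.
  have dgw : differentiable (g : C -> C^o) w by case: cw => /dg.
  have e1 := differentiable_kernel dgw (capn _ _ _ z4 cw).
  have e2 := differentiable_kernel e1 (capn _ _ _ z4 cw).
  exact: differentiable_kernel e2 (capn _ _ _ hz cw).
have f2b g z (N : R) : nm z <= 1 / 4 -> (forall w, nm w <= 1 -> nm (g w) <= N) ->
    holD (fun w => nm w <= 1) g -> nm (diamond (f2 g z)) <= 32 * 16 * N.
  move=> hz gN dg; rewrite (_ : 32 * 16 * N = 8 * (N * 4 * 4 * 4)); last by ring.
  apply: diamond_bound => k; first exact: cf2.
  move=> w cw; rewrite /f2 !nmM.
  have w1 : nm w <= 1 by case: cw.
  do 3 (apply: ler_pM; rewrite ?mulr_ge0 ?nm_ge0 //; last exact: capi cw).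
  exact: gN.
have kE g z : nm z <= 1 / 4 -> holD (fun w => nm w <= 1) g ->
    diamond (fun w => g w / (w - z)) = diamond (fun w => g w / (w - 0)) +
      z * diamond (fun w => g w / (w - 0) / (w - 0)) + z ^+ 2 * diamond (f2 g z).
  move=> hz dg.
  have c1 k := kernel_contD (k := k) z4 dg.
  have c2 k : contD (cap (ii R ^+ k)) (fun w => g w / (w - 0) / (w - 0)).
    apply: diff_contD => w cw.
    have dgw : differentiable (g : C -> C^o) w by case: cw => /dg.
    have e1 := differentiable_kernel dgw (capn _ _ _ z4 cw).
    exact: differentiable_kernel e1 (capn _ _ _ z4 cw).
  have c3 k := cf2 g z k hz dg.
  have c12 k : contD (cap (ii R ^+ k))
      (fun w => z * (g w / (w - 0) / (w - 0)) + g w / (w - 0)).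
    apply: diff_contD => w cw.
    have dgw : differentiable (g : C -> C^o) w by case: cw => /dg.
    have d1 := differentiable_kernel dgw (capn _ _ _ z4 cw).
    have d2 := differentiable_kernel d1 (capn _ _ _ z4 cw).
    apply: (@differentiableD _ _ C^o
      (fun w => z * (g w / (w - 0) / (w - 0)) : C^o) (fun w => g w / (w - 0) : C^o)).
      exact: (@differentiableM _ _ (fun _ => z : C^o) _ w (differentiable_cst _ _) d2).
    exact: d1.
  rewrite addrC [X in _ + X]addrC -(diamond_lin z c2 c1) -(diamond_lin _ c3 c12).
  apply: diamond_ext => k w cw.
  have := capn _ _ _ z4 cw; have := capn _ _ _ hz cw.
  by rewrite /f2 subr0 => wz w0; field; rewrite wz w0.
have d1 : holD (fun w : C => nm w <= 1) (fun w : C => 1).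
  by move=> w _; exact: differentiable_cst.
have B1 : diamond (fun w : C => 1 / (w - 0) / (w - 0)) = 0.
  apply: diamond_even => [k|w]; last by rewrite !subr0 invrN; ring.
  apply: diff_contD => w cw.
  have dgw : differentiable (fun=> 1 : C^o) w := differentiable_cst _ _.
  have e1 := differentiable_kernel dgw (capn _ _ _ z4 cw).
  exact: differentiable_kernel e1 (capn _ _ _ z4 cw).
have M0 : 0 <= M by apply: le_trans (fM 0 _); rewrite ?nm0 ?nm_ge0.
set A1 := diamond (fun w => f w / (w - 0) / (w - 0)).
have alg (fz f0 A P Q z : C) : f0 * W + z * A + z ^+ 2 * P = fz * (W + z ^+ 2 * Q) ->
    fz - f0 - A / W * z = (P - fz * Q) * z ^+ 2 / W.
  move=> h; apply/eqP; rewrite -subr_eq0; apply/eqP.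
  transitivity ((fz * (W + z ^+ 2 * Q) - (f0 * W + z * A + z ^+ 2 * P)) / W).
    by field.
  by rewrite h subrr mul0r.
have key z : nm z <= 1 / 4 -> f z - f 0 - A1 / W * z =
   (diamond (f2 f z) - f z * diamond (f2 (fun=> 1) z)) * z ^+ 2 / W.
  move=> hz; have := cauchy_formula hz df; rewrite (kE _ _ hz df) (kE _ _ hz d1).
  rewrite (cauchy_formula z4 df) -/W -/A1 B1 mulr0 addr0.
  exact: alg.
have A1b : nm A1 <= 32 * 4 * M.
  rewrite (_ : 32 * 4 * M = 8 * (M * 4 * 4)); last by ring.
  apply: diamond_bound => k.
    apply: diff_contD => w cw.
    have dgw : differentiable (f : C -> C^o) w by case: cw => /df.
    have e1 := differentiable_kernel dgw (capn _ _ _ z4 cw).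
    exact: differentiable_kernel e1 (capn _ _ _ z4 cw).
  move=> w cw; rewrite !nmM.
  have w1 : nm w <= 1 by case: cw.
  do 2 (apply: ler_pM; rewrite ?mulr_ge0 ?nm_ge0 //; last exact: capi cw).
  exact: fM.
exists (A1 / W).
  rewrite nmM nmV mulrAC ler_pM2r ?invr_gt0 //.
  by apply: le_trans A1b _; rewrite -!mulrA !ler_wpM2l ?ler0n //; lra.
move=> z hz; rewrite (key z hz).
have z1 : nm z <= 1 by apply: le_trans hz _; lra.
have b1 := f2b f z M hz fM df.
have b2 : nm (diamond (f2 (fun=> 1) z)) <= 32 * 16 * 1.
  by apply: f2b => // w _; rewrite nm1.
have b3 : nm (diamond (f2 f z) - f z * diamond (f2 (fun=> 1) z)) <= 32 * 32 * M.
  apply: le_trans (nmB _ _) _; rewrite nmM.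
  rewrite (_ : 32 * 32 * M = 32 * 16 * M + M * (32 * 16 * 1)); last by ring.
  by apply: lerD => //; apply: ler_pM; rewrite ?nm_ge0 //; exact: fM.
rewrite nmM nmV nmM nmX.
rewrite [X in _ <= X](_ : _ = 32 * 32 * M * nm z ^+ 2 / nm W); last by ring.
rewrite ler_pM2r ?invr_gt0 //; apply: ler_wpM2r b3.
by rewrite exprn_ge0 // nm_ge0.
Qed.

End CauchyEstimate.

(** * Holomorphic functions of several variables *)

Section SeveralVariables.
Variable R : realType.
Local Notation C := (CC R).
Local Notation diffble f x := (differentiable (f : _ -> C^o) x).

Lemma linear_coef_uniq (k l : C) (A d : R) : 0 < d ->
  (forall e : R, 0 < e -> exists2 d' : R, 0 < d' & forall x : C,
     nm x < d' -> nm (k * x - l * x) <= e * nm x + A * nm x ^+ 2) -> k = l.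
Proof.
move=> d0 H; apply/eqP; rewrite -subr_eq0; apply/eqP.
apply: (@le_eps_eq0 R _ 2) => e e0; have [d' d'0 Hd] := H e e0.
pose t := Num.min (d' / 2) (e / (`|A| + 1)).
have A1 : 0 < `|A| + 1 by rewrite ltr_wpDl.
have t0 : 0 < t by rewrite lt_min !divr_gt0.
have td : t < d'.
  by apply: (@le_lt_trans _ _ (d' / 2)); [rewrite ge_min lexx|lra].
have te : t * (`|A| + 1) <= e by rewrite -ler_pdivlMr // ge_min lexx orbT.
have := Hd (rc t); rewrite (nm_rc (ltW t0)) => /(_ td).
rewrite -mulrBl nmM (nm_rc (ltW t0)) => h.
rewrite -(ler_pM2r t0); apply: le_trans h _.
have := ler_norm A; have : A * t <= e by have := ler_norm A; nra.
by nra.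
Qed.

(** [cauchy_estimate] is applied on the complex line through z0 in the direction h, with a direction
    vector u of norm r / 2 so that the unit disc lands in the ball. Hence K depends neither on V nor
    on r, and |h| <= r / 8 corresponds to a parameter of modulus at most 1 / 4. *)
Lemma taylor_estimate : exists2 K : R, 0 < K &
  forall (V : normedModType C) (z0 : V) (r M : R) (f : V -> C), 0 < r ->
  (forall z, nm (z - z0) < r -> diffble f z) ->
  (forall z, nm (z - z0) < r -> nm (f z) <= M) ->
  (forall h, nm ('D_h (f : V -> C^o) z0) <= K * M * nm h / r) /\
  (forall h, nm h <= r / 8 ->
    nm (f (z0 + h) - f z0 - 'D_h (f : V -> C^o) z0) <= K * M * (nm h / r) ^+ 2).
Proof.
have [K K0 HK] := cauchy_estimate R; exists (4 * K); first exact: mulr_gt0.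
move=> V z0 r M f r0 df fM.
have df0 : diffble f z0 by apply: df; rewrite subrr nm0.
have M0 : 0 <= M by apply: le_trans (fM z0 _); rewrite ?nm_ge0 // subrr nm0.
have key (h : V) : h != 0 -> nm ('D_h (f : V -> C^o) z0) <= K * M * (nm h / r) * 2 /\
    (nm h <= r / 8 ->
     nm (f (z0 + h) - f z0 - 'D_h (f : V -> C^o) z0) <= K * M * (nm h / r * 2) ^+ 2).
  move=> h0; have hp : 0 < nm h by rewrite nm_gt0.
  have [u nu hE] : exists2 u : V, nm u = r / 2 & h = rc (nm h / (r / 2)) *: u.
    exists (rc (r / 2 / nm h) *: h).
      rewrite nmZ nm_rc ?divr_ge0 ?nm_ge0 ?ltW // divfK //; exact: lt0r_neq0.
    rewrite scalerA -rcM.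
    have -> : nm h / (r / 2) * (r / 2 / nm h) = 1 by field; rewrite !gt_eqF.
    by rewrite rc1 scale1r.
  pose g (x : C) := f (z0 + x *: u).
  have gr (x : C) : nm x <= 1 -> nm (z0 + x *: u - z0) < r.
    by move=> x1; rewrite addrAC subrr add0r nmZ nu; nra.
  have dg : holD (fun w : C => nm w <= 1) g.
    move=> x x1.
    have dl : differentiable (fun x : C => z0 + x *: u) x.
      apply: differentiableD; first exact: differentiable_cst.
      exact: (@differentiableZl _ C V (fun x => x)).
    exact: (differentiable_comp dl (df _ (gr x x1))).
  have [l lK Hl] := HK g M dg (fun x x1 => fM _ (gr x x1)).
  (* Both l and the directional derivative are first-order coefficients of f along u. *)
  have lE : l = 'D_u (f : V -> C^o) z0.
    apply: (@linear_coef_uniq _ _ (K * M) 1 ltr01) => e e0.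
    have e1 : 0 < e / (r / 2) by rewrite !divr_gt0.
    have [d d0 Hd] := diff_eps df0 e1.
    have r2 : 0 < r / 2 by rewrite divr_gt0.
    exists (Num.min (1 / 4) (d / (r / 2))); first by rewrite lt_min !divr_gt0.
    move=> x; rewrite lt_min => /andP[x1 x2].
    have := Hl x (ltW x1).
    have := Hd (z0 + x *: u); rewrite addrAC subrr add0r nmZ nu.
    rewrite -ltr_pdivlMr // => /(_ x2); rewrite linearZ /= -deriveE //.
    have -> : e / (r / 2) * (nm x * (r / 2)) = e * nm x by field; rewrite gt_eqF.
    rewrite /g scale0r addr0 -[_ *: 'D_u _ _]/(x * 'D_u _ _).
    move: ('D_u _ _ : C) (f z0) (f (z0 + x *: u)) => y f0 fx h1 h2.
    have -> : l * x - y * x = (fx - f0 - x * y) - (fx - f0 - l * x) by ring.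
    by apply: le_trans (nmB _ _) _; rewrite lerD.
  pose t := nm h / (r / 2).
  have t0 : 0 <= t by rewrite divr_ge0 ?nm_ge0 // divr_ge0 // ltW.
  rewrite -/t in hE.
  have DE : 'D_h (f : V -> C^o) z0 = rc t * l.
    by rewrite lE !deriveE // {1}hE linearZ.
  have tE : t = nm h / r * 2 by rewrite /t; field; rewrite gt_eqF.
  rewrite DE; split.
    rewrite nmM nm_rc // -mulrA -tE mulrC; apply: ler_wpM2r => //.
  move=> h8; have t4 : t <= 1 / 4.
    by rewrite /t ler_pdivrMr ?divr_gt0 //; lra.
  have := Hl (rc t); rewrite nm_rc // => /(_ t4).
  by rewrite /g scale0r addr0 -hE -tE mulrC.
split=> h.
  have [->|h0] := eqVneq h 0.
    by rewrite deriveE // linear0 !nm0 mulr0 mul0r.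
  apply: le_trans (key h h0).1 _.
  have : 0 <= K * M * (nm h / r).
    by rewrite mulr_ge0 ?divr_ge0 ?nm_ge0 ?(ltW r0) ?mulr_ge0 ?(ltW K0).
  by move: (nm h) (r^-1) => x y; lra.
have [->|h0] := eqVneq h 0.
  by rewrite deriveE // linear0 addr0 !subrr !nm0 mul0r expr0n mulr0.
move=> h8; apply: le_trans ((key h h0).2 h8) _.
rewrite exprMn; move: (nm h / r) => x.
by rewrite le_eqVlt; apply/orP; left; apply/eqP; ring.
Qed.

Lemma nm6 (V : normedModType C) (p q s t x y : V) :
  nm ((p - q - (s - t)) - (x - y)) <= nm p + nm q + nm s + nm t + nm x + nm y.
Proof.
have := nmB (p - q - (s - t)) (x - y); have := nmB (p - q) (s - t).
by have := nmB p q; have := nmB s t; have := nmB x y; lra.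
Qed.

Lemma derive_lin (V W : normedModType C) (f : V -> W) z :
  differentiable f z -> linear (fun v => 'D_v f z).
Proof.
by move=> df a u v; rewrite !deriveE // linearP.
Qed.

(* A bounded pointwise limit of holomorphic functions is holomorphic, and its
   derivatives are the limits of the derivatives (no uniformity is needed: the
   Cauchy estimates make the sequence equicontinuous). *)
Lemma vitali (V : normedModType C) (z0 : V) (r M : R) (F : nat -> V -> C)
    (f : V -> C) : 0 < r ->
  (forall n z, nm (z - z0) < r -> diffble (F n) z) ->
  (forall n z, nm (z - z0) < r -> nm (F n z) <= M) ->
  (forall z, nm (z - z0) < r -> tends (fun n => F n z) (f z)) ->
  diffble f z0 /\
  forall v, tends (fun n => 'D_v (F n : V -> C^o) z0) ('D_v (f : V -> C^o) z0).
Proof.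
move=> r0 dF FM Ff.
have [K K0 HK] := taylor_estimate.
have tay n := HK V z0 r M (F n) r0 (dF n) (FM n).
have dF0 n : diffble (F n) z0 by apply: dF; rewrite subrr nm0.
have Ff0 : tends (fun n => F n z0) (f z0) by apply: Ff; rewrite subrr nm0.
have M0 : 0 <= M by apply: le_trans (FM 0 z0 _); rewrite ?nm_ge0 // subrr nm0.
have KM0 : 0 <= K * M by rewrite mulr_ge0 // ltW.
pose d n v := 'D_v (F n : V -> C^o) z0 : C.
have dZ n (a : C) v : d n (a *: v) = a * d n v.
  by rewrite /d !deriveE // linearZ.
have dcauchy v : cauchys (d ^~ v).
  move=> e e0.
  pose A := K * M * (nm v / r) ^+ 2.
  have A0 : 0 <= A by rewrite mulr_ge0 // exprn_ge0 // divr_ge0 ?nm_ge0 ?ltW.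
  (* The step t is small enough for t v to be in the range of the Taylor estimate and for the
     quadratic remainder, once divided by t, to be at most e / 4. The derivatives are then compared
     through the values at z0 + t v and z0, which converge. *)
  pose t := Num.min (r / 8 / (nm v + 1)) (e / 4 / (A + 1)).
  have t0 : 0 < t by rewrite lt_min !divr_gt0 // ltr_wpDl ?nm_ge0.
  have tr : nm (rc t *: v) <= r / 8.
    rewrite nmZ (nm_rc (ltW t0)); apply: (@le_trans _ _ (t * (nm v + 1))).
      by rewrite ler_pM2l // lerDl.
    by rewrite -ler_pdivlMr ?ltr_wpDl ?nm_ge0 // ge_min lexx.
  have tA : t * A <= e / 4.
    apply: (@le_trans _ _ (t * (A + 1))); first by rewrite ler_pM2l // lerDl.
    by rewrite -ler_pdivlMr ?ltr_wpDl // ge_min lexx orbT.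
  have zr : nm (z0 + rc t *: v - z0) < r.
    by rewrite addrAC subrr add0r; apply: le_lt_trans tr _; lra.
  have te : 0 < t * e / 8 by rewrite !divr_gt0 // mulr_gt0.
  have [N HN] := Ff _ zr _ te; have [N' HN'] := Ff0 _ te.
  exists (N + N')%N => n k nN kN.
  have hb j := (tay j).2 _ tr.
  have eqA : K * M * (nm (rc t *: v) / r) ^+ 2 = t * (t * A).
    by rewrite nmZ (nm_rc (ltW t0)) /A; ring.
  have hn := hb n; have hk := hb k; move: hn hk; rewrite eqA.
  rewrite -![('D__ _ _)]/(d _ _) !dZ.
  have h1 := HN n (leq_trans (leq_addr _ _) nN).
  have h2 := HN k (leq_trans (leq_addr _ _) kN).
  have h3 := HN' n (leq_trans (leq_addl _ _) nN).
  have h4 := HN' k (leq_trans (leq_addl _ _) kN).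
  move: h1 h2 h3 h4; set u := z0 + _.
  move: (F n u) (F k u) (f u) (F n z0) (F k z0) (f z0) (d n v) (d k v).
  move=> a1 a2 a b1 b2 b x y h1 h2 h3 h4 h5 h6.
  rewrite -(ler_pM2l t0) -{1}(nm_rc (ltW t0)) -nmM.
  have -> : rc t * (x - y) = (((a1 - a) - (a2 - a)) - ((b1 - b) - (b2 - b))) -
    ((a1 - b1 - rc t * x) - (a2 - b2 - rc t * y)) by ring.
  apply: le_trans (nm6 _ _ _ _ _ _) _.
  have : t * (t * A) <= t * (e / 4) by rewrite ler_pM2l.
  move: (t * (t * A)) h1 h2 h3 h4 h5 h6 => B h1 h2 h3 h4 h5 h6 hB.
  rewrite (_ : t * e = 4 * (t * e / 8) + 2 * (t * (e / 4))); last by field.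
  by move: (t * e / 8) (t * (e / 4)) h1 h2 h3 h4 hB => *; lra.
have [L HL] := choice (fun v => cauchys_lim (dcauchy v)).
have linL : linear (L : V -> C^o).
  move=> a u v; apply: (tends_uniq (HL _)).
  under eq_fun do rewrite /d (derive_lin (dF0 _)).
  by apply: tendsD; [apply: tendsZ|]; exact: HL.
pose Ll : {linear V -> C^o} :=
  HB.pack (L : V -> C^o) (GRing.isLinear.Build C V C^o _ L linL).
have Lb v : nm (L v) <= K * M / r * nm v.
  apply: tends_bound0 (HL v) _; exists 0 => n _.
  by apply: le_trans ((tay n).1 v) _; rewrite mulrAC.
(* The Taylor estimate is uniform in n and passes to the limit; it identifies L as the differential
   of f. *)
have Lt h : nm h <= r / 8 ->
    nm (f (z0 + h) - f z0 - L h) <= K * M * (nm h / r) ^+ 2.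
  move=> hr; have hz : nm (z0 + h - z0) < r.
    by rewrite addrAC subrr add0r; apply: le_lt_trans hr _; lra.
  apply: (tends_bound0 (tendsB (tendsB (Ff _ hz) Ff0) (HL h))).
  by exists 0 => n _; exact: (tay n).2.
have [df dE] : diffble f z0 /\ 'd (f : V -> C^o) z0 = Ll :> (V -> C^o).
  apply: (@eps_diff R V C^o f z0 Ll _ Lb) => e e0.
  pose A := K * M / r ^+ 2.
  have A0 : 0 <= A by rewrite divr_ge0 // exprn_ge0 // ltW.
  exists (Num.min (r / 8) (e / (A + 1))).
    by rewrite lt_min !divr_gt0 // ltr_wpDl.
  move=> w; rewrite lt_min => /andP[w1]; rewrite ltr_pdivlMr ?ltr_wpDl // => w2.
  have := Lt _ (ltW w1); rewrite (addrC z0) subrK => h; apply: le_trans h _.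
  rewrite expr_div_n mulrA -/A mulrAC -/A expr2 mulrA.
  by apply: ler_wpM2r; [exact: nm_ge0|have := nm_ge0 (w - z0); nra].
split => // v; rewrite deriveE // dE; exact: HL.
Qed.

Lemma diff_continuous_nm (V W : normedModType C) (f : V -> W) z :
  differentiable f z -> forall e : R, 0 < e ->
  exists2 d : R, 0 < d & forall w, nm (w - z) < d -> nm (f w - f z) <= e.
Proof.
move=> /differentiable_continuous/cvgrPdist_le H e e0.
have re0 : 0 < rc e by rewrite -rc0 rc_lt.
have /nearP[d d0 Hd] := H _ re0; exists d => // w /Hd.
by rewrite distrC nmE rc_le.
Qed.

Lemma hol_bounded (V : normedModType C) (z0 : V) (f : V -> C) :
  affine_hol z0 f -> exists r M : R, 0 < r /\ forall z, nm (z - z0) < r ->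
    diffble f z /\ nm (f z) <= M.
Proof.
move=> hf; have df0 : diffble f z0 := nbhs_singleton hf.
have /nearP[r1 r10 H1] := hf.
have [r2 r20 H2] := diff_continuous_nm df0 ltr01.
exists (Num.min r1 r2), (nm (f z0) + 1); split; first by rewrite lt_min r10.
move=> z; rewrite lt_min => /andP[z1 z2]; split; first exact: H1.
have := H2 z z2; have := nm_tri (f z0) (f z) 0; rewrite !subr0.
move: (nm _) (nm _) (nm _) => x y t; lra.
Qed.

Lemma derive_shift_arg (V W : normedModType C) (f : V -> W) (u v z : V) :
  'D_v (fun x => f (x + u)) z = 'D_v f (z + u).
Proof.
rewrite /derive (_ : (fun h => _) = (fun h => h^-1 *: ((f \o shift (z + u)) (h *: v) - f (z + u)))) //.
by apply/funext => h; rewrite /= addrA.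
Qed.

Lemma diff_shift_arg (V W : normedModType C) (f : V -> W) (u z : V) :
  differentiable f (z + u) -> differentiable (fun x => f (x + u)) z.
Proof.
by move=> df; apply: (differentiable_comp (f := fun x => x + u)).
Qed.

(** The difference quotients of f in the direction v with steps t n converge to the derivative with
    an error of at most A times t n, and are uniformly bounded, so [vitali] applies to them. Its
    statement on derivatives expresses the mixed second derivative as a limit of difference
    quotients of ['D_w f], which is the source of [derive_sym]. *)
Lemma hol_derive_aux (V : normedModType C) (z0 v : V) (f : V -> C) :
  affine_hol z0 f -> diffble (fun z => 'D_v (f : V -> C^o) z) z0 /\
  forall w, exists t : nat -> C, (forall n, t n != 0) /\ tends t 0 /\
    tends (fun n => ('D_w (f : V -> C^o) (z0 + t n *: v) -
                     'D_w (f : V -> C^o) z0) / t n)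
      ('D_w (fun z => 'D_v (f : V -> C^o) z) z0).
Proof.
move=> /hol_bounded[r [M [r0 H]]].
have [K K0 HK] := taylor_estimate.
have r2 : 0 < r / 2 by rewrite divr_gt0.
have H2 z : nm (z - z0) < r / 2 -> forall y, nm (y - z) < r / 2 ->
    diffble f y /\ nm (f y) <= M.
  by move=> hz y hy; apply: H; apply: le_lt_trans (nm_tri z _ _) _; lra.
have tay z hz := HK V z (r / 2) M f r2 (fun y hy => (H2 z hz y hy).1)
  (fun y hy => (H2 z hz y hy).2).
(* This keeps all steps t n v within the range of the Taylor estimate on balls of radius r / 2. *)
pose t0 := r / 2 / 8 / (nm v + 1).
have v1 : 0 < nm v + 1 by rewrite ltr_wpDl ?nm_ge0.
have t00 : 0 < t0 by rewrite !divr_gt0.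
pose t n := t0 / 2 ^+ n.
have t0n n : 0 < t n by rewrite divr_gt0 // exprn_gt0.
have tle n : t n <= t0.
  rewrite ler_pdivrMr ?exprn_gt0 // ler_pMr // exprn_ege1 // ler1n //.
have tv n : nm (rc (t n) *: v) <= r / 2 / 8.
  rewrite nmZ (nm_rc (ltW (t0n n))).
  have := tle n; have := nm_ge0 v; have : t0 * (nm v + 1) = r / 2 / 8.
    by rewrite /t0 divfK // gt_eqF.
  have := t0n n; nra.
pose F n z := (f (z + rc (t n) *: v) - f z) / rc (t n).
have rt n : rc (t n) != 0 by rewrite rc_eq0 gt_eqF.
have M0 : 0 <= M.
  by apply: le_trans (H z0 _).2; rewrite ?nm_ge0 // subrr nm0.
have KM0 : 0 <= K * M by rewrite mulr_ge0 // ltW.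
have r20 : 0 <= r / 2 := ltW r2.
pose A := K * M * (nm v / (r / 2)) ^+ 2.
have A0 : 0 <= A by rewrite mulr_ge0 // exprn_ge0 // divr_ge0 ?nm_ge0.
have FD n z : nm (z - z0) < r / 2 ->
    nm (F n z - 'D_v (f : V -> C^o) z) <= A * t n.
  move=> hz; have [_ /(_ _ (tv n)) h] := tay z hz.
  have dz : diffble f z by apply: (H2 z hz z _).1; rewrite subrr nm0.
  have DZ : 'D_(rc (t n) *: v) (f : V -> C^o) z = rc (t n) * ('D_v (f : V -> C^o) z : C).
    by rewrite !deriveE // linearZ.
  move: h; rewrite DZ nmZ (nm_rc (ltW (t0n n))) /F.
  move: ('D_v _ _ : C) (f z) (f _) => y b a h.
  rewrite -(ler_pM2l (t0n n)) -{1}(nm_rc (ltW (t0n n))) -nmM.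
  have -> : rc (t n) * ((a - b) / rc (t n) - y) = a - b - rc (t n) * y.
    by field; exact: rt.
  by apply: le_trans h _; rewrite le_eqVlt; apply/orP; left; apply/eqP; rewrite /A; ring.
have dshift n z : nm (z - z0) < r / 2 -> diffble f (z + rc (t n) *: v).
  move=> hz; apply: (H2 z hz _ _).1.
  by rewrite addrAC subrr add0r; apply: le_lt_trans (tv n) _; lra.
have dF n z : nm (z - z0) < r / 2 -> diffble (F n) z.
  move=> hz; rewrite (_ : F n = (fun z => (rc (t n))^-1 *: (f (z + rc (t n) *: v) - f z : C^o))); last first.
    by apply/funext => y; rewrite /F mulrC.
  apply: differentiableZ; apply: differentiableB.
    by apply: diff_shift_arg; exact: dshift.
  by apply: (H2 z hz z _).1; rewrite subrr nm0.
have FB n z : nm (z - z0) < r / 2 -> nm (F n z) <= A * t0 + K * M * nm v / (r / 2).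
  move=> hz; have := FD n z hz; have := (tay z hz).1 v.
  have : A * t n <= A * t0 by rewrite ler_wpM2l.
  have := nmD (F n z - 'D_v (f : V -> C^o) z) ('D_v (f : V -> C^o) z : C).
  rewrite subrK; move: (nm _) (nm _) (nm _) => x y s; move: (K * M * nm v / (r / 2)) => B.
  move: (A * t n) (A * t0) => *; lra.
have FT z : nm (z - z0) < r / 2 -> tends (F ^~ z) ('D_v (f : V -> C^o) z).
  move=> hz e e0; have [N HN] := half_pow_small (A * t0) e0; exists N => n nN.
  by apply: le_trans (FD n z hz) _; rewrite /t mulrA; exact: HN.
have [d1 d2] := vitali r2 dF FB FT.
split => // w; exists (fun n => rc (t n)); split => //; split.
  move=> e e0; have [N HN] := half_pow_small t0 e0; exists N => n nN.
  by rewrite subr0 (nm_rc (ltW (t0n n))); exact: HN.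
have z0r : nm (z0 - z0) < r / 2 by rewrite subrr nm0.
have := d2 w; congr (tends _ _); apply/funext => n.
rewrite (_ : F n = (fun z => (rc (t n))^-1 *: (f (z + rc (t n) *: v) - f z : C^o))); last first.
  by apply/funext => y; rewrite /F mulrC.
have dz : diffble f z0 by apply: (H2 z0 z0r z0 _).1; rewrite subrr nm0.
have ds := diff_shift_arg (dshift n z0 z0r).
rewrite deriveZ; last by apply: diff_derivable; apply: differentiableB.
rewrite deriveB; [|exact: diff_derivable|exact: diff_derivable].
by rewrite derive_shift_arg [RHS]mulrC.
Qed.

End SeveralVariables.

(** * Higher derivatives and integrals depending on parameters *)

Section HolomorphicDerivatives.
Variable R : realType.
Local Notation C := (CC R).
Local Notation diffble f x := (differentiable (f : _ -> C^o) x).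

Lemma scaleoE (a : C) (x : C^o) : a *: x = a * (x : C) :> C.
Proof. by []. Qed.

Lemma hol_derive (V : normedModType C) (z0 v : V) (f : V -> C) :
  affine_hol z0 f -> affine_hol z0 (fun z => 'D_v (f : V -> C^o) z).
Proof.
move=> /affine_hol_near; apply: filterS => z hz.
by have [] := hol_derive_aux v hz.
Qed.

Lemma derive_quotient (V : normedModType C) (f : V -> C) z v (t : nat -> C) :
  diffble f z -> (forall n, t n != 0) -> tends t 0 ->
  tends (fun n => (f (z + t n *: v) - f z) / t n) ('D_v (f : V -> C^o) z).
Proof.
move=> df tn t0 e e0.
have v1 : 0 < nm v + 1 by rewrite ltr_wpDl ?nm_ge0.
have e1 : 0 < e / (nm v + 1) by rewrite divr_gt0.
have [d d0 Hd] := diff_eps df e1.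
have d1 : 0 < d / 2 / (nm v + 1) by rewrite !divr_gt0.
have [N HN] := t0 _ d1; exists N => n /HN; rewrite subr0 => tnd.
have tv : nm (t n *: v) < d.
  rewrite nmZ; apply: (@le_lt_trans _ _ (d / 2)); last by lra.
  apply: (@le_trans _ _ (nm (t n) * (nm v + 1))).
    by rewrite ler_wpM2l ?nm_ge0 // lerDl.
  by rewrite -ler_pdivlMr.
have := Hd (z + t n *: v); rewrite addrAC subrr add0r => /(_ tv).
rewrite linearZ /= -deriveE // nmZ -[_ *: 'D_v _ _]/(t n * ('D_v _ _ : C)).
move: ('D_v _ _ : C) (f z) (f _) => y b a h.
have tp : 0 < nm (t n) by rewrite nm_gt0.
rewrite -(ler_pM2l tp) -nmM.
have -> : t n * ((a - b) / t n - y) = a - b - t n * y by field; exact: tn.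
apply: le_trans h _.
rewrite mulrCA ler_pM2l // mulrAC ler_pdivrMr //.
by apply: ler_wpM2l; [exact: ltW|rewrite lerDl].
Qed.

(** Both sides are limits of the same difference quotients of ['D_w f] in the direction v: the left
    one by [hol_derive_aux], the right one because ['D_w f] is differentiable. *)
Lemma derive_sym (V : normedModType C) (z0 v w : V) (f : V -> C) :
  affine_hol z0 f ->
  'D_w (fun z => 'D_v (f : V -> C^o) z) z0 =
  'D_v (fun z => 'D_w (f : V -> C^o) z) z0.
Proof.
move=> hf; have [_ /(_ w)[t [tn [t0 H]]]] := hol_derive_aux v hf.
have [dw _] := hol_derive_aux w hf.
exact: tends_uniq H (derive_quotient v dw tn t0).
Qed.

Lemma trap_diff (V : normedModType C) (h : C -> V -> C) D n a b z :
  midclosed D -> (forall t, D t -> diffble (h t) z) -> D a -> D b ->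
  diffble (fun y => trap (h ^~ y) n a b) z /\
  forall v, 'D_v (fun y => trap (h ^~ y) n a b : C^o) z =
    trap (fun t => 'D_v (h t : V -> C^o) z) n a b.
Proof.
move=> mD dh; elim: n a b => [|n IH] a b Da Db /=.
  have E : (fun y => (h a y + h b y) / 2 * (b - a)) =
      (fun y => ((b - a) / 2) *: (h a y + h b y : C^o)).
    by apply/funext => y; rewrite scaleoE; ring.
  have da := dh a Da; have db := dh b Db.
  have dab : diffble (fun y => h a y + h b y) z by exact: differentiableD.
  split; first by rewrite E; exact: differentiableZ.
  move=> v; rewrite E deriveZ; last exact: diff_derivable.
  rewrite deriveD; [|exact: diff_derivable|exact: diff_derivable].
  move: ('D_v (h a : V -> C^o) z) ('D_v (h b : V -> C^o) z) => x y.
  by rewrite scaleoE; ring.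
have Dm := mD _ _ Da Db.
have [d1 e1] := IH _ _ Da Dm; have [d2 e2] := IH _ _ Dm Db.
split; first exact: differentiableD.
move=> v; rewrite -e1 -e2 deriveD //; exact: diff_derivable.
Qed.

(* The trapezoid sums are uniformly bounded near z0 by Cousin's lemma, so that
   [vitali] applies to them. *)
Lemma diff_intg (V : normedModType C) (h : C -> V -> C) D a b z0 :
  midclosed D -> seqclosed D -> D a -> D b ->
  (forall t0, D t0 -> exists d M : R, 0 < d /\ forall t, D t -> nm (t - t0) < d ->
     forall z, nm (z - z0) < d -> diffble (h t) z /\ nm (h t z) <= M) ->
  (exists2 d : R, 0 < d & forall z, nm (z - z0) < d -> contD D (h ^~ z)) ->
  (forall v, contD D (fun t => 'D_v (h t : V -> C^o) z0)) ->
  diffble (fun z => intg (h ^~ z) a b) z0 /\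
  forall v, 'D_v (fun z => intg (h ^~ z) a b : C^o) z0 =
    intg (fun t => 'D_v (h t : V -> C^o) z0) a b.
Proof.
move=> mD sD Da Db H1 [d1 d10 H2] H3.
have H u w : D u -> D w -> exists d M : R, 0 < d /\ forall n z, nm (z - z0) < d ->
    diffble (fun z => trap (h ^~ z) n u w) z /\ nm (trap (h ^~ z) n u w) <= M.
  move=> Du Dw; move: u w Du Dw.
  apply: (cousin_seg mD sD).
    move=> u w Du Dw [r1 [M1 [r10 HM1]]] [r2 [M2 [r20 HM2]]].
    have [r3 [M3 [r30 HM3]]] := H1 u Du; have [r4 [M4 [r40 HM4]]] := H1 w Dw.
    exists (Num.min (Num.min r1 r2) (Num.min r3 r4)).
    (* A sum of positive order splits over the two halves; the sum of order 0 does not, and is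
       bounded through the values at u and w. *)
    exists (Num.max (M1 + M2) ((M3 + M4) / 2 * nm (w - u))).
    split; first by rewrite !lt_min r10 r20 r30 r40.
    move=> n z; rewrite !lt_min => /andP[/andP[z1 z2] /andP[z3 z4]].
    have [du hu] : diffble (h u) z /\ nm (h u z) <= M3.
      by apply: HM3; rewrite // subrr nm0.
    have [dw hw] : diffble (h w) z /\ nm (h w z) <= M4.
      by apply: HM4; rewrite // subrr nm0.
    case: n => [|n] /=.
      split.
        rewrite (_ : (fun y => _) = (fun y => ((w - u) / 2) *: (h u y + h w y : C^o))); last first.
          by apply/funext => y; rewrite scaleoE; ring.
        by apply: differentiableZ; exact: differentiableD.
      rewrite le_max; apply/orP; right; rewrite nmM nm_half.
      apply: ler_wpM2r; first exact: nm_ge0.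
      by have := nmD (h u z) (h w z); lra.
    have [e1 b1] := HM1 n z z1; have [e2 b2] := HM2 n z z2.
    split; first exact: differentiableD.
    rewrite le_max; apply/orP; left; apply: le_trans (nmD _ _) _; exact: lerD.
  move=> t0 Dt0; have [d [M [d0 HM]]] := H1 t0 Dt0.
  exists (d / 2); first by rewrite divr_gt0.
  move=> u w Du Dw ut wu; exists d, (M * nm (w - u)); split => // n z hz.
  have mD' := midclosedI mD (@midclosed_ball R t0 d).
  have ud : nm (u - t0) < d by lra.
  have wd : nm (w - t0) < d by apply: le_lt_trans (nm_tri u _ _) _; lra.
  split.
    apply: (trap_diff _ mD' _ (conj Du ud) (conj Dw wd)).1 => t [Dt td].
    by have [] := HM t Dt td z hz.
  apply: (trap_bound0 _ mD' _ (conj Du ud) (conj Dw wd)) => t [Dt td].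
  by have [] := HM t Dt td z hz.
have [r [M [r0 HM]]] := H a b Da Db.
have dz t : D t -> diffble (h t) z0.
  move=> Dt; have [d [M' [d0 HM']]] := H1 t Dt.
  by have [] := HM' t Dt _ z0 _; rewrite // subrr nm0.
have rd : 0 < Num.min r d1 by rewrite lt_min r0.
have [] := @vitali R V z0 (Num.min r d1) M (fun n z => trap (h ^~ z) n a b)
  (fun z => intg (h ^~ z) a b) rd.
- by move=> n z; rewrite lt_min => /andP[zr _]; have [] := HM n z zr.
- by move=> n z; rewrite lt_min => /andP[zr _]; have [] := HM n z zr.
- move=> z; rewrite lt_min => /andP[_ zd].
  exact: (trap_tends mD sD (H2 z zd) Da Db).
move=> di Di; split => // v.
have T := trap_tends mD sD (H3 v) Da Db.
apply: tends_uniq (Di v) _.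
by under eq_fun do rewrite (trap_diff _ mD dz Da Db).2.
Qed.

End HolomorphicDerivatives.

(** * Row vectors and the inverse function theorem *)

Section RowVectors.
Variable R : realType.
Local Notation C := (CC R).
Local Notation diffble f x := (differentiable (f : _ -> C^o) x).

Lemma nm_row_lt d (x : 'rV[C]_d) (M : R) : 0 < M ->
  nm x < M <-> forall j, nm (x 0 j) < M.
Proof.
move=> M0; have H (V : normedModType C) (y : V) : nm y < M <-> ball (0 : V) (rc M) y.
  by rewrite -ball_normE /ball_ /= sub0r normrN nmE rc_lt.
split=> [/H[_ h] j|h]; first by apply/H; have := h 0 j; rewrite mxE.
apply/H; split=> [|i j]; first by rewrite -rc0 rc_lt.
by rewrite ord1 mxE; apply/H/h.
Qed.

Lemma nm_row_le d (x : 'rV[C]_d) (M : R) : 0 <= M ->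
  (forall j, nm (x 0 j) <= M) -> nm x <= M.
Proof.
move=> M0 h; apply/ler_addgt0Pr => e e0; apply: ltW; apply/nm_row_lt.
  by rewrite ltr_wpDl.
by move=> j; apply: le_lt_trans (h j) _; rewrite ltrDl.
Qed.

Lemma nm_coord d (x : 'rV[C]_d) j : nm (x 0 j) <= nm x.
Proof.
apply/ler_addgt0Pr => e e0; apply: ltW.
have e1 : 0 < nm x + e by rewrite ltr_wpDl ?nm_ge0.
by apply: (nm_row_lt x e1).1; rewrite ltrDl.
Qed.

(** The reciprocal of 1 plus the sum of the reciprocals is a lower bound; the 1 covers the empty
    family. *)
Lemma fin_pos (T : finType) (r : T -> R) : (forall j, 0 < r j) ->
  exists2 m : R, 0 < m & forall j, m <= r j.
Proof.
move=> r0; have S0 : 0 <= \sum_j (r j)^-1 by apply: sumr_ge0 => j _; rewrite invr_ge0 ltW.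
exists (\sum_j (r j)^-1 + 1)^-1; first by rewrite invr_gt0 ltr_wpDl.
move=> j; rewrite -[leRHS]invrK lef_pV2 ?posrE ?invr_gt0 ?ltr_wpDl //.
rewrite (bigD1 j) //= -addrA lerDl addr_ge0 // sumr_ge0 // => k _.
by rewrite invr_ge0 ltW.
Qed.

Definition coordl d (j : 'I_d) (x : 'rV[C]_d) : C^o := x 0 j.

Lemma coordl_linear d (j : 'I_d) : linear (@coordl d j).
Proof. by move=> a x y; rewrite /coordl !mxE. Qed.

HB.instance Definition _ d (j : 'I_d) :=
  GRing.isLinear.Build C 'rV[C]_d C^o _ (@coordl d j) (@coordl_linear d j).

Lemma coordl_continuous d (j : 'I_d) : continuous (@coordl d j).
Proof. by move=> x; apply: differentiable_continuous; exact: differentiable_coord. Qed.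

Section Maps.
Variables (V : normedModType C) (d : nat).
Implicit Types (G : V -> 'rV[C]_d) (z : V).

Lemma diff_rowP G z :
  differentiable G z <-> forall j, diffble (fun y => G y 0 j) z.
Proof.
split=> [dG j|dG].
  exact: (differentiable_comp dG (differentiable_coord (G z) 0 j)).
have -> : G = \sum_(j < d) (fun y => (G y 0 j : C) *: (delta_mx 0 j : 'rV[C]_d)).
  by apply/funext => y; rewrite fct_sumE {1}[G y]row_sum_delta.
apply: differentiable_sum => j; exact: (differentiableZl _ (dG j)).
Qed.

Lemma derive_row G z v j : differentiable G z ->
  ('D_v G z) 0 j = 'D_v (fun y => G y 0 j : C^o) z.
Proof.
move=> dG; rewrite !deriveE //; last exact: ((diff_rowP _ _).1 dG).
have dc := differentiable_coord (G z) 0 j.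
have := diff_comp dG dc; rewrite -[X in 'd (X \o G) _]/(coordl j) => ->.
by rewrite /= (diff_lin _ (@coordl_continuous d j)).
Qed.

Lemma hol_rowP G z : (forall j, affine_hol z (fun y => G y 0 j)) <->
  \forall y \near z, differentiable G y.
Proof.
split=> [H|H j]; last by apply: filterS H => y /diff_rowP.
have : \forall y \near z, forall j, diffble (fun x => G x 0 j) y.
  exact: filter_forall.
by apply: filterS => y /diff_rowP.
Qed.

End Maps.

Lemma row_geometric_lim d (u : nat -> 'rV[C]_d) (s : nat -> R) :
  (forall n, s n.+1 <= s n / 2) ->
  (forall n, nm (u n.+1 - u n) <= s n / 2) ->
  exists2 l, tends u l & forall n, nm (u n - l) <= s n.
Proof.
move=> s2 us.
have s0 n : 0 <= s n by have := us n; have := nm_ge0 (u n.+1 - u n); lra.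
have H j : exists l : C, forall n, nm (u n 0 j - l) <= s n.
  have [|l _ Hl] := @geometric_lim R (fun n => u n 0 j) s s2; last by exists l.
  move=> n; apply: le_trans (us n).
  by have := nm_coord (u n.+1 - u n) j; rewrite !mxE.
have [l Hl] := choice H.
have B n : nm (u n - \row_j l j) <= s n.
  by apply: nm_row_le => // j; rewrite !mxE.
exists (\row_j l j) => // e e0.
have [N HN] := half_pow_small (s 0) e0; exists N => n nN.
apply: le_trans (B n) _; apply: le_trans (HN n nN).
elim: n {nN} => [|n IH]; first by rewrite expr0 divr1.
by rewrite exprS invfM mulrA mulrAC; have := s2 n; lra.
Qed.

(* The Taylor estimate bounds f by a multiple of s^2 on the ball of radius s, and
   the Cauchy estimate on that ball then bounds its derivative by a multiple of s. *)
Lemma flat_lipschitz (V : normedModType C) (z1 : V) (f : V -> C) :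
  affine_hol z1 f -> (forall v, 'D_v (f : V -> C^o) z1 = 0) ->
  exists2 p : R, 0 < p & forall z z', nm (z - z1) < p -> nm (z' - z1) < p ->
    nm (f z - f z') <= nm (z - z') / 2.
Proof.
move=> hf f0; have [r [M [r0 H]]] := hol_bounded hf.
have [K K0 HK] := taylor_estimate R.
have [_ T] := HK V z1 r M f r0 (fun z hz => (H z hz).1) (fun z hz => (H z hz).2).
have M0 : 0 <= M by apply: le_trans (H z1 _).2; rewrite ?nm_ge0 // subrr nm0.
have A0 : 0 <= K * M / r ^+ 2 by rewrite divr_ge0 ?mulr_ge0 ?exprn_ge0 ?(ltW K0) ?(ltW r0).
set A := K * M / r ^+ 2 in A0.
have KA0 : 0 < K * A * 8 + 1 by rewrite ltr_wpDl // mulr_ge0 // mulr_ge0 // ltW.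
pose s := Num.min (r / 8) (1 / (K * A * 8 + 1)).
have s0 : 0 < s by rewrite lt_min !divr_gt0.
have sr : s <= r / 8 by rewrite ge_min lexx.
have sA : s * (K * A * 8 + 1) <= 1 by rewrite -ler_pdivlMr // ge_min lexx orbT.
have small z : nm (z - z1) < s -> nm (f z - f z1) <= A * s ^+ 2.
  move=> zs; have zr : nm (z - z1) <= r / 8 by lra.
  have := T (z - z1) zr; rewrite f0 subr0 (addrC z1) subrK => h.
  apply: le_trans h _.
  have -> : K * M * (nm (z - z1) / r) ^+ 2 = A * nm (z - z1) ^+ 2.
    by rewrite /A; field; rewrite gt_eqF.
  apply: ler_wpM2l => //.
  by rewrite ler_pXn2r ?nnegrE ?nm_ge0 ?(ltW s0) // ltW.
have s2 : 0 < s / 2 by rewrite divr_gt0.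
exists (s / 32); first by rewrite divr_gt0.
move=> z z' hz hz'.
pose g x := f x - f z1.
have inb x : nm (x - z) < s / 2 -> nm (x - z1) < s.
  by move=> hx; apply: le_lt_trans (nm_tri z _ _) _; lra.
have dg x : nm (x - z) < s / 2 -> diffble g x.
  move=> /inb hx; apply: differentiableB; last exact: differentiable_cst.
  by apply: (H x _).1; lra.
have [B1 B2] := HK V z (s / 2) (A * s ^+ 2) g s2 dg (fun x hx => small x (inb x hx)).
have hz8 : nm (z' - z) <= s / 2 / 8.
  by apply: le_trans (nm_tri z1 _ _) _; rewrite (nm_dist z1); lra.
have := B2 _ hz8; rewrite (addrC z) subrK.
have := B1 (z' - z).
have -> : g z' - g z = f z' - f z by rewrite /g; ring.
rewrite (nm_dist (f z)) (nm_dist z).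
move: ('D_(z' - z) (g : V -> C^o) z : C) (nm_ge0 (z' - z)) hz8.
move: (nm (z' - z)) => x y x0 hx h1 h2.
have := nmD (f z' - f z - y) y; rewrite subrK => h3; apply: le_trans h3 _.
have E1 : K * (A * s ^+ 2) * x / (s / 2) = 2 * (s * (K * A)) * x.
  by field; rewrite gt_eqF.
have E2 : K * (A * s ^+ 2) * (x / (s / 2)) ^+ 2 = 4 * (K * A) * (x * x).
  by field; rewrite gt_eqF.
move: h1 h2; rewrite E1 E2.
have k0 : 0 <= K * A by rewrite mulr_ge0 // ltW.
move: (K * A) k0 sA => k k0 sA h1 h2.
have h4 : k * (x * x) <= k * (s / 16 * x).
  by apply: ler_wpM2l => //; apply: ler_wpM2r => //; lra.
have h5 : s * k * x <= x / 8.
  by rewrite [leRHS]mulrC; apply: ler_wpM2r => //; lra.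
have h6 : k * (s / 16 * x) <= x / 8 / 16.
  by rewrite (_ : k * (s / 16 * x) = s * k * x / 16) ?ler_pM2r //; ring.
by move: (nm (_ - _ - _)) (nm y) h1 h2 => a b h1 h2; lra.
Qed.

Lemma fin_near (V : normedModType C) (z : V) (T : finType)
    (P : T -> V -> V -> Prop) :
  (forall j, exists2 p : R, 0 < p & forall x y, nm (x - z) < p ->
     nm (y - z) < p -> P j x y) ->
  exists2 p : R, 0 < p & forall x y, nm (x - z) < p -> nm (y - z) < p ->
     forall j, P j x y.
Proof.
move=> H; have [r Hr] := choice (fun j => (fun e => e) (let: ex_intro2 p p0 Hp := H j in
  ex_intro (fun p => 0 < p /\ forall x y, nm (x - z) < p -> nm (y - z) < p -> P j x y)
    p (conj p0 Hp))).
have [p p0 Hp] := fin_pos (fun j => (Hr j).1).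
exists p => // x y hx hy j; apply: (Hr j).2; apply: lt_le_trans (Hp j) => //.
Qed.

Lemma flat_row_lipschitz d e (z1 : 'rV[C]_d) (G : 'rV[C]_d -> 'rV[C]_e) :
  (\forall z \near z1, differentiable G z) -> (forall v, 'D_v G z1 = 0) ->
  exists2 p : R, 0 < p & forall z z', nm (z - z1) < p -> nm (z' - z1) < p ->
    nm (G z - G z') <= nm (z - z') / 2.
Proof.
move=> hG G0; have dG := nbhs_singleton hG.
have [|p p0 Hp] := @fin_near 'rV[C]_d z1 'I_e
  (fun j z z' => nm (G z 0 j - G z' 0 j) <= nm (z - z') / 2).
  move=> j; apply: (@flat_lipschitz _ _ (fun z => G z 0 j)).
    exact: (hol_rowP _ _).2.
  by move=> v; rewrite -(derive_row v j dG) G0 mxE.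
exists p => // z z' hz hz'; apply: nm_row_le.
  by rewrite divr_ge0 // nm_ge0.
by move=> j; rewrite !mxE; exact: Hp.
Qed.

(* Picard iteration for x = y + (x - Psi x); its limit depends holomorphically
   on y by [vitali]. *)
Lemma inverse_function d (Psi : 'rV[C]_d -> 'rV[C]_d) (z1 : 'rV[C]_d) (e : R) :
  0 < e -> (\forall z \near z1, differentiable Psi z) ->
  (forall v, 'D_v Psi z1 = v) ->
  exists (Phi : 'rV[C]_d -> 'rV[C]_d) (r : R), [/\ 0 < r,
    forall y, nm (y - Psi z1) < r -> [/\ differentiable Phi y, nm (Phi y - z1) < e &
      Psi (Phi y) = y] &
    exists2 r' : R, 0 < r' & forall z, nm (z - z1) < r' ->
      nm (Psi z - Psi z1) < r /\ Phi (Psi z) = z].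
Proof.
move=> e0 hP dP1; have dP := nbhs_singleton hP.
pose G z := z - Psi z.
have hG : \forall z \near z1, differentiable G z.
  apply: filterS hP => z dz; apply: differentiableB; last exact: dz.
  exact: differentiable_idfun.
have G0 v : 'D_v G z1 = 0.
  rewrite deriveB; [|exact: derivable_id|exact: diff_derivable].
  by rewrite derive_id dP1 subrr.
have [p1 p10 L] := flat_row_lipschitz hG G0.
have /nearP[p2 p20 dG] := hG.
pose p := Num.min (Num.min p1 p2) e.
have pp : 0 < p by rewrite !lt_min p10 p20.
have pp1 : p <= p1 by rewrite !ge_min lexx.
have pp2 : p <= p2 by rewrite !ge_min lexx orbT.
have pe : p <= e by rewrite !ge_min lexx orbT.
(* G is a contraction of ratio 1/2 near z1, so for y within r of y1 the iterates stay within 2 r = p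
   / 2 of z1. *)
set y1 := Psi z1; pose r := p / 4; have r0 : 0 < r by rewrite divr_gt0.
pose x n y := iter n (fun x => y + G x) z1.
have yE : y1 = z1 - G z1 by rewrite /G opprB addrC subrK.
have xb n y : nm (y - y1) < r -> nm (x n y - z1) <= 2 * r.
  move=> hy; elim: n => [|n IH] /=; first by rewrite subrr nm0 mulr_ge0 // ltW.
  have -> : y + G (x n y) - z1 = (y - y1) + (G (x n y) - G z1).
    by rewrite yE opprB [RHS]addrACA (addrAC (G z1)) subrr add0r.
  apply: le_trans (nmD _ _) _.
  have xp : nm (x n y - z1) < p1 by apply: le_lt_trans IH _; rewrite /r; lra.
  have zp : nm (z1 - z1) < p1 by rewrite subrr nm0.
  by have := L _ _ xp zp; lra.
have xp1 n y : nm (y - y1) < r -> nm (x n y - z1) < p1.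
  by move=> hy; apply: le_lt_trans (xb n y hy) _; rewrite /r; lra.
have xi n y : nm (y - y1) < r -> nm (x n.+1 y - x n y) <= 2 * r / 2 ^+ n / 2.
  move=> hy; elim: n => [|n IH].
    rewrite expr0 divr1 /= (_ : y + G z1 - z1 = y - y1); last first.
      by rewrite yE opprB -addrA.
    by move: (nm _) hy => a; lra.
  rewrite [x n.+2 y]/= [X in _ - X]/= opprD addrACA subrr add0r.
  apply: le_trans (L _ _ (xp1 n.+1 y hy) (xp1 n y hy)) _.
  have -> : 2 * r / 2 ^+ n.+1 / 2 = 2 * r / 2 ^+ n / 2 / 2.
    by rewrite exprS invfM; ring.
  by apply: ler_wpM2r => //; rewrite invr_ge0.
have xlim y : exists l, nm (y - y1) < r -> tends (x ^~ y) l.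
  have [hy|] := pselect (nm (y - y1) < r); last by exists 0.
  have [||l tl _] := @row_geometric_lim d (x ^~ y) (fun n => 2 * r / 2 ^+ n).
  - by move=> n; rewrite exprS invfM mulrA mulrAC.
  - by move=> n; exact: xi.
  by exists l.
have [Phi tPhi] := choice xlim.
have Pb y : nm (y - y1) < r -> nm (Phi y - z1) <= 2 * r.
  move=> hy; apply: tends_bound (tPhi y hy) _.
  by exists 0 => n _; exact: xb.
have fixP y : nm (y - y1) < r -> Phi y = y + G (Phi y).
  move=> hy; apply: (tends_uniq (tPhi y hy)); apply/tends_shift => e' e'0.
  have [N HN] := tPhi y hy e' e'0; exists N => n nN /=.
  rewrite opprD addrACA subrr add0r.
  have Pp : nm (Phi y - z1) < p1 by apply: le_lt_trans (Pb y hy) _; rewrite /r; lra.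
  apply: le_trans (L _ _ (xp1 n y hy) Pp) _.
  by have := HN n nN; have := nm_ge0 (x n y - Phi y); move: (nm _) => a; lra.
have dx n y : nm (y - y1) < r -> differentiable (x n) y.
  move=> hy; elim: n => [|n IH]; first exact: differentiable_cst.
  apply: (@differentiableD _ _ _ (fun y => y) (fun y => G (x n y))).
    exact: differentiable_idfun.
  apply: (differentiable_comp IH); apply: dG.
  by apply: lt_le_trans pp2; apply: le_lt_trans (xb n y hy) _; rewrite /r; lra.
have dPhi y : nm (y - y1) < r -> differentiable Phi y.
  move=> hy; apply/diff_rowP => j.
  have s0 : 0 < r - nm (y - y1) by rewrite subr_gt0.
  have inb y' : nm (y' - y) < r - nm (y - y1) -> nm (y' - y1) < r.
    by move=> hy'; apply: le_lt_trans (nm_tri y _ _) _; lra.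
  apply: (@vitali R _ y (r - nm (y - y1)) (2 * r + nm z1) (fun n y => x n y 0 j)
    (fun y => Phi y 0 j) s0 _ _ _).1.
  - move=> n y' /inb /(dx n) dn; exact: ((diff_rowP (x n) y').1 dn j).
  - move=> n y' /inb hy'; apply: le_trans (nm_coord _ _) _.
    by rewrite -[x n y'](subrK z1); apply: le_trans (nmD _ _) _; rewrite lerD2r xb.
  - move=> y' /inb hy' e' e'0; have [N HN] := tPhi y' hy' e' e'0.
    exists N => n nN; apply: le_trans (HN n nN).
    by have := nm_coord (x n y' - Phi y') j; rewrite !mxE.
have GPhi y : nm (y - y1) < r -> G (Phi y) = Phi y - y.
  by move=> hy; rewrite [in RHS](fixP y hy) addrAC subrr add0r.
exists Phi, r; split; first exact: r0.
  move=> y hy; split; first exact: dPhi.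
    by apply: lt_le_trans pe; apply: le_lt_trans (Pb y hy) _; rewrite /r; lra.
  have -> : Psi (Phi y) = Phi y - G (Phi y) by rewrite /G opprB addrC subrK.
  by rewrite (GPhi y hy) opprB addrC subrK.
have [p3 p30 cP] := diff_continuous_nm dP (divr_gt0 r0 (ltr0n _ 2)).
exists (Num.min p1 p3); first by rewrite lt_min p10.
move=> z; rewrite lt_min => /andP[z1' z3].
have hy : nm (Psi z - y1) < r.
  by apply: le_lt_trans (cP z z3) _; lra.
split => //; apply/eqP; rewrite -subr_eq0; apply/eqP/nm_le0.
have Pp : nm (Phi (Psi z) - z1) < p1 by apply: le_lt_trans (Pb _ hy) _; rewrite /r; lra.
have := L _ _ Pp z1'.
have -> : G (Phi (Psi z)) - G z = Phi (Psi z) - z.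
  by rewrite (GPhi _ hy) /G opprB addrA subrK.
by move: (nm _) => a; lra.
Qed.

End RowVectors.

(** * The constant rank theorem *)

Section ConstantRank.
Variable R : realType.
Local Notation C := (CC R).
Local Notation diffble f x := (differentiable (f : _ -> C^o) x).

Lemma nm_mulmx d e (x : 'rV[C]_d) (B : 'M[C]_(d, e)) :
  nm (x *m B) <= (\sum_j nm (row j B)) * nm x.
Proof.
rewrite mulmx_sum_row mulr_suml; apply: le_trans (nm_sum _ _) _.
apply: ler_sum => j _; rewrite nmZ mulrC; apply: ler_wpM2l (nm_ge0 _) _ _ _.
exact: nm_coord.
Qed.

Lemma diff_mulmxr d e (B : 'M[C]_(d, e)) (z : 'rV[C]_d) :
  differentiable (fun x => x *m B) z /\ forall v, 'D_v (fun x => x *m B) z = v *m B.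
Proof.
have [|e0|dB dE] := @eps_diff R _ _ (mulmxr B) z (mulmxr B) (\sum_j nm (row j B)).
- by move=> v; exact: nm_mulmx.
- move=> e00; exists 1 => // w _; rewrite /= mulmxBl subrr nm0.
  by rewrite mulr_ge0 ?nm_ge0 // ltW.
by split => // v; rewrite deriveE // dE.
Qed.

Lemma derive_comp (U V W : normedModType C) (f : U -> V) (g : V -> W) z v :
  differentiable f z -> differentiable g (f z) ->
  'D_v (g \o f) z = 'D_('D_v f z) g (f z).
Proof.
move=> df dg; have dgf := differentiable_comp df dg.
by rewrite (deriveE v dgf) (diff_comp df dg) (deriveE _ dg) (deriveE v df).
Qed.

Lemma derive_line (V : normedModType C) (z u : V) (x : C) :
  'D_(1 : C) (fun x : C => z + x *: u) x = u.
Proof.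
have d1 : differentiable (fun x : C => x *: u) x.
  by apply: (@differentiableZl _ C V (fun x => x)); exact: differentiable_idfun.
rewrite (_ : (fun x : C => z + x *: u) = cst z + (fun x : C => x *: u)) //.
rewrite deriveD; [|exact: derivable_cst|exact: diff_derivable].
rewrite derive_cst add0r (deriveE (1 : C) d1).
rewrite (diffZl (k := fun x : C => x) u); last exact: differentiable_idfun.
by rewrite /= -(deriveE (1 : C) (differentiable_idfun x)) derive_id scale1r.
Qed.

Lemma const_along (V : normedModType C) (f : V -> C) (z u : V) :
  (forall x : C, nm x <= 1 -> diffble f (z + x *: u) /\
     'D_u (f : V -> C^o) (z + x *: u) = 0) ->
  f (z + u) = f z.
Proof.
move=> H; pose g (x : C) := f (z + x *: u).
have dl (x : C) : differentiable (fun x : C => z + x *: u) x.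
  apply: differentiableD; first exact: differentiable_cst.
  exact: (@differentiableZl _ C V (fun x => x)).
have mD : midclosed (fun w : C => nm w <= 1).
  by have := @midclosed_cball R 0 1; under eq_fun do rewrite subr0.
have sD : seqclosed (fun w : C => nm w <= 1).
  by have := @seqclosed_cball R 0 1; under eq_fun do rewrite subr0.
have c0 : contD (fun w : C => nm w <= 1) (fun=> 0).
  by move=> ? _ e e0; exists 1 => // w _ _; rewrite subrr nm0 ltW.
have [h0 h1] : nm (0 : C) <= 1 /\ nm (1 : C) <= 1 by rewrite nm0 nm1.
have := @intg_ftc R _ g (fun=> 0) 0 1 mD sD c0 _ h0 h1.
have -> : intg (fun=> 0 : C) 0 1 = 0 :> C.
  have := intg_affine (0 : C) 0 0 1; rewrite (_ : (fun w => _) = (fun=> 0)).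
    by rewrite !mul0r addr0.
  by apply/funext => w; rewrite mul0r addr0.
rewrite /g scale0r scale1r addr0 => E; apply/eqP; rewrite -subr_eq0 -E //.
move=> x x1; have [dx Dx] := H x x1.
have dg : diffble g x := differentiable_comp (dl x) dx.
have dg0 : 'd (g : C -> C^o) x 1 = 0 :> C.
  rewrite -(deriveE (1 : C) dg) -[RHS]Dx.
  have := @derive_comp C V C^o (fun x : C => z + x *: u) f x 1 (dl x) dx.
  by rewrite derive_line.
by have := @diff_diffD R g (fun w => nm w <= 1) x dg; rewrite dg0.
Qed.

(** The kernel of J is contained in that of J P, and the hypothesis on ranks forces the two to have
    the same dimension. *)
Lemma kernel_rank (d e r : nat) (J : 'M[C]_(d, e)) (P : 'M[C]_(e, r)) (v : 'rV[C]_d) :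
  (\rank J <= \rank (J *m P))%N -> v *m (J *m P) = 0 -> v *m J = 0.
Proof.
move=> rk /eqP vJP; apply/eqP.
have sub : (kermx J <= kermx (J *m P))%MS.
  by apply/sub_kermxP; rewrite mulmxA mulmx_ker mul0mx.
have : (kermx (J *m P) <= kermx J)%MS.
  have [_ <-] := mxrank_leqif_sup sub.
  rewrite eqn_leq; apply/andP; split; first exact: mxrankS.
  apply: leq_trans (eq_leq (mxrank_ker (J *m P))) _.
  apply: leq_trans _ (eq_leq (esym (mxrank_ker J))).
  by apply: leq_sub2l; exact: rk.
move=> s; rewrite -sub_kermx; apply: submx_trans s.
by rewrite sub_kermx.
Qed.

Definition jac d e (F : 'rV[C]_d -> 'rV[C]_e) z : 'M[C]_(d, e) := lin1_mx ('d F z).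

Lemma jacE d e (F : 'rV[C]_d -> 'rV[C]_e) z v :
  differentiable F z -> 'D_v F z = v *m jac F z.
Proof. by move=> dF; rewrite deriveE // mul_rV_lin1. Qed.

Lemma diff_mulmx_comp (V : normedModType C) d e (F : V -> 'rV[C]_d)
    (B : 'M[C]_(d, e)) z : differentiable F z ->
  differentiable (fun x => F x *m B) z /\
  forall v, 'D_v (fun x => F x *m B) z = 'D_v F z *m B.
Proof.
move=> dF; have [dB EB] := diff_mulmxr B (F z).
split; first exact: (differentiable_comp dF dB).
by move=> v; rewrite -EB -(derive_comp v dF dB).
Qed.

(* With J(z1) = c *m b the rank factorization and c', b' one-sided inverses,
   Psi z = F z *m b' *m c' + z *m (1 - c *m c') is a local chart in which F depends
   only on y *m c. *)
Lemma constant_rank d e (F : 'rV[C]_d -> 'rV[C]_e) (z1 : 'rV[C]_d) (eps : R) :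
  0 < eps -> (\forall z \near z1, differentiable F z) ->
  (\forall z \near z1, (\rank (jac F z) <= \rank (jac F z1))%N) ->
  let r := \rank (jac F z1) in
  exists (S : 'rV[C]_r -> 'rV[C]_d) (P : 'M[C]_(e, r)) (dl : R), [/\ 0 < dl,
    forall x, nm x < dl -> [/\ differentiable S x, nm (S x - z1) < eps &
      (F (S x) - F z1) *m P = x] &
    \forall z \near z1, nm ((F z - F z1) *m P) < dl /\
      F (S ((F z - F z1) *m P)) = F z].
Proof.
move=> eps0 hF hrk r; set A := jac F z1 in hrk r *.
have dF1 := nbhs_singleton hF.
have [c [c' [P [cc AP rkc]]]] : exists (c : 'M[C]_(d, r)) (c' : 'M[C]_(r, d))
    (P : 'M[C]_(e, r)), [/\ c' *m c = 1%:M, A *m P = c & (\rank c = r)%N].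
  exists (col_base A), (pinvmx (col_base A)), (pinvmx (row_base A)); split.
  - by apply: mulVpmx; exact: col_base_full.
  - by rewrite -{1}(mulmx_base A) -mulmxA mulmxVp ?mulmx1 // row_base_free.
  - by apply/eqP; exact: col_base_full.
pose Q := 1%:M - c *m c'.
have Qc : Q *m c = 0 by rewrite mulmxBl mul1mx -mulmxA cc mulmx1 subrr.
pose Psi z := F z *m (P *m c') + z *m Q.
have Psic z : Psi z *m c = F z *m P.
  by rewrite mulmxDl -!mulmxA Qc cc mulmx0 addr0 mulmx1.
have dPsi z : differentiable F z -> differentiable Psi z /\
    forall v, 'D_v Psi z = 'D_v F z *m (P *m c') + v *m Q.
  move=> dF; have [d1 D1] := diff_mulmx_comp (P *m c') dF.
  have [d2 D2] := diff_mulmxr Q z.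
  split; first exact: differentiableD.
  move=> v; rewrite -D1 -D2 -deriveD //; exact: diff_derivable.
have dPc z v : differentiable F z -> 'D_v Psi z *m c = 'D_v F z *m P.
  move=> dF; rewrite (dPsi z dF).2 mulmxDl -!mulmxA Qc cc.
  by rewrite mulmx0 addr0 mulmx1.
have hPsi : \forall z \near z1, differentiable Psi z.
  by apply: filterS hF => z /dPsi[].
have dPsi1 v : 'D_v Psi z1 = v.
  rewrite (dPsi z1 dF1).2 jacE // -/A mulmxA -[_ *m A *m P]mulmxA AP -mulmxA.
  by rewrite -mulmxDr addrC subrK mulmx1.
have /nearP[e1 e10 He1] : \forall z \near z1, differentiable F z /\
    (\rank (jac F z) <= r)%N by exact: filterI.
have e20 : 0 < Num.min eps e1 by rewrite lt_min eps0.
have [Phi [r0 [r00 HPhi [r1 r10 Hinv]]]] := inverse_function e20 hPsi dPsi1.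
set y0 := Psi z1 in HPhi Hinv.
have PhiF y : nm (y - y0) < r0 -> differentiable F (Phi y) /\
    (\rank (jac F (Phi y)) <= r)%N.
  by move=> /HPhi[_]; rewrite lt_min => /andP[_ h] _; exact: He1.
have PhiE y u : nm (y - y0) < r0 -> u *m c = 'D_u Phi y *m (jac F (Phi y) *m P).
  move=> hy; have [dPhi _ _] := HPhi y hy; have [dF _] := PhiF y hy.
  have dP := (dPsi _ dF).1.
  rewrite mulmxA -(jacE _ dF) -(dPc _ _ dF) -(derive_comp u dPhi dP).
  congr (_ *m c); rewrite -[LHS](derive_id y u); apply: near_eq_derive.
  apply/nearP; exists (r0 - nm (y - y0)); first by rewrite subr_gt0.
  move=> w hw; have hw' : nm (w - y0) < r0.
    by apply: le_lt_trans (nm_tri y _ _) _; rewrite -ltrBrDr.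
  by have [_ _ /= ->] := HPhi w hw'.
(* Since c factors through DF P by the chain rule, DF P has rank at least r, which bounds the rank
   of DF from above. Thus [kernel_rank] shows that F o Phi has zero derivative in every direction
   killed by c. *)
have flat y u : nm (y - y0) < r0 -> u *m c = 0 -> 'D_u (F \o Phi) y = 0.
  move=> hy uc; have [dPhi _ _] := HPhi y hy; have [dF rk] := PhiF y hy.
  rewrite (derive_comp u dPhi dF) jacE //.
  apply: (@kernel_rank _ _ _ _ P); last by rewrite -(PhiE y u hy).
  apply: leq_trans rk _; apply: leq_trans (eq_leq (esym rkc)) _.
  have -> : c = jac Phi y *m (jac F (Phi y) *m P).
    apply/row_matrixP => i; rewrite [LHS]rowE [RHS]rowE (PhiE y _ hy).
    by rewrite (jacE _ dPhi) -mulmxA.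
  exact: mxrankM_maxr.
pose k := \sum_j nm (row j c'); have k0 : 0 <= k by apply: sumr_ge0 => j _; exact: nm_ge0.
have k1 : 0 < k + 1 by rewrite ltr_wpDl.
have [dl dl0 dlE] : exists2 dl, 0 < dl & dl * (k + 1) = r0.
  by exists (r0 / (k + 1)); [rewrite divr_gt0|rewrite divfK // gt_eqF].
have inS (x : 'rV[C]_r) : nm x < dl -> nm (y0 + x *m c' - y0) < r0.
  rewrite addrAC subrr add0r => hx; apply: le_lt_trans (nm_mulmx _ _) _.
  by rewrite -/k -dlE mulrC; have := nm_ge0 x; nra.
exists (fun x => Phi (y0 + x *m c')), P, dl; split => //.
  move=> x /inS hy; have [dPhi hz PsiPhi] := HPhi _ hy; split.
  - have dS : differentiable (fun x : 'rV[C]_r => y0 + x *m c') x.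
      apply: differentiableD; first exact: differentiable_cst.
      exact: (diff_mulmxr c' x).1.
    exact: (differentiable_comp dS dPhi).
  - by move: hz; rewrite lt_min => /andP[].
  - rewrite mulmxBl -!Psic PsiPhi -/y0 mulmxDl -mulmxA cc mulmx1.
    by rewrite addrAC subrr add0r.
pose k2 := \sum_j nm (row j Q); pose k3 := \sum_j nm (row j c).
have k20 : 0 <= k2 by apply: sumr_ge0 => j _; exact: nm_ge0.
have k30 : 0 <= k3 by apply: sumr_ge0 => j _; exact: nm_ge0.
pose s := Num.min (r0 / (k2 + 1)) (dl / (k3 + 1)) / 2.
have s0 : 0 < s by rewrite divr_gt0 // lt_min !divr_gt0 // ltr_wpDl.
have [r2 r20 cPsi] := diff_continuous_nm (nbhs_singleton hPsi) s0.
apply/nearP; exists (Num.min r1 r2); first by rewrite lt_min r10.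
move=> z; rewrite lt_min => /andP[/Hinv[hz Phiz] /cPsi]; rewrite -/y0 => hs.
have ss : nm (Psi z - y0) < Num.min (r0 / (k2 + 1)) (dl / (k3 + 1)).
  by apply: le_lt_trans hs _; rewrite /s ltr_pdivrMr // mulr_natr mulr2n ltrDl; rewrite lt_min !divr_gt0 // ltr_wpDl.
move: ss; rewrite lt_min !ltr_pdivlMr ?ltr_wpDl // => /andP[ss1 ss2].
have rhoE : (F z - F z1) *m P = (Psi z - y0) *m c.
  by rewrite !mulmxBl !Psic.
split.
  rewrite rhoE; apply: le_lt_trans (nm_mulmx _ _) _; apply: le_lt_trans ss2.
  by rewrite mulrC ler_wpM2l ?nm_ge0 // lerDl.
(* The argument of Phi in S differs from [Psi z] by u, which c kills, so F o Phi takes the same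
   value at both points. *)
pose u := (y0 - Psi z) *m Q.
have uE : y0 + (F z - F z1) *m P *m c' = Psi z + u.
  rewrite rhoE -mulmxA /u /Q; move: (Psi z) (c *m c') => w B.
  rewrite mulmxBr mulmx1 -(opprB w y0) mulNmx opprK addrA opprB.
  by rewrite (addrC w) subrK.
rewrite uE; apply/rowP => j.
have key := @const_along 'rV[C]_d (fun y => F (Phi y) 0 j) (Psi z) u.
rewrite -[RHS](congr1 (fun z => F z 0 j) Phiz); apply: key => x x1.
have hy : nm (Psi z + x *: u - y0) < r0.
  rewrite addrAC; apply: le_lt_trans (nmD _ _) _; rewrite nmZ.
  have : nm u <= k2 * nm (Psi z - y0) by rewrite nm_dist; exact: nm_mulmx.
  have h : nm x * nm u <= nm u by rewrite ler_piMl ?nm_ge0.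
  by move: (nm x * nm u) (nm u) (nm (Psi z - y0)) h ss1 => a b g *; lra.
have [dPhi _ _] := HPhi _ hy; have [dF _] := PhiF _ hy.
have dFP : differentiable (F \o Phi) (Psi z + x *: u) := differentiable_comp dPhi dF.
split; first exact: ((diff_rowP _ _).1 dFP j).
rewrite -(derive_row u j dFP) flat ?mxE //.
by rewrite /u -mulmxA Qc mulmx0.
Qed.

End ConstantRank.

(** * Multilinear and alternating forms *)

Section Multilinear.
Variable R : realType.
Local Notation C := (CC R).
Local Notation diffble f x := (differentiable (f : _ -> C^o) x).

(** The first half of [alternating_form], with the other rows compared one by one; this avoids the
    matrices of height [i.-1] produced by [row']. *)
Definition multilin (i d : nat) (w : 'M[C]_(i, d) -> C) : Prop :=
  forall (A B D : 'M[C]_(i, d)) (k : 'I_i) (a : C),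
    row k A = a *: row k B + row k D ->
    (forall j, j != k -> row j A = row j B) ->
    (forall j, j != k -> row j A = row j D) -> w A = a * w B + w D.

Lemma row_row' (i d : nat) (k : 'I_i) (A : 'M[C]_(i, d)) j :
  row j (row' k A) = row (lift k j) A.
Proof. by apply/rowP => x; rewrite !mxE. Qed.

Lemma row_row_perm (i d : nat) (s : 'S_i) (A : 'M[C]_(i, d)) j :
  row j (row_perm s A) = row (s j) A.
Proof. by apply/rowP => x; rewrite !mxE. Qed.

Lemma row'_eqP (i d : nat) (k : 'I_i) (A B : 'M[C]_(i, d)) :
  row' k A = row' k B <-> forall j, j != k -> row j A = row j B.
Proof.
split=> [AB j jk|AB].
  case: (unliftP k j) jk => [j' ->|->]; last by rewrite eqxx.
  by move=> _; rewrite -!row_row' AB.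
by apply/row_matrixP => j; rewrite !row_row' AB // eq_sym neq_lift.
Qed.

Lemma alternating_multilin (i d : nat) (w : 'M[C]_(i, d) -> C) :
  alternating_form w -> multilin w.
Proof. by move=> [h _] A B D k a h1 h2 h3; apply: (h A B D k) => //; exact/row'_eqP. Qed.

Definition upd (i d : nat) (A : 'M[C]_(i, d)) (k : 'I_i) (x : 'rV[C]_d) :=
  \matrix_(j < i) (if j == k then x else row j A).

Lemma row_upd i d (A : 'M[C]_(i, d)) k x j :
  row j (upd A k x) = if j == k then x else row j A.
Proof. exact: rowK. Qed.

Lemma upd_row i d (A : 'M[C]_(i, d)) k : upd A k (row k A) = A.
Proof. by apply/row_matrixP => j; rewrite row_upd; case: eqP => // ->. Qed.

Lemma multilin_upd i d (w : 'M[C]_(i, d) -> C) A k :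
  multilin w -> linear (fun x => w (upd A k x) : C^o).
Proof.
move=> hw a x y; apply: (hw _ _ _ k); first by rewrite !row_upd !eqxx.
  by move=> j /negbTE jk; rewrite !row_upd jk.
by move=> j /negbTE jk; rewrite !row_upd jk.
Qed.

Lemma linear_sum_row (V : lmodType C) (g : V -> C) (T : finType) (c : T -> C)
    (x : T -> V) : linear (g : V -> C^o) ->
  g (\sum_j c j *: x j) = \sum_j c j * g (x j).
Proof.
move=> lg; have g0 : g 0 = 0.
  have := lg 1 0 0; rewrite !scale1r addr0 => /eqP.
  by rewrite -subr_eq0 opprD addrA subrr add0r oppr_eq0 => /eqP.
elim/big_rec2: _ => // j a b _ <-; exact: lg.
Qed.

Section Alternating.
Variables (i d : nat) (w : 'M[C]_(i, d) -> C).
Hypothesis hw : alternating_form w.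

Lemma alt_upd_eq A k l : k != l -> w (upd A k (row l A)) = 0.
Proof.
move=> kl; apply: (hw.2 _ k l kl).
by rewrite !row_upd eqxx eq_sym (negbTE kl).
Qed.

Lemma alt_tperm A (k l : 'I_i) : k != l -> w (row_perm (tperm k l) A) = - w A.
Proof.
move=> kl; have mw := alternating_multilin hw.
pose f x y := w (upd (upd A k x) l y).
have f0 x : f x x = 0.
  by apply: (hw.2 _ k l kl); rewrite !row_upd eqxx (negbTE kl) eqxx.
have fr x y y' : f x (y + y') = f x y + f x y'.
  by have := multilin_upd (upd A k x) l mw 1 y y'; rewrite !scale1r.
have fl x x' y : f (x + x') y = f x y + f x' y.
  have C' a b : upd (upd A k a) l b = upd (upd A l b) k a.
    apply/row_matrixP => j; rewrite !row_upd.
    by case: eqP => // ->; rewrite eq_sym (negbTE kl).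
  rewrite /f !C'; have := multilin_upd (upd A l y) k mw 1 x x'.
  by rewrite !scale1r.
have -> : w A = f (row k A) (row l A).
  by rewrite /f !upd_row.
have -> : row_perm (tperm k l) A = upd (upd A k (row l A)) l (row k A).
  apply/row_matrixP => j; rewrite !row_upd.
  rewrite row_row_perm; case: tpermP => [->|->|/eqP/negbTE-> /eqP/negbTE->]; rewrite ?eqxx ?(negbTE kl) //.
apply/eqP; rewrite -addr_eq0; apply/eqP.
have := f0 (row k A + row l A).
by rewrite fr !fl !f0 add0r addr0 -/(f _ _) addrC.
Qed.

Lemma alt_perm (s : 'S_i) A : w (row_perm s A) = (-1) ^+ s * w A.
Proof.
case: (prod_tpermP s) => ts -> dts.
elim: ts dts A => [|t ts IH] /= dts A.
  by rewrite big_nil row_perm1 odd_perm1 mul1r.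
case/andP: dts => dt dts; rewrite big_cons row_permM odd_mul_tperm.
rewrite (alt_tperm _ dt) IH // dt /=; case: (odd_perm _) => /=; rewrite ?expr0 ?expr1.
  by rewrite !mulN1r opprK mul1r.
by rewrite mul1r mulN1r.
Qed.

End Alternating.

(** The rows satisfy a linear relation with a nonzero coefficient at some k. When the relation is
    substituted into row k, alternation leaves only the term with that coefficient. *)
Lemma alt_deg (i d : nat) (w : 'M[C]_(i, d) -> C) A :
  alternating_form w -> (d < i)%N -> w A = 0.
Proof.
move=> hw di; have mw := alternating_multilin hw.
have [c c0 cA] : exists2 c : 'rV[C]_i, c != 0 & c *m A = 0.
  have : kermx A != 0.
    rewrite -mxrank_eq0 mxrank_ker subn_eq0 -ltnNge.
    exact: leq_ltn_trans (rank_leq_col A) di.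
  case/rowV0Pn => c /sub_kermxP h c0; by exists c.
have [k ck] : exists k, c 0 k != 0.
  apply/existsP; rewrite -negb_forall; apply: contraNN c0 => /forallP h.
  by apply/eqP/rowP => j; rewrite mxE; exact/eqP/h.
have := linear_sum_row (c 0) (fun j => row j A) (multilin_upd A k mw).
rewrite -mulmx_sum_row cA (bigD1 k) //= upd_row big1 ?addr0.
  move=> h; apply/eqP; have : c 0 k * w A == 0.
    rewrite -h; have := multilin_upd A k mw 1 0 0; rewrite !scale1r addr0 => /eqP.
    by rewrite -subr_eq0 opprD addrA subrr add0r oppr_eq0.
  by rewrite mulf_eq0 (negbTE ck).
by move=> j jk; rewrite (alt_upd_eq hw) ?mulr0 // eq_sym.
Qed.

(* The sum over k of (-1)^k B(row k M; row' k M) is, up to a nonzero factor, the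
   antisymmetrization of B over all permutations of the rows of M. *)
Section Antisymmetrization.
Variables (i d : nat) (B : 'M[C]_(i.+1, d) -> C).

(** The permutation that sends 0 to k and is increasing on the remaining indices; its sign is
    (-1)^k. *)
Definition shuffle (k : 'I_i.+1) : 'S_i.+1 := lift_perm ord0 k 1.

Definition alt0 := forall (t : 'S_i) M,
  B (row_perm (lift_perm ord0 ord0 t) M) = (-1) ^+ t * B M.

Definition antisum M : C := \sum_(s : 'S_i.+1) (-1) ^+ s * B (row_perm s M).

Lemma fix0_lift_perm (s : 'S_i.+1) : s ord0 = ord0 ->
  exists t : 'S_i, s = lift_perm ord0 ord0 t.
Proof.
move=> s0; have H j : exists k, s (lift ord0 j) = lift ord0 k.
  case: (unliftP ord0 (s (lift ord0 j))) => [k ->|h]; first by exists k.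
  by have /eqP := perm_inj (etrans h (esym s0)).
have [f Hf] := choice H.
have fi : injective f.
  move=> a b ab; apply: (@lift_inj _ ord0); apply: (@perm_inj _ s).
  by rewrite !Hf ab.
exists (perm fi); apply/permP => j; case: (unliftP ord0 j) => [k|] ->.
  by rewrite lift_perm_lift permE Hf.
by rewrite lift_perm_id s0.
Qed.

(** Permutations are grouped by the image k of 0. Each group is a coset of the stabilizer of 0
    represented by [shuffle k], and the stabilizer acts on B by signs. The cardinal of the
    stabilizer is cancelled later as a nonzero factor. *)
Lemma antisumE M : alt0 -> antisum M =
  #|[pred s : 'S_i.+1 | s ord0 == ord0]|%:R *
  \sum_(k < i.+1) (-1) ^+ k * B (row_perm (shuffle k) M).
Proof.
move=> hB; rewrite /antisum (partition_big (fun s : 'S_i.+1 => s ord0) xpredT) //=.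
rewrite mulr_sumr; apply: eq_bigr => k _.
rewrite (reindex_inj (mulIg (shuffle k))) /=.
rewrite (eq_bigl (fun s : 'S_i.+1 => s ord0 == ord0)); last first.
  move=> s; rewrite permM -[RHS](inj_eq (@perm_inj _ (shuffle k))).
  by rewrite /shuffle lift_perm_id.
rewrite (eq_bigr (fun _ => (-1) ^+ k * B (row_perm (shuffle k) M))).
  by rewrite sumr_const mulr_natl.
move=> s /eqP /fix0_lift_perm[t ->]; rewrite row_permM hB mulrA; congr (_ * _).
rewrite odd_permM /shuffle !odd_lift_perm odd_perm1 /= addbF.
rewrite -signr_addb -addbA addbC -addbA addbb addbF signr_odd.
by [].
Qed.

Lemma antisum_perm (s : 'S_i.+1) M :
  antisum (row_perm s M) = (-1) ^+ s * antisum M.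
Proof.
rewrite /antisum mulr_sumr [RHS](reindex_inj (mulIg s)); apply: eq_bigr => t _.
rewrite row_permM odd_permM mulrA -signr_addb; congr (_ ^+ _ * _).
by rewrite addbC -addbA addbb addbF.
Qed.

Lemma shuffle_sum_eq0 M : alt0 -> antisum M = 0 ->
  \sum_(k < i.+1) (-1) ^+ k * B (row_perm (shuffle k) M) = 0.
Proof.
move=> hB; rewrite antisumE // => /eqP; rewrite mulf_eq0 pnatr_eq0.
case/orP => [/eqP/card0_eq/(_ 1%g)|/eqP //].
by rewrite inE perm1 eqxx.
Qed.

End Antisymmetrization.

Lemma antisum_sym (i d : nat) (B : 'M[C]_(i.+1, d) -> C) (k l : 'I_i.+1) M :
  k != l -> (forall M, B (row_perm (tperm k l) M) = B M) -> antisum B M = 0.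
Proof.
move=> kl hB; have : antisum B M = - antisum B M.
  rewrite {1}/antisum (reindex_inj (mulgI (tperm k l))) /= /antisum -sumrN.
  apply: eq_bigr => s _; rewrite row_permM hB odd_permM odd_tperm kl /= -mulNr.
  by case: (odd_perm s); rewrite ?expr0 ?expr1 ?opprK.
move/eqP; rewrite -addr_eq0 -mulr2n -mulr_natl mulf_eq0 pnatr_eq0 /=.
by move/eqP.
Qed.

End Multilinear.

(** * The exterior derivative in coordinates *)

Section ExteriorDerivative.
Variable R : realType.
Local Notation C := (CC R).
Local Notation diffble f x := (differentiable (f : _ -> C^o) x).

Definition dco (i d : nat) (W : 'rV[C]_d -> 'M[C]_(i, d) -> C) z
    (v : 'M[C]_(i.+1, d)) : C :=
  \sum_(k < i.+1) (-1) ^+ k * 'D_(row k v) (fun y => W y (row' k v) : C^o) z.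

(** The term of index 0 of [dco]. The other terms are its shuffles, so [dco] is a multiple of the
    antisymmetrization of [der0]. *)
Definition der0 (i d : nat) (W : 'rV[C]_d -> 'M[C]_(i, d) -> C) z
    (M : 'M[C]_(i.+1, d)) : C :=
  'D_(row ord0 M) (fun y => W y (row' ord0 M) : C^o) z.

Lemma row'_row_perm_lift (i d : nat) (k : 'I_i.+1) (t : 'S_i) (M : 'M[C]_(i.+1, d)) :
  row' ord0 (row_perm (lift_perm ord0 k t) M) = row_perm t (row' k M).
Proof.
apply/row_matrixP => j; rewrite row_row_perm.
by rewrite !(row_row' (i := i.+1)) row_row_perm lift_perm_lift.
Qed.

Lemma row'_shuffle (i d : nat) (k : 'I_i.+1) (M : 'M[C]_(i.+1, d)) :
  row' ord0 (row_perm (shuffle k) M) = row' k M.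
Proof. by rewrite row'_row_perm_lift row_perm1. Qed.

Lemma row_shuffle (i d : nat) (k : 'I_i.+1) (M : 'M[C]_(i.+1, d)) :
  row ord0 (row_perm (shuffle k) M) = row k M.
Proof. by rewrite row_row_perm lift_perm_id. Qed.

Lemma dcoE (i d : nat) (W : 'rV[C]_d -> 'M[C]_(i, d) -> C) z v :
  dco W z v = \sum_(k < i.+1) (-1) ^+ k * der0 W z (row_perm (shuffle k) v).
Proof.
by apply: eq_bigr => k _; rewrite /der0 row'_shuffle row_shuffle.
Qed.

Definition coform (i d : nat) (W : 'rV[C]_d -> 'M[C]_(i, d) -> C) z :=
  (\forall y \near z, alternating_form (W y)) /\
  forall v, affine_hol z (fun y => W y v).

Lemma coform_diff (i d : nat) (W : 'rV[C]_d -> 'M[C]_(i, d) -> C) z v :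
  coform W z -> diffble (fun y => W y v) z.
Proof. by case=> _ /(_ v) /nbhs_singleton. Qed.

Lemma derive_affine_comb (V : normedModType C) (f g h : V -> C) (a : C) z v :
  (\forall y \near z, f y = a * g y + h y) -> diffble g z -> diffble h z ->
  'D_v (f : V -> C^o) z = a * 'D_v (g : V -> C^o) z + 'D_v (h : V -> C^o) z :> C.
Proof.
move=> fgh dg dh; have dag : diffble (fun y => a *: (g y : C^o)) z.
  exact: differentiableZ.
have -> : 'D_v (f : V -> C^o) z = 'D_v ((fun y => a *: (g y : C^o)) + (h : V -> C^o)) z.
  by apply: near_eq_derive; apply: filterS fgh => y ->.
rewrite deriveD; [|exact: diff_derivable|exact: diff_derivable].
by rewrite deriveZ //; exact: diff_derivable.
Qed.

Lemma der0_alt0 (i d : nat) (W : 'rV[C]_d -> 'M[C]_(i, d) -> C) z :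
  coform W z -> alt0 (der0 W z).
Proof.
move=> hW t M; rewrite /der0 row'_row_perm_lift row_row_perm lift_perm_id.
have dW := coform_diff _ hW.
rewrite (@derive_affine_comb _ _ (fun y => W y (row' ord0 M)) (fun=> 0) ((-1) ^+ t)) //.
- by rewrite derive_cst addr0.
- by apply: filterS hW.1 => y hy; rewrite (alt_perm hy) addr0.
Qed.

Lemma dco_multilin (i d : nat) (W : 'rV[C]_d -> 'M[C]_(i, d) -> C) z :
  coform W z -> multilin (dco W z).
Proof.
move=> hW A B D k a h1 h2 h3; have dW := coform_diff _ hW.
rewrite /dco mulr_sumr -big_split /=; apply: eq_bigr => j _.
rewrite mulrCA -mulrDr; congr (_ * _).
have [->|jk] := eqVneq j k.
  have -> : row' k B = row' k A by apply/esym/row'_eqP.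
  have -> : row' k D = row' k A by apply/esym/row'_eqP.
  by rewrite h1 !deriveE // linearP.
rewrite -(h2 j jk) -(h3 j jk); apply: derive_affine_comb => //.
apply: filterS hW.1 => y /alternating_multilin hy.
case: (unliftP j k) jk h1 h2 h3 => [k' ->|->]; last by rewrite eqxx.
move=> _ h1 h2 h3; apply: (hy _ _ _ k'); first by rewrite !(row_row' (i := i.+1)).
  by move=> l lk; rewrite !(row_row' (i := i.+1)) h2 // (inj_eq (@lift_inj _ _)).
by move=> l lk; rewrite !(row_row' (i := i.+1)) h3 // (inj_eq (@lift_inj _ _)).
Qed.

(** An antisymmetrization is skew by construction; the nonzero factor in [antisumE] is cancelled. *)
Lemma dco_perm (i d : nat) (W : 'rV[C]_d -> 'M[C]_(i, d) -> C) z (s : 'S_i.+1) v :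
  coform W z -> dco W z (row_perm s v) = (-1) ^+ s * dco W z v.
Proof.
move=> /der0_alt0 h; have e1 := antisumE (row_perm s v) h.
have e2 := congr1 (fun x => (-1) ^+ s * x) (antisumE v h).
have := etrans (esym e1) (etrans (antisum_perm (der0 W z) s v) e2).
have N0 : #|[pred s : 'S_i.+1 | s ord0 == ord0]|%:R != 0 :> C.
  by rewrite pnatr_eq0; apply/eqP => /card0_eq/(_ 1%g); rewrite inE perm1 eqxx.
have cancel (N a b c : C) : N != 0 -> N * a = c * (N * b) -> a = c * b.
  by move=> hN; rewrite mulrCA => /(mulfI hN).
move=> /(cancel _ _ _ _ N0) H; apply: etrans (dcoE W z _) _.
exact: etrans H (congr1 (fun x => _ * x) (esym (dcoE W z v))).
Qed.

Lemma dco_alternating (i d : nat) (W : 'rV[C]_d -> 'M[C]_(i, d) -> C) z :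
  coform W z -> alternating_form (dco W z).
Proof.
move=> hW; split.
  by move=> A B D k a h1 /row'_eqP h2 /row'_eqP h3; apply: (dco_multilin hW (k := k)).
move=> A k l kl rkl; have := dco_perm (tperm k l) A hW.
have -> : row_perm (tperm k l) A = A.
  by apply/row_matrixP => j; rewrite row_row_perm; case: tpermP => [->|->|//].
rewrite odd_tperm kl expr1 mulN1r => /eqP.
by rewrite -addr_eq0 -mulr2n -mulr_natl mulf_eq0 pnatr_eq0 /= => /eqP.
Qed.

Lemma dco_coform (i d : nat) (W : 'rV[C]_d -> 'M[C]_(i, d) -> C) z :
  (\forall y \near z, coform W y) -> coform (dco W) z.
Proof.
move=> hW; split; first by apply: filterS hW => y; exact: dco_alternating.
move=> v; have [_ h] := nbhs_singleton hW.
have : \forall y \near z, forall k : 'I_i.+1, diffble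
    (fun y => 'D_(row k v) (fun y => W y (row' k v) : C^o) y) y.
  by apply: (filter_forall (F := nbhs z)) => k; exact: (hol_derive (row k v) (h (row' k v))).
apply: filterS => y hy.
rewrite (_ : (fun y => dco W y v) = \sum_(k < i.+1) (fun y => (-1) ^+ k *:
    ('D_(row k v) (fun y => W y (row' k v) : C^o) y))); last first.
  by apply/funext => x; rewrite fct_sumE.
by apply: differentiable_sum => k; exact: differentiableZ.
Qed.

(** The first term of d d W is a sum of second derivatives [B l], taken along the rows 0 and l + 1.
    By [derive_sym] each is invariant under the exchange of these two rows, so its
    antisymmetrization is 0. *)
Lemma ddco (i d : nat) (W : 'rV[C]_d -> 'M[C]_(i, d) -> C) z v :
  (\forall y \near z, coform W y) -> dco (dco W) z v = 0.
Proof.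
move=> hW; have hdW := dco_coform hW; have [_ h] := nbhs_singleton hW.
rewrite dcoE; apply: shuffle_sum_eq0; first exact: der0_alt0.
pose B (l : 'I_i.+1) (M : 'M[C]_(i.+2, d)) : C :=
  (-1) ^+ l * 'D_(row ord0 M) (fun y => 'D_(row (lift ord0 l) M)
     (fun y => W y (row' l (row' ord0 M)) : C^o) y) z.
have BE M : der0 (dco W) z M = \sum_(l < i.+1) B l M.
  rewrite /der0 (_ : (fun y => dco W y (row' ord0 M)) = \sum_(l < i.+1) (fun y =>
    (-1) ^+ l *: ('D_(row (lift ord0 l) M) (fun y => W y (row' l (row' ord0 M)) : C^o) y))); last first.
    by apply/funext => x; rewrite fct_sumE; apply: eq_bigr => l _; rewrite (row_row' (i := i.+2)).
  have dd l : diffble (fun y => 'D_(row (lift ord0 l) M)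
      (fun y => W y (row' l (row' ord0 M)) : C^o) y) z.
    exact: nbhs_singleton (hol_derive (row (lift ord0 l) M) (h (row' l (row' ord0 M)))).
  rewrite derive_sum; last first.
    by move=> l; apply: diff_derivable; exact: differentiableZ.
  by apply: eq_bigr => l _; rewrite deriveZ //; exact: diff_derivable.
have -> : antisum (der0 (dco W) z) v = \sum_(l < i.+1) antisum (B l) v.
  rewrite /antisum exchange_big /=; apply: eq_bigr => s _.
  by rewrite BE mulr_sumr.
apply: big1 => l _; apply: (@antisum_sym _ _ _ _ ord0 (lift ord0 l)).
  exact: neq_lift.
move=> M; set t := tperm _ _.
have r1 : row ord0 (row_perm t M) = row (lift ord0 l) M.
  by rewrite row_row_perm tpermL.
have r2 : row (lift ord0 l) (row_perm t M) = row ord0 M.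
  by rewrite row_row_perm tpermR.
have r3 : row' l (row' ord0 (row_perm t M)) = row' l (row' ord0 M).
  apply/row_matrixP => j.
  rewrite (row_row' (i := i.+1)) (row_row' (i := i.+2)).
  rewrite [RHS](row_row' (i := i.+1)) (row_row' (i := i.+2)) row_row_perm tpermD //.
  by rewrite (inj_eq (@lift_inj _ _)) neq_lift.
rewrite /B r1 r2 r3; apply: (congr1 (fun x => (-1) ^+ l * x)).
exact: (derive_sym _ _ (h _)).
Qed.

End ExteriorDerivative.

(** * Naturality of the exterior derivative *)

Section Pullback.
Variable R : realType.
Local Notation C := (CC R).
Local Notation diffble f x := (differentiable (f : _ -> C^o) x).

Definition consr (i d : nat) (x : 'rV[C]_d) (A : 'M[C]_(i, d)) : 'M[C]_(i.+1, d) :=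
  \matrix_(j < i.+1) oapp (fun j' => row j' A) x (unlift ord0 j).

Lemma row_consr0 i d x (A : 'M[C]_(i, d)) : row ord0 (consr x A) = x.
Proof. by rewrite rowK unlift_none. Qed.

Lemma row_consr i d x (A : 'M[C]_(i, d)) j :
  row (lift ord0 j) (consr x A) = row j A.
Proof. by rewrite rowK liftK. Qed.

Lemma consr_row i d (A : 'M[C]_(i.+1, d)) : consr (row ord0 A) (row' ord0 A) = A.
Proof.
apply/row_matrixP => j; case: (unliftP ord0 j) => [k|] ->.
  by rewrite row_consr (row_row' (i := i.+1)).
by rewrite row_consr0.
Qed.

Lemma upd_consr0 i d x y (A : 'M[C]_(i, d)) : upd (consr x A) ord0 y = consr y A.
Proof.
apply/row_matrixP => j; rewrite row_upd; case: (unliftP ord0 j) => [k|] ->.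
  by rewrite eq_sym (negbTE (neq_lift _ _)) !row_consr.
by rewrite eqxx row_consr0.
Qed.

Lemma upd_consr i d x y (A : 'M[C]_(i, d)) l :
  upd (consr x A) (lift ord0 l) y = consr x (upd A l y).
Proof.
apply/row_matrixP => j; rewrite row_upd; case: (unliftP ord0 j) => [k|] ->.
  by rewrite (inj_eq (@lift_inj _ _)) !row_consr row_upd.
by rewrite (negbTE (neq_lift _ _)) !row_consr0.
Qed.

Lemma multilin_consr i d (w : 'M[C]_(i.+1, d) -> C) x :
  multilin w -> multilin (fun A => w (consr x A)).
Proof.
move=> hw A B D k a h1 h2 h3; apply: (hw _ _ _ (lift ord0 k)).
- by rewrite !row_consr.
- move=> j; case: (unliftP ord0 j) => [l|] ->; rewrite ?row_consr0 // !row_consr.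
  by rewrite (inj_eq (@lift_inj _ _)) => /h2.
- move=> j; case: (unliftP ord0 j) => [l|] ->; rewrite ?row_consr0 // !row_consr.
  by rewrite (inj_eq (@lift_inj _ _)) => /h3.
Qed.

Lemma multilin_expand0 i d (w : 'M[C]_(i.+1, d) -> C) x A : multilin w ->
  w (consr x A) = \sum_(k < d) x 0 k * w (consr (delta_mx 0 k) A).
Proof.
move=> hw; have lw := multilin_upd (consr x A) ord0 hw.
have := linear_sum_row (fun k => x 0 k) (fun k => delta_mx 0 k : 'rV[C]_d) lw.
rewrite -row_sum_delta upd_consr0 => ->.
by apply: eq_bigr => k _; rewrite upd_consr0.
Qed.

(** The product rule, by induction on the degree: expanding the first row in the standard basis
    writes the form as a sum of scalar functions times forms of one degree less. *)
Lemma derive_multilin (V : normedModType C) (i e : nat)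
    (W : 'rV[C]_e -> 'M[C]_(i, e) -> C) (G : V -> 'rV[C]_e)
    (A : V -> 'M[C]_(i, e)) (z u : V) :
  (\forall y \near G z, multilin (W y)) ->
  (forall M, diffble (W ^~ M) (G z)) -> differentiable G z ->
  (forall l, differentiable (fun x => row l (A x)) z) ->
  diffble (fun x => W (G x) (A x)) z /\
  'D_u (fun x => W (G x) (A x) : C^o) z =
    'D_('D_u G z) (fun y => W y (A z) : C^o) (G z) +
    \sum_(l < i) W (G z) (upd (A z) l ('D_u (fun x => row l (A x)) z)) :> C.
Proof.
elim: i W A => [|i IH] W A hW dW dG dA.
  have -> : (fun x => W (G x) (A x)) = (fun y => W y (A z) : C^o) \o G.
    by apply/funext => x /=; congr W; apply/matrixP => -[].
  split; first exact: (differentiable_comp dG (dW _)).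
  by rewrite (derive_comp u dG (dW _)) big_ord0 addr0.
have cG : \forall x \near z, multilin (W (G x)).
  exact: (differentiable_continuous dG hW).
pose Wk k y B := W y (consr (delta_mx 0 k : 'rV[C]_e) B).
pose A' x := row' ord0 (A x).
have hk k : diffble (fun x => Wk k (G x) (A' x)) z /\
  'D_u (fun x => Wk k (G x) (A' x) : C^o) z =
    'D_('D_u G z) (fun y => Wk k y (A' z) : C^o) (G z) +
    \sum_(l < i) Wk k (G z) (upd (A' z) l ('D_u (fun x => row l (A' x)) z)) :> C.
  apply: IH => //.
  - by apply: filterS hW => y; exact: multilin_consr.
  - by move=> M; exact: dW.
  - move=> l; rewrite /A'; under eq_fun do rewrite (row_row' (i := i.+1)).
    exact: dA.
pose a k x : C := A x 0 k.
have da k : diffble (a k) z.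
  have /diff_rowP/(_ k) := dA ord0; congr (differentiable _ z).
  by apply/funext => x; rewrite mxE.
have Da k : 'D_u (a k : V -> C^o) z = ('D_u (fun x => row ord0 (A x)) z) 0 k.
  rewrite (derive_row u k (dA ord0)); apply: near_eq_derive.
  by near=> x; rewrite mxE.
have E : \forall x \near z, \sum_(k < e) a k x * Wk k (G x) (A' x) = W (G x) (A x).
  apply: filterS cG => x hx; rewrite -[in RHS](consr_row (A x)) multilin_expand0 //.
  by apply: eq_bigr => k _; rewrite /a !mxE.
have dprod k : diffble (fun x => a k x * Wk k (G x) (A' x)) z.
  exact: (@differentiableM _ _ (a k : V -> C^o) (fun x => Wk k (G x) (A' x) : C^o) z (da k) (hk k).1).
have sumE : (fun x => \sum_(k < e) a k x * Wk k (G x) (A' x)) =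
    \sum_(k < e) (fun x => a k x * Wk k (G x) (A' x) : C^o).
  by apply/funext => x; rewrite fct_sumE.
have dsum : diffble (fun x => \sum_(k < e) a k x * Wk k (G x) (A' x)) z.
  by rewrite sumE; exact: differentiable_sum.
split; first exact: near_eq_differentiable E dsum.
have -> : 'D_u (fun x => W (G x) (A x) : C^o) z =
    'D_u (fun x => \sum_(k < e) a k x * Wk k (G x) (A' x) : C^o) z.
  by apply: near_eq_derive; apply: filterS E => x ->.
rewrite sumE derive_sum; last first.
  by move=> k; exact: diff_derivable.
have Dprod k : 'D_u (fun x => a k x * Wk k (G x) (A' x) : C^o) z =
    a k z * ('D_('D_u G z) (fun y => Wk k y (A' z) : C^o) (G z) +
      \sum_(l < i) Wk k (G z) (upd (A' z) l ('D_u (fun x => row l (A' x)) z))) +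
    Wk k (G z) (A' z) * ('D_u (fun x => row ord0 (A x)) z) 0 k :> C.
  have := @deriveM _ _ (a k : V -> C^o) (fun x => Wk k (G x) (A' x) : C^o) z u
    (diff_derivable (da k)) (diff_derivable (hk k).1).
  by rewrite (hk k).2 Da.
under eq_bigr do rewrite Dprod mulrDr -addrA.
rewrite big_split /= big_split /= big_ord_recl.
have hz := nbhs_singleton hW.
congr (_ + _).
  have F : \forall y \near G z, \sum_(k < e) a k z * Wk k y (A' z) = W y (A z).
    apply: filterS hW => y hy; rewrite -[in RHS](consr_row (A z)) multilin_expand0 //.
    by apply: eq_bigr => k _; rewrite /a !mxE.
  have -> : 'D_('D_u G z) (fun y => W y (A z) : C^o) (G z) =
      'D_('D_u G z) (fun y => \sum_(k < e) a k z * Wk k y (A' z) : C^o) (G z).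
    by apply: near_eq_derive; apply: filterS F => y ->.
  have -> : (fun y => \sum_(k < e) a k z * Wk k y (A' z)) =
      \sum_(k < e) (fun y => (a k z) *: (Wk k y (A' z) : C^o)).
    by apply/funext => y; rewrite fct_sumE.
  rewrite derive_sum; last first.
    by move=> k; apply: diff_derivable; apply: differentiableZ; exact: dW.
  by apply: eq_bigr => k _; rewrite deriveZ //; apply: diff_derivable; exact: dW.
rewrite addrC; congr (_ + _).
  rewrite -{1}(consr_row (A z)) upd_consr0 multilin_expand0 //.
  by apply: eq_bigr => k _; rewrite mulrC.
under eq_bigr do rewrite mulr_sumr.
rewrite exchange_big /=; apply: eq_bigr => l _.
set X := 'D_u (fun x => row (lift ord0 l) (A x)) z.
have -> : upd (A z) (lift ord0 l) X = consr (row ord0 (A z)) (upd (A' z) l X).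
  by rewrite -upd_consr consr_row.
rewrite (multilin_expand0 _ _ hz).
have XE : 'D_u (fun x => row l (A' x)) z = X.
  by apply: near_eq_derive; near=> x; rewrite /A' (row_row' (i := i.+1)).
have aE k : (row ord0 (A z)) 0 k = a k z by rewrite mxE.
by apply: eq_bigr => k _; rewrite XE aE.
Unshelve. all: by end_near. Qed.

Definition pbmx (i d e : nat) (G : 'rV[C]_d -> 'rV[C]_e) z (v : 'M[C]_(i, d)) :
  'M[C]_(i, e) := \matrix_(k < i) 'd G z (row k v).

Lemma row_pbmx i d e (G : 'rV[C]_d -> 'rV[C]_e) z (v : 'M[C]_(i, d)) k :
  row k (pbmx G z v) = 'd G z (row k v).
Proof. exact: rowK. Qed.

(** By the product rule the first term of d (G^* W) is that of G^* (d W) plus a sum S of terms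
    containing second derivatives of G. Each of them is symmetric in the rows 0 and l + 1, so S
    disappears under antisymmetrization; S has the sign behaviour [alt0] as a difference of two
    functions that have it. *)
Lemma dco_pullback (i d e : nat) (W : 'rV[C]_e -> 'M[C]_(i, e) -> C)
    (W' : 'rV[C]_d -> 'M[C]_(i, d) -> C) (G : 'rV[C]_d -> 'rV[C]_e) z v :
  coform W (G z) -> coform W' z ->
  (\forall y \near z, differentiable G y) ->
  (\forall y \near z, forall v, W' y v = W (G y) (pbmx G y v)) ->
  dco W' z v = dco W (G z) (pbmx G z v).
Proof.
move=> hW hW' hG WW'; have dG := nbhs_singleton hG.
pose B l (M : 'M[C]_(i.+1, d)) : C := W (G z) (upd (pbmx G z (row' ord0 M)) l
  ('D_(row ord0 M) (fun y => 'D_(row (lift ord0 l) M) G y) z)).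
pose S M := \sum_(l < i) B l M.
have pbr' (M : 'M[C]_(i.+1, d)) : row' ord0 (pbmx G z M) = pbmx G z (row' ord0 M).
  apply/row_matrixP => j; rewrite row_pbmx.
  by rewrite !(row_row' (i := i.+1)) row_pbmx.
have pbp (s : 'S_i.+1) M : pbmx G z (row_perm s M) = row_perm s (pbmx G z M).
  by apply/row_matrixP => j; rewrite row_row_perm !row_pbmx row_row_perm.
have hGj w j : affine_hol z (fun y => 'D_w (fun x => G x 0 j : C^o) y).
  by apply: hol_derive; exact: (hol_rowP _ _).2.
have dDG w : differentiable (fun y => 'D_w G y) z.
  apply/diff_rowP => j; apply: near_eq_differentiable (nbhs_singleton (hGj w j)).
  by apply: filterS hG => y dy; rewrite derive_row.
have key M : der0 W' z M = der0 W (G z) (pbmx G z M) + S M.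
  have -> : der0 W' z M = 'D_(row ord0 M)
      (fun y => W (G y) (pbmx G y (row' ord0 M)) : C^o) z.
    by apply: near_eq_derive; apply: filterS WW' => y ->.
  have rowE' l : \forall y \near z, 'D_(row (lift ord0 l) M) G y =
      row l (pbmx G y (row' ord0 M)).
    by apply: filterS hG => y dy; rewrite row_pbmx (row_row' (i := i.+1)) deriveE.
  have mW : \forall y \near G z, multilin (W y).
    by apply: filterS hW.1 => y; exact: alternating_multilin.
  have dA l : differentiable (fun y => row l (pbmx G y (row' ord0 M))) z.
    exact: near_eq_differentiable (rowE' l) (dDG _).
  have [_ ->] := derive_multilin (row ord0 M) mW (fun N => coform_diff N hW) dG dA.
  have -> : der0 W (G z) (pbmx G z M) = 'D_('D_(row ord0 M) G z)
      (fun y => W y (pbmx G z (row' ord0 M)) : C^o) (G z).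
    by rewrite /der0 pbr' row_pbmx (deriveE (row ord0 M) dG).
  apply: (congr1 (fun x => _ + x)); apply: eq_bigr => l _.
  have E : 'D_(row ord0 M) (fun y => row l (pbmx G y (row' ord0 M))) z =
      'D_(row ord0 M) (fun y => 'D_(row (lift ord0 l) M) G y) z.
    by apply/esym; exact: near_eq_derive (rowE' l).
  by rewrite E.
have aS : alt0 S.
  move=> t M; have h1 := der0_alt0 hW' t M.
  have h2 := der0_alt0 hW t (pbmx G z M).
  move: h1; rewrite !key pbp h2 mulrDr => /addrI.
  by [].
suff H : antisum S v = 0.
  apply: etrans (dcoE W' z v) _; apply: etrans _ (esym (dcoE W (G z) _)).
  apply: (@etrans _ _ (\sum_(k < i.+1)
      ((-1) ^+ k * der0 W (G z) (row_perm (shuffle k) (pbmx G z v)) +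
       (-1) ^+ k * S (row_perm (shuffle k) v)))).
    by apply: eq_bigr => k _; rewrite key pbp mulrDr.
  rewrite big_split /=.
  exact: etrans (congr1 (fun x => _ + x) (shuffle_sum_eq0 aS H)) (addr0 _).
have -> : antisum S v = \sum_(l < i) antisum (B l) v.
  rewrite /antisum exchange_big /=; apply: eq_bigr => s _.
  by rewrite mulr_sumr.
apply: big1 => l _; apply: (@antisum_sym _ _ _ _ ord0 (lift ord0 l)).
  exact: neq_lift.
move=> M; set t := tperm _ _.
have r1 : row ord0 (row_perm t M) = row (lift ord0 l) M.
  by rewrite row_row_perm tpermL.
have r2 : row (lift ord0 l) (row_perm t M) = row ord0 M.
  by rewrite row_row_perm tpermR.
rewrite /B r1 r2; apply: (congr1 (W (G z))).
have E w w' k : ('D_w (fun y => 'D_w' G y) z) 0 k =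
    'D_w (fun y => 'D_w' (fun x => G x 0 k : C^o) y) z.
  rewrite (derive_row w k (dDG w')); apply: near_eq_derive.
  by apply: filterS hG => y dy; rewrite (derive_row w' k dy).
have X : 'D_(row (lift ord0 l) M) (fun y => 'D_(row ord0 M) G y) z =
    'D_(row ord0 M) (fun y => 'D_(row (lift ord0 l) M) G y) z.
  apply/rowP => k; apply: etrans (E _ _ k) (etrans _ (esym (E _ _ k))).
  by apply: derive_sym; exact: (hol_rowP _ _).2.
have Y j : j != l -> row j (pbmx G z (row' ord0 (row_perm t M))) =
    row j (pbmx G z (row' ord0 M)).
  move=> jl; rewrite !row_pbmx; apply: (congr1 ('d G z)).
  have tj : t (lift ord0 j) = lift ord0 j.
    apply: tpermD; first exact: neq_lift.
    by rewrite (inj_eq (@lift_inj _ _)) eq_sym.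
  have e1 := row_row' (i := i.+1) ord0 (row_perm t M) j.
  have e2 := row_row' (i := i.+1) ord0 M j.
  apply: etrans e1 (etrans _ (esym e2)).
  by apply: etrans (row_row_perm t M _) _; rewrite tj.
apply/row_matrixP => j; apply: etrans (row_upd _ _ _ j) _.
apply: etrans _ (esym (row_upd _ _ _ j)).
by case: eqP => [_|/eqP jl]; [exact: X|exact: Y].
Qed.

End Pullback.

(** * Open subsets of C^d as manifolds *)

Section OpenSubset.
Variable R : realType.
Local Notation C := (CC R).
Variables (d : nat) (D : set 'rV[C]_d).

Definition sub_top : topologicalType := set_type D.
Definition sub_val (x : sub_top) : 'rV[C]_d := set_val x.

Definition sub_hol (x : sub_top) (f : sub_top -> C) : Prop :=
  exists2 g : 'rV[C]_d -> C, affine_hol (sub_val x) g &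
    \forall y \near x, f y = g (sub_val y).

Lemma sub_val_cont (x : sub_top) : {for x, continuous sub_val}.
Proof. exact: initial_continuous. Qed.

Lemma sub_hol_cont x f : sub_hol x f -> {for x, continuous f}.
Proof.
move=> [g hg fg].
have gc : (g \o sub_val) @ x --> f x.
  rewrite (nbhs_singleton fg).
  exact: (cvg_comp _ _ (@sub_val_cont x) (affine_hol_cont hg)).
have h : \forall y \near x, g (sub_val y) = f y by apply: filterS fg => y ->.
rewrite /continuous_at; apply: cvg_trans gc.
exact: (@near_eq_cvg _ _ (nbhs x) _ (g \o sub_val) f h).
Qed.

Lemma sub_hol_germ x (f g : sub_top -> C) :
  (\forall y \near x, f y = g y) -> sub_hol x f -> sub_hol x g.
Proof. by move=> fg [h hh fh]; exists h => //; apply: filterS2 fg fh => y <-. Qed.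

Lemma sub_hol_near x f : sub_hol x f -> \forall y \near x, sub_hol y f.
Proof.
move=> [g hg fg].
have hg' : \forall y \near x, affine_hol (sub_val y) g.
  exact: (@sub_val_cont x) (affine_hol_near hg).
by apply: filterS2 hg' (near_join fg) => y ? ?; exists g.
Qed.

Definition sub_space : fspace R := FSpace sub_hol_cont sub_hol_germ sub_hol_near.

Lemma sub_hausdorff : hausdorff_space sub_space.
Proof.
move=> x y xy; apply: val_inj.
apply: (@norm_hausdorff _ 'rV[C]_d) => A B xA yB.
have xA' : nbhs x (sub_val @^-1` A) := @sub_val_cont x _ xA.
have yB' : nbhs y (sub_val @^-1` B) := @sub_val_cont y _ yB.
by have [z [zA zB]] := xy _ _ xA' yB'; exists (sub_val z).
Qed.

Hypothesis oD : open D.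

(** Points outside D are sent to the given point z0, because D may be empty; this is why charts of D
    are indexed by points of D. *)
Definition sub_inv (z0 : 'rV[C]_d) (Dz0 : D z0) (z : 'rV[C]_d) : sub_top :=
  if pselect (D z) is left Dz then SigSub (mem_set Dz) else SigSub (mem_set Dz0).

Lemma sub_invK z0 (Dz0 : D z0) z : D z -> sub_val (sub_inv Dz0 z) = z.
Proof. by rewrite /sub_inv; case: pselect. Qed.

Lemma sub_valP (x : sub_top) : D (sub_val x).
Proof. exact: set_valP. Qed.

Lemma sub_valK z0 (Dz0 : D z0) x : sub_inv Dz0 (sub_val x) = x.
Proof. apply: val_inj; exact: (sub_invK Dz0 (sub_valP x)). Qed.

Lemma sub_val_hol : holomorphic (Z := Cn R d) (sub_val : sub_space -> Cn R d).
Proof.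
move=> x _; split; first exact: sub_val_cont.
move=> g hg; exists g; first exact: hg.
by have F : Filter (nbhs (x : sub_top)) := nbhs_filter _; apply: filterE.
Qed.

Lemma sub_inv_hol z0 (Dz0 : D z0) :
  hol_on (X := Cn R d) (Z := sub_space) D (sub_inv Dz0).
Proof.
move=> z Dz; have nD : nbhs z D by exact: open_nbhs_nbhs.
have c : {for z, continuous (sub_inv Dz0 : 'rV[C]_d -> sub_top)}.
  move=> A; rewrite nbhsE => H; case: H => O1 [H O1z] OA; case: H => O oO O1E; subst O1.
  have nO : nbhs z O.
    by apply: open_nbhs_nbhs; split => //; rewrite -(sub_invK Dz0 Dz).
  rewrite nbhs_filterE; apply: filterS2 nD nO => y Dy Oy; apply: OA.
  rewrite /preimage /mkset; have E : set_val (sub_inv Dz0 y) = y := sub_invK Dz0 Dy.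
  by rewrite E.
split => // g [h hh gh]; rewrite sub_invK // in hh.
apply: affine_hol_germ hh.
have gh' : \forall y \near z, g (sub_inv Dz0 y) = h (sub_val (sub_inv Dz0 y)).
  exact: c gh.
by apply: filterS2 nD gh' => y Dy e; rewrite /= e sub_invK.
Qed.

Definition sub_chart (z0 : 'rV[C]_d) (Dz0 : D z0) : chart sub_space.
Proof.
apply: (@Chart R sub_space d setT D sub_val (sub_inv Dz0)).
- exact: openT.
- exact: oD.
- by move=> x _; split; [exact: sub_valP|exact: sub_valK].
- by move=> z Dz; split => //; exact: sub_invK.
- exact: sub_val_hol.
- exact: sub_inv_hol.
Defined.

Lemma sub_chart_ex (x : sub_space) : exists c : chart sub_space, cdom c x.
Proof. by exists (sub_chart (sub_valP x)). Qed.

Definition sub_mfd : manifold R := Manifold sub_hausdorff sub_chart_ex.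

End OpenSubset.

(** * Holomorphic maps between open sets of C^d *)

Section HolOn.
Variable R : realType.
Local Notation C := (CC R).

Lemma hol_on_comp (X Y Z : fspace R) (A : set X) (B : set Y) (f : X -> Y)
    (g : Y -> Z) : hol_on A f -> hol_on B g -> (forall x, A x -> B (f x)) ->
  hol_on A (g \o f).
Proof.
move=> hf hg AB x Ax; have [cf pf] := hf x Ax; have [cg pg] := hg _ (AB x Ax).
split; first exact: (continuous_comp cf cg).
by move=> h /pg /pf.
Qed.

Lemma coord_hol d (z : 'rV[C]_d) (j : 'I_d) : affine_hol z (fun y : 'rV[C]_d => y 0 j).
Proof. by apply: filterE => y; exact: differentiable_coord. Qed.

Lemma hol_on_diff d e (D : set 'rV[C]_d) (G : 'rV[C]_d -> 'rV[C]_e) :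
  open D -> hol_on (X := Cn R d) (Z := Cn R e) D G <->
  (forall z, D z -> differentiable G z).
Proof.
move=> oD; split=> [hG z Dz|dG z Dz].
  apply/diff_rowP => j; have [_ /(_ (fun y => y 0 j))] := hG z Dz.
  by move=> h; exact: (nbhs_singleton (h (coord_hol _ _))).
have nD : nbhs z D by exact: open_nbhs_nbhs.
have cG : {for z, continuous G} by exact: differentiable_continuous (dG z Dz).
split => // g hg; have hg' : \forall y \near z, differentiable (g : _ -> C^o) (G y).
  exact: cG hg.
apply: filterS2 nD hg' => y Dy dg.
exact: (differentiable_comp (dG y Dy) dg).
Qed.

End HolOn.

(** * Coordinate expressions of h-forms *)

Arguments ccod {R M} c _.
Arguments cinv {R M} c _.

Section Coordinates.
Variable R : realType.
Local Notation C := (CC R).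
Variables (X : fspace R) (i : nat).
Implicit Types (a : hfamily X i) (U : set X).

(* The value of a on the restriction of f to the open set D, read in the chart
   of D given by the identity; it is 0 outside D or if D is not open. *)
Definition co a d (D : set 'rV[C]_d) (f : 'rV[C]_d -> X) (z : 'rV[C]_d)
    (v : 'M[C]_(i, d)) : C :=
  if pselect (open D) is left oD then
    if pselect (D z) is left Dz then
      a (sub_mfd oD) (f \o @sub_val R d D) (sub_chart oD Dz) z v
    else 0
  else 0.

Lemma coE a d (D : set 'rV[C]_d) f z v (oD : open D) (Dz : D z) :
  co a D f z v = a (sub_mfd oD) (f \o @sub_val R d D) (sub_chart oD Dz) z v.
Proof.
rewrite /co; case: pselect => [oD'|//]; case: pselect => [Dz'|//].
by rewrite (Prop_irrelevance oD' oD) (Prop_irrelevance Dz' Dz).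
Qed.

Lemma sub_maps_into U d (D : set 'rV[C]_d) f (oD : open D) :
  hol_on (X := Cn R d) D f -> (forall z, D z -> U (f z)) ->
  maps_into U (f \o @sub_val R d D : sub_mfd oD -> X).
Proof.
move=> hf fU; split; last by move=> x; apply: fU; exact: sub_valP.
by apply: (hol_on_comp (@sub_val_hol R d D) hf) => x _; exact: sub_valP.
Qed.

Lemma diff_near_id d (G : 'rV[C]_d -> 'rV[C]_d) z :
  (\forall y \near z, G y = y) -> 'd G z = id :> ('rV[C]_d -> 'rV[C]_d).
Proof.
move=> Gid; apply/funext => v.
have did : differentiable (fun y : 'rV[C]_d => y) z by exact: differentiable_idfun.
have Gid' : \forall y \near z, y = G y by apply: filterS Gid.
have dG : differentiable G z := near_eq_differentiable Gid' did.
by rewrite -(deriveE v dG) -(near_eq_derive v Gid') derive_id.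
Qed.

Lemma pbmx_near_id d (G : 'rV[C]_d -> 'rV[C]_d) z (v : 'M[C]_(i, d)) :
  (\forall y \near z, G y = y) -> pbmx G z v = v.
Proof.
by move=> Gid; apply/row_matrixP => k; rewrite row_pbmx diff_near_id.
Qed.

Lemma near_open d (D : set 'rV[C]_d) z : open D -> D z -> \forall y \near z, D y.
Proof. by move=> oD Dz; exact: open_nbhs_nbhs. Qed.

Section Family.
Variables (a : hfamily X i) (U : set X).
Hypothesis ha : hform U a.

(** The map [cinv c] from the open set [ccod c] to M is the identity when read in coordinates, so
    naturality of a along it identifies the two values. Through this lemma, statements on manifolds
    reduce to open sets of C^d. *)
Lemma co_chart (M : manifold R) (f : M -> X) (c : chart M) z v :
  maps_into U f -> ccod c z -> @a M f c z v = co a (ccod c) (f \o cinv c) z v.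
Proof.
move=> hf cz; have oD := @ccod_open R M c.
rewrite (coE _ _ v oD cz).
pose g : sub_mfd oD -> M := cinv c \o @sub_val R _ (ccod c).
have hg : holomorphic g.
  apply: (hol_on_comp (@sub_val_hol R _ (ccod c)) (@cinv_hol _ _ c)) => x _.
  exact: sub_valP.
have gx : g (sub_inv cz z) = cinv c z.
  have e : sub_val (sub_inv cz z) = z := sub_invK cz cz.
  by rewrite /g /= e.
have cgx : cdom c (g (sub_inv cz z)) by rewrite gx; exact: (cinvK cz).1.
pose G (y : 'rV[C]_(cdim c)) : 'rV[C]_(cdim c) := cmap c (g (sub_inv cz y)).
have Gid : \forall y \near z, G y = y.
  apply: filterS (near_open oD cz) => y cy.
  have e : sub_val (sub_inv cz y) = y := sub_invK cz cy.
  by rewrite /G /g /= e; exact: (cinvK cy).2.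
have E : @a (sub_mfd oD) (f \o g) (sub_chart oD cz) z v =
    @a M f c (G z) (pbmx G z v) := ha.2 _ _ g f hg hf (sub_chart oD cz) c z v cz cgx.
by apply: etrans _ (esym E); rewrite (nbhs_singleton Gid) pbmx_near_id.
Qed.

(** In [co] the default point of the chart moves with z. Comparing with a chart whose default point
    is fixed is what permits differentiation in z. *)
Lemma co_indep d (D : set 'rV[C]_d) f (oD : open D) z z' (v : 'M[C]_(i, d))
    (Dz' : D z') :
  hol_on (X := Cn R d) D f -> (forall z, D z -> U (f z)) -> D z ->
  @a (sub_mfd oD) (f \o @sub_val R d D) (sub_chart oD Dz') z v = co a D f z v.
Proof.
move=> hf fU Dz.
have hM := sub_maps_into oD hf fU.
have [_ _ H] := ha.1 _ _ hM.
rewrite (coE _ _ v oD Dz).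
pose G (y : 'rV[C]_d) : 'rV[C]_d := sub_val (sub_inv Dz' y).
have Gid : \forall y \near z, G y = y.
  by apply: filterS (near_open oD Dz) => y Dy; exact: (sub_invK Dz' Dy).
have E : @a (sub_mfd oD) (f \o @sub_val R d D) (sub_chart oD Dz') z v =
    @a (sub_mfd oD) (f \o @sub_val R d D) (sub_chart oD Dz) (G z) (pbmx G z v) :=
  H (sub_chart oD Dz') (sub_chart oD Dz) z v Dz I.
by apply: etrans E _; rewrite (nbhs_singleton Gid) pbmx_near_id.
Qed.

Lemma co_form d (D : set 'rV[C]_d) f z : open D ->
  hol_on (X := Cn R d) D f -> (forall z, D z -> U (f z)) -> D z ->
  coform (co a D f) z.
Proof.
move=> oD hf fU Dz; have hM := sub_maps_into oD hf fU.
have [h1 h2 _] := ha.1 _ _ hM.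
split.
  apply: filterS (near_open oD Dz) => y Dy.
  rewrite (_ : co a D f y = @a (sub_mfd oD) (f \o @sub_val R d D) (sub_chart oD Dy) y).
    exact: (h1 (sub_chart oD Dy) y Dy).
  by apply/funext => v; rewrite (coE _ _ v oD Dy).
move=> v; apply: affine_hol_germ (h2 (sub_chart oD Dz) z v Dz).
by apply: filterS (near_open oD Dz) => y Dy; exact: co_indep.
Qed.

(** The map f' is compared with f o G on D' only: maps are total functions, with arbitrary values
    outside the open set under consideration. *)
Lemma co_pull d e (D : set 'rV[C]_d) (D' : set 'rV[C]_e) f f' G z (v : 'M[C]_(i, e)) :
  open D -> open D' -> hol_on (X := Cn R d) D f -> (forall z, D z -> U (f z)) ->
  (forall z, D' z -> differentiable G z) -> (forall z, D' z -> D (G z)) ->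
  (forall z, D' z -> f' z = f (G z)) -> D' z ->
  co a D' f' z v = co a D f (G z) (pbmx G z v).
Proof.
move=> oD oD' hf fU dG GD ff' Dz; have DGz := GD z Dz.
have hM := sub_maps_into oD hf fU.
pose g : sub_mfd oD' -> sub_mfd oD := sub_inv DGz \o (G \o @sub_val R e D').
have hG : hol_on (X := Cn R e) (Z := Cn R d) D' G by exact/hol_on_diff.
have hG' : hol_on (X := sub_mfd oD') (Z := Cn R d) setT (G \o @sub_val R e D').
  by apply: (hol_on_comp (@sub_val_hol R e D') hG) => x _; exact: sub_valP.
have hg : holomorphic g.
  apply: (hol_on_comp hG' (sub_inv_hol oD DGz)) => x _; apply: GD; exact: sub_valP.
have fg : f' \o @sub_val R e D' = (f \o @sub_val R d D) \o g.
  apply/funext => x /=; rewrite ff'; last exact: sub_valP.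
  have e1 : sub_val (sub_inv DGz (G (sub_val x))) = G (sub_val x).
    by apply: sub_invK; apply: GD; exact: sub_valP.
  by rewrite e1.
rewrite (coE _ _ v oD' Dz) (coE _ _ _ oD DGz) fg.
pose H (y : 'rV[C]_e) : 'rV[C]_d := sub_val (g (sub_inv Dz y)).
have HG : \forall y \near z, G y = H y.
  apply: filterS (near_open oD' Dz) => y Dy; rewrite /H /g /=.
  have e1 : sub_val (sub_inv Dz y) = y := sub_invK Dz Dy.
  by rewrite e1; apply/esym; apply: sub_invK; exact: GD.
have Hz := nbhs_singleton HG.
have pH : pbmx H z v = pbmx G z v.
  apply/row_matrixP => k; have dGz := dG z Dz.
  have dHz := near_eq_differentiable HG dGz.
  have dE := near_eq_derive (row k v) HG.
  apply: etrans (row_pbmx H z v k) (etrans _ (esym (row_pbmx G z v k))).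
  exact: etrans (esym (deriveE _ dHz)) (etrans (esym dE) (deriveE _ dGz)).
have E : @a (sub_mfd oD') ((f \o @sub_val R d D) \o g) (sub_chart oD' Dz) z v =
    @a (sub_mfd oD) (f \o @sub_val R d D) (sub_chart oD DGz) (H z) (pbmx H z v) :=
  ha.2 _ _ g _ hg hM (sub_chart oD' Dz) (sub_chart oD DGz) z v Dz I.
by apply: etrans E _; rewrite pH -Hz.
Qed.

End Family.

End Coordinates.

Lemma co_hd (R : realType) (X : fspace R) i (a : hfamily X i) U d
    (D : set 'rV[CC R]_d) f z v : hform U a -> open D ->
  hol_on (X := Cn R d) D f -> (forall z, D z -> U (f z)) -> D z ->
  co (hd a) D f z v = dco (co a D f) z v.
Proof.
move=> ha oD hf fU Dz; rewrite (coE _ _ v oD Dz) /hd /dform /dco.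
apply: eq_bigr => k _; apply: (congr1 (fun x => (-1) ^+ k * x)).
have H : \forall y \near z, a (sub_mfd oD) (f \o @sub_val R d D) (sub_chart oD Dz)
    y (row' k v) = co a D f y (row' k v).
  by apply: filterS (near_open oD Dz) => y Dy; exact: (co_indep ha).
exact: near_eq_derive H.
Qed.

(** * Forms of degree larger than the dimension *)

Section Vanishing.
Variable R : realType.
Local Notation C := (CC R).

Lemma open_nmball (V : normedModType C) (z : V) (r : R) :
  open [set y | nm (y - z) < r].
Proof.
rewrite openE => y /= hy; apply/nearP; exists (r - nm (y - z)).
  by rewrite subr_gt0.
by move=> w hw; apply: le_lt_trans (nm_tri y _ _) _; rewrite -ltrBrDr.
Qed.

Variable X : fspace R.

(* b d D f is the q-form attached to the holomorphic map f : D -> U. *)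
Definition natural_family (q : nat) (U : set X)
    (b : forall d, set 'rV[C]_d -> ('rV[C]_d -> X) -> 'rV[C]_d -> 'M[C]_(q, d) -> C) :=
  [/\ forall d (D : set 'rV[C]_d) f z, open D -> hol_on (X := Cn R d) D f ->
        (forall y, D y -> U (f y)) -> D z -> alternating_form (b d D f z),
      forall d (D : set 'rV[C]_d) f z v, open D -> hol_on (X := Cn R d) D f ->
        (forall y, D y -> U (f y)) -> D z -> {for z, continuous (fun y => b d D f y v)} &
      forall d e (D : set 'rV[C]_d) (D' : set 'rV[C]_e) f f' G z v,
        open D -> open D' -> hol_on (X := Cn R d) D f ->
        (forall y, D y -> U (f y)) ->
        (forall y, D' y -> differentiable G y) -> (forall y, D' y -> D (G y)) ->
        (forall y, D' y -> f' y = f (G y)) -> D' z ->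
        b e D' f' z v = b d D f (G z) (pbmx G z v)].

Lemma co_natural q U (a : hfamily X q) : hform U a ->
  natural_family U (fun d => @co R X q a d).
Proof.
move=> ha; split.
- move=> d D f z oD hf fU Dz.
  by have [h _] := co_form ha oD hf fU Dz; exact: nbhs_singleton h.
- move=> d D f z v oD hf fU Dz.
  by have [_ h] := co_form ha oD hf fU Dz; exact: affine_hol_cont (h v).
- move=> d e D D' f f' G z v oD oD' hf fU dG GD ff' Dz.
  exact: (co_pull ha _ oD oD' hf fU dG GD ff' Dz).
Qed.

(** In coordinates the compatibility of d a with pullbacks is [dco_pullback]. The vanishing result
    thereby applies to d a, which settles the top degree. *)
Lemma co_hd_natural q U (a : hfamily X q) : hform U a ->
  natural_family U (fun d => @co R X q.+1 (hd a) d).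
Proof.
move=> ha.
have E d (D : set 'rV[C]_d) f z : open D -> hol_on (X := Cn R d) D f ->
    (forall y, D y -> U (f y)) -> D z -> co (hd a) D f z = dco (co a D f) z.
  by move=> oD hf fU Dz; apply/funext => v; exact: (co_hd v ha oD hf fU Dz).
have cf d (D : set 'rV[C]_d) f z : open D -> hol_on (X := Cn R d) D f ->
    (forall y, D y -> U (f y)) -> D z -> \forall y \near z, coform (co a D f) y.
  move=> oD hf fU Dz; apply: filterS (near_open oD Dz) => y Dy; exact: (co_form ha oD hf fU Dy).
split.
- move=> d D f z oD hf fU Dz; rewrite E //.
  exact: dco_alternating (co_form ha oD hf fU Dz).
- move=> d D f z v oD hf fU Dz.
  have [_ h] := dco_coform (cf d D f z oD hf fU Dz).
  apply: affine_hol_cont; apply: affine_hol_germ (h v).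
  by apply: filterS (near_open oD Dz) => y Dy; rewrite E.
- move=> d e D D' f f' G z v oD oD' hf fU dG GD ff' Dz.
  have hG : hol_on (X := Cn R e) (Z := Cn R d) D' G by exact/hol_on_diff.
  have hfG : hol_on (X := Cn R e) D' (f \o G) := hol_on_comp hG hf GD.
  have fGU y : D' y -> U ((f \o G) y) by move=> Dy; exact/fU/GD.
  have Ef : co (hd a) D' f' z v = co (hd a) D' (f \o G) z v.
    rewrite (coE _ _ v oD' Dz) (coE _ _ v oD' Dz).
    rewrite (_ : f' \o @sub_val R e D' = (f \o G) \o @sub_val R e D') //.
    by apply/funext => x; apply: ff'; exact: sub_valP.
  rewrite Ef (co_hd v ha oD' hfG fGU Dz) (co_hd _ ha oD hf fU (GD z Dz)).
  apply: dco_pullback.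
  + exact: (co_form ha oD hf fU (GD z Dz)).
  + exact: (co_form ha oD' hfG fGU Dz).
  + by apply: filterS (near_open oD' Dz).
  + apply: filterS (near_open oD' Dz) => y Dy w.
    exact: (co_pull ha _ oD oD' hf fU dG GD (fun _ _ => erefl) Dy).
Qed.

Lemma max_rank d e (D : set 'rV[C]_d) (F : 'rV[C]_d -> 'rV[C]_e) z0 : D z0 ->
  exists2 z1, D z1 & forall z, D z -> (\rank (jac F z) <= \rank (jac F z1))%N.
Proof.
move=> Dz0; pose P k := `[< exists2 z, D z & \rank (jac F z) = k >].
have exP : exists k, P k by exists (\rank (jac F z0)); apply/asboolP; exists z0.
have bP k : P k -> (k <= d)%N by move=> /asboolP[z _ <-]; exact: rank_leq_row.
case: (ex_maxnP exP bP) => k /asboolP[z1 Dz1 <-] H.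
exists z1; first exact: Dz1.
move=> z Dz; apply: H; apply/asboolP; exists z; [exact: Dz|exact: erefl].
Qed.

(* Near a point z1 of maximal rank r, f factors through a map s from an open
   subset of C^r; s parametrizes a submanifold of Y, so r <= m < q and the q-form
   attached to s vanishes. *)
Lemma natural_family_eq0 (q m : nat) (U Y : set X) b d (D : set 'rV[C]_d) f z0 v :
  reduced_complex_space X ->
  (forall r, contains_submanifold Y r -> (r <= m)%N) -> (m < q)%N ->
  natural_family (q := q) U b -> open D -> hol_on (X := Cn R d) D f ->
  (forall y, D y -> U (f y) /\ Y (f y)) -> D z0 -> b d D f z0 v = 0.
Proof.
move=> [_ hX] hm mq [b_alt b_cont b_pull] oD hf fUY Dz0.
have fU y (Dy : D y) := (fUY y Dy).1; have fY y (Dy : D y) := (fUY y Dy).2.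
apply/eqP/negP => /negP bz0.
have [Ue [N [De [A [e [s [Uez0 [[oUe _] _ es _ [he _]]]]]]]]] := hX (f z0).
(* By continuity the form is nonzero on a whole ball around z0, so a contradiction may be sought at
   a point z1 of maximal rank in that ball. *)
have nb : \forall y \near z0, b d D f y v != 0.
  have /cvgrPdist_lt/(_ `|b d D f z0 v|) h := b_cont d D f z0 v oD hf fU Dz0.
  have b0 : 0 < `|b d D f z0 v| by rewrite normr_gt0.
  apply: filterS (h b0) => y; apply: contraTneq => ->.
  by rewrite subr0 ltxx.
have nU : \forall y \near z0, Ue (f y).
  by apply: (hf z0 Dz0).1; exact: open_nbhs_nbhs.
have /nearP[p p0 Hp] : \forall y \near z0, [/\ D y, Ue (f y) & b d D f y v != 0].
  by apply: filterS3 (near_open oD Dz0) nU nb => y.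
pose D1 := [set y : 'rV[C]_d | nm (y - z0) < p].
have oD1 : open D1 by exact: open_nmball.
have D1D y : D1 y -> D y by move=> /Hp[].
have D1U y : D1 y -> Ue (f y) by move=> /Hp[].
pose F : 'rV[C]_d -> 'rV[C]_N := e \o f.
have hf1 : hol_on (X := Cn R d) D1 f by move=> y /D1D; exact: hf.
have dF y : D1 y -> differentiable F y.
  apply: (hol_on_diff _ oD1).1; exact: (hol_on_comp hf1 he D1U).
have D1z0 : D1 z0 by rewrite /D1 /= subrr nm0.
have [z1 D1z1 rk] := max_rank F D1z0.
have nD1 : \forall y \near z1, D1 y by exact: near_open.
have /nearP[e1 e10 He1] := nD1.
have nF : \forall y \near z1, differentiable F y by apply: filterS nD1 => y; exact: dF.
have nrk : \forall y \near z1, (\rank (jac F y) <= \rank (jac F z1))%N.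
  by apply: filterS nD1 => y; exact: rk.
have [r [S [P [dl [dl0 HS Hn]]]]] : exists r (S : 'rV[C]_r -> 'rV[C]_d)
    (P : 'M[C]_(N, r)) (dl : R), [/\ 0 < dl,
      forall x, nm x < dl -> [/\ differentiable S x, nm (S x - z1) < e1 &
        (F (S x) - F z1) *m P = x] &
      \forall z \near z1, nm ((F z - F z1) *m P) < dl /\
        F (S ((F z - F z1) *m P)) = F z] :=
  ex_intro _ _ (constant_rank e10 nF nrk).
pose W := [set x : 'rV[C]_r | nm (x - 0) < dl].
have oW : open W by exact: open_nmball.
have Wn x : W x -> nm x < dl by rewrite /W /= subr0.
have WS x : W x -> D1 (S x) by move=> /Wn/HS[_ h _]; exact: He1.
have hS : hol_on (X := Cn R r) (Z := Cn R d) W S.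
  by apply/hol_on_diff => // x /Wn/HS[].
have hfS : hol_on (X := Cn R r) W (f \o S) := hol_on_comp hS hf1 WS.
(* The holomorphic retraction onto the submanifold is x |-> (e x - F z1) P, which inverts f o S by
   the last property of S. *)
have rm : (r <= m)%N.
  apply: hm; exists W, Ue, (f \o S), (fun x => (e x - F z1) *m P); split.
  - by split; [exact: oW|exists 0; rewrite /W /= subrr nm0].
  - exact: oUe.
  - exact: hfS.
  - have hr : hol_on (X := Cn R N) (Z := Cn R r) setT (fun y => (y - F z1) *m P).
      apply/hol_on_diff; first exact: openT.
      move=> y _; apply: (diff_mulmx_comp P _).1.
      apply: differentiableB; first exact: differentiable_idfun.
      exact: differentiable_cst.
    by apply: (hol_on_comp he hr) => x _.
  - move=> x Wx; split; [exact: D1U (WS x Wx)|exact: fY (D1D _ (WS x Wx))|].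
    by have [_ _] := HS x (Wn x Wx).
have /nearP[e2 e20 He2] : \forall z \near z1, D1 z /\
    W ((F z - F z1) *m P) /\ F (S ((F z - F z1) *m P)) = F z.
  apply: filterS2 nD1 Hn => z Dz [h1 h2]; split => //; split => //.
  by rewrite /W /= subr0.
pose D2 := [set y : 'rV[C]_d | nm (y - z1) < e2].
have oD2 : open D2 by exact: open_nmball.
have D2z1 : D2 z1 by rewrite /D2 /= subrr nm0.
pose G z := (F z - F z1) *m P.
have dG y : D2 y -> differentiable G y.
  move=> /He2[Dy _]; apply: (diff_mulmx_comp P _).1.
  by apply: differentiableB; [exact: dF|exact: differentiable_cst].
have GW y : D2 y -> W (G y) by move=> /He2[_ []].
have fG y : D2 y -> f y = (f \o S) (G y).
  move=> D2y; have [Dy [Wy Fy]] := He2 y D2y.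
  have := congr1 s Fy; rewrite /F /= (es _ (D1U _ Dy)).2 => <-.
  by rewrite (es _ (D1U _ (WS _ Wy))).2.
have fSU x : W x -> U ((f \o S) x) by move=> /WS/D1D; exact: fU.
have D2D y : D2 y -> D y by move=> /He2[/D1D].
have did (y : 'rV[C]_d) : D2 y -> differentiable (fun y : 'rV[C]_d => y) y.
  by move=> _; exact: differentiable_idfun.
have E1 : b d D2 f z1 v = b d D f z1 (pbmx (fun y => y) z1 v) :=
  b_pull d d D D2 f f (fun y => y) z1 v oD oD2 hf fU did D2D (fun _ _ => erefl) D2z1.
have E2 : b d D2 f z1 v = b r W (f \o S) (G z1) (pbmx G z1 v) :=
  b_pull r d W D2 (f \o S) f G z1 v oW oD2 hfS fSU dG GW fG D2z1.
have E3 : pbmx (fun y : 'rV[C]_d => y) z1 v = v by apply: pbmx_near_id; exact: filterE.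
have E4 : b r W (f \o S) (G z1) (pbmx G z1 v) = 0.
  apply: alt_deg; last exact: leq_ltn_trans rm mq.
  exact: b_alt oW hfS fSU (GW z1 D2z1).
have [_ _ /negP] := Hp z1 D1z1; apply; apply/eqP; apply: etrans (etrans E2 E4).
exact: etrans (esym (congr1 _ E3)) (esym E1).
Qed.

End Vanishing.

(** * The homotopy operator *)

Section Embedding.
Variable R : realType.
Local Notation C := (CC R).
Variable d : nat.

(** In C x C^d, with t as first coordinate, [je] is the vector d/dt, [jm] the inclusion of C^d, [pm]
    the projection to C^d and [tc] the coordinate t. *)
Definition je : 'rV[C]_(1 + d) := row_mx 1%:M 0.
Definition jm : 'M[C]_(d, 1 + d) := row_mx 0 1%:M.
Definition pm : 'M[C]_(1 + d, d) := col_mx 0 1%:M.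
Definition tc (y : 'rV[C]_(1 + d)) : C := lsubmx y 0 0.

(* The point (t, z) of C x C^d. *)
Definition em (t : C) (z : 'rV[C]_d) : 'rV[C]_(1 + d) := t *: je + z *m jm.

Lemma jm_pm : jm *m pm = 1%:M.
Proof. by rewrite /jm /pm mul_row_col mul0mx mulmx1 add0r. Qed.

Lemma je_pm : je *m pm = 0.
Proof. by rewrite /je /pm mul_row_col mulmx0 mul0mx addr0. Qed.

Lemma em_pm t z : em t z *m pm = z.
Proof. by rewrite /em mulmxDl -scalemxAl je_pm scaler0 add0r -mulmxA jm_pm mulmx1. Qed.

Lemma emE t z : em t z = row_mx t%:M z.
Proof.
rewrite /em /je /jm mul_mx_row mulmx0 mulmx1 scale_row_mx scaler0 add_row_mx addr0 add0r.
by rewrite scalemx1.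
Qed.

Lemma tc_em t z : tc (em t z) = t.
Proof. by rewrite /tc emE row_mxKl mxE eqxx. Qed.

Lemma diff_em_l (z : 'rV[C]_d) (t : C^o) :
  differentiable (fun t : C^o => em t z) t /\ 'D_1 (fun t : C^o => em t z) t = je.
Proof.
have -> : (fun t : C^o => em t z) = fun t : C^o => z *m jm + t *: je.
  by apply/funext => s; rewrite /em addrC.
split; last exact: derive_line.
apply: differentiableD; first exact: differentiable_cst.
by apply: differentiableZl; exact: differentiable_idfun.
Qed.

Lemma diff_em_r t (z : 'rV[C]_d) :
  differentiable (em t) z /\ forall u, 'D_u (em t) z = u *m jm.
Proof.
have [h1 h2] := diff_mulmxr jm z.
have dc : differentiable (cst (t *: je) : 'rV[C]_d -> _) z by exact: differentiable_cst.
split; first exact: (differentiableD dc h1).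
move=> u; rewrite -(h2 u).
have -> : em t = cst (t *: je) + (fun x => x *m jm) by [].
rewrite deriveD; [|exact: diff_derivable|exact: diff_derivable].
by rewrite derive_cst add0r.
Qed.

Lemma tc_diff y : differentiable (tc : 'rV[C]_(1 + d) -> C^o) y.
Proof.
have -> : tc = (fun y : 'rV[C]_(1 + d) => y 0 (lshift d ord0)).
  by apply/funext => x; rewrite /tc mxE.
exact: differentiable_coord.
Qed.

End Embedding.

(** * Holomorphic maps into a product *)

Section HolPair.
Variable R : realType.
Local Notation C := (CC R).

Lemma diffble_hol d (D : set 'rV[C]_d) (f : 'rV[C]_d -> C) :
  open D -> (forall z, D z -> differentiable (f : _ -> C^o) z) ->
  hol_on (X := Cn R d) (Z := Cline R) D f.
Proof.
move=> oD df z Dz; have cf : {for z, continuous f} by exact: differentiable_continuous (df z Dz).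
split => // g hg; have hg' : \forall y \near z, differentiable (g : C^o -> C^o) (f y).
  exact: cf hg.
apply: filterS2 (near_open oD Dz) hg' => y Dy dg.
exact: (differentiable_comp (df y Dy) dg).
Qed.

Lemma hol_on_pair (X Z : fspace R) d (D : set 'rV[C]_d) (f : 'rV[C]_d -> X)
    (g : 'rV[C]_d -> Z) : hol_on (X := Cn R d) D f -> hol_on (X := Cn R d) D g ->
  hol_on (X := Cn R d) (Z := prod_space X Z) D (fun y => (f y, g y)).
Proof.
move=> hf hg z Dz; have [cf pf] := hf z Dz; have [cg pg] := hg z Dz.
have c : {for z, continuous (fun y => (f y, g y))}.
  move=> A [[P Q] [/= fP gQ] PQ].
  have nP : \forall y \near z, P (f y) := cf _ fP.
  have nQ : \forall y \near z, Q (g y) := cg _ gQ.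
  by rewrite /= nbhs_filterE; apply: filterS2 nP nQ => y Py Qy; exact: (PQ (f y, g y)).
split; first exact: c.
move=> F [k [l [a [b [G [ha hb hG FE]]]]]].
have da : \forall y \near z, differentiable (a \o f) y.
  by apply/hol_rowP => j; exact: pf (ha j).
have db : \forall y \near z, differentiable (b \o g) y.
  by apply/hol_rowP => j; exact: pg (hb j).
have ca : {for z, continuous (a \o f)} by exact: differentiable_continuous (nbhs_singleton da).
have cb : {for z, continuous (b \o g)} by exact: differentiable_continuous (nbhs_singleton db).
have cab : {for z, continuous (fun y => (a (f y), b (g y)))}.
  move=> A [[P Q] [/= fP gQ] PQ].
  have nP : \forall y \near z, P (a (f y)) := ca _ fP.
  have nQ : \forall y \near z, Q (b (g y)) := cb _ gQ.
  by rewrite /= nbhs_filterE; apply: filterS2 nP nQ => y Py Qy; exact: (PQ (a (f y), b (g y))).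
have dG : \forall y \near z, differentiable (G : _ -> C^o) (a (f y), b (g y)).
  exact: cab hG.
have FE' : \forall y \near z, G (a (f y), b (g y)) = F (f y, g y).
  have : \forall y \near z, F (f y, g y) = G (a (f y), b (g y)) by exact: c FE.
  by apply: filterS => y ->.
apply: affine_hol_germ FE' _.
apply: filterS3 da db dG => y day dby dGy.
have dab : differentiable (fun y => (a (f y), b (g y))) y by exact: differentiable_pair.
exact: (differentiable_comp dab dGy).
Qed.

End HolPair.

Lemma contD_eq (R : realType) (D : CC R -> Prop) (f g : CC R -> CC R) :
  (forall t, D t -> f t = g t) -> contD D f -> contD D g.
Proof.
move=> fg cf t Dt e e0; have [r r0 Hr] := cf t Dt e e0.
by exists r => // w Dw hw; rewrite -!fg //; exact: Hr.
Qed.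

Lemma intg_sum (R : realType) (D : CC R -> Prop) n (c : 'I_n -> CC R)
    (g : 'I_n -> CC R -> CC R) t1 t2 : midclosed D -> seqclosed D -> D t1 -> D t2 ->
  (forall k z, D z -> differentiable (g k : _ -> (CC R)^o) z) ->
  intg (fun t => \sum_k c k * g k t) t1 t2 = \sum_k c k * intg (g k) t1 t2.
Proof.
move=> mD sD D1 D2; elim: n c g => [|n IH] c g dg.
  have E0 : intg (fun t => 0 + 0 * t) t1 t2 = 0 :> CC R.
    by rewrite intg_affine !mul0r addr0.
  rewrite big_ord0 -[RHS]E0; apply: (intg_ext mD _ D1 D2) => t Dt.
  by rewrite big_ord0 mul0r addr0.
have dg' k z : D z -> differentiable (g (lift ord0 k) : _ -> (CC R)^o) z by exact: dg.
rewrite big_ord_recl -(IH (fun k => c (lift ord0 k)) (fun k => g (lift ord0 k)) dg').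
have c0 : contD D (g ord0) by apply: diff_contD; exact: dg.
have c1 : contD D (fun t => \sum_k c (lift ord0 k) * g (lift ord0 k) t).
  apply: diff_contD => z Dz.
  rewrite (_ : (fun t => _) = \sum_k (fun t => c (lift ord0 k) *: (g (lift ord0 k) t : (CC R)^o))).
    apply: differentiable_sum => k; apply: differentiableZ; exact: dg'.
  by apply/funext => t; rewrite fct_sumE.
apply: etrans (intg_lin (c ord0) mD sD c0 c1 D1 D2).
apply: (intg_ext mD _ D1 D2) => t Dt; exact: big_ord_recl.
Qed.

(** * The operator in coordinates and on h-forms *)

Section Operator.
Variable R : realType.
Local Notation C := (CC R).
Local Notation diffble f x := (differentiable (f : _ -> C^o) x).
Variables (X : fspace R) (i : nat) (a : hfamily X i.+1) (W : set X).
Hypothesis ha : hform W a.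
Variables (phi : X * C -> X) (S : set X) (B : set C).
Hypothesis oB : open (B : set C^o).
Hypothesis hphi : hol_on (X := prod_space X (Cline R)) (S `*` B) phi.
Hypothesis phiW : forall x t, S x -> B t -> W (phi (x, t)).
Variables (Dc : C -> Prop) (t1 t2 : C).
Hypotheses (DcB : forall t, Dc t -> B t) (mDc : midclosed Dc) (sDc : seqclosed Dc).
Hypotheses (Dt1 : Dc t1) (Dt2 : Dc t2).

Definition cyl d (D : set 'rV[C]_d) : set 'rV[C]_(1 + d) :=
  [set y | D (y *m pm R d) /\ B (tc y)].

Definition cylmap d (h : 'rV[C]_d -> X) (y : 'rV[C]_(1 + d)) : X :=
  phi (h (y *m pm R d), tc y).

(* Integration over the path from t1 to t2 of the contraction with d/dt of the
   pullback of a along (t, z) |-> phi (h z, t). *)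
Definition htpy d (D : set 'rV[C]_d) (h : 'rV[C]_d -> X) z (v : 'M[C]_(i, d)) : C :=
  intg (fun t => co a (cyl D) (cylmap h) (em t z) (consr (je R d) (v *m jm R d))) t1 t2.

Section Chart.
Variables (d : nat) (D : set 'rV[C]_d) (h : 'rV[C]_d -> X).
Hypotheses (oD : open D) (hh : hol_on (X := Cn R d) D h) (hS : forall z, D z -> S (h z)).

Lemma diff_pm (y : 'rV[C]_(1 + d)) :
  differentiable (fun y : 'rV[C]_(1 + d) => y *m pm R d) y.
Proof. exact: (diff_mulmxr _ _).1. Qed.

Lemma cyl_em z t : D z -> B t -> cyl D (em t z).
Proof. by rewrite /cyl /= em_pm tc_em. Qed.

Lemma cyl_open : open (cyl D).
Proof.
rewrite openE => y [Dy By].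
have c1 : {for y, continuous (fun y : 'rV[C]_(1 + d) => y *m pm R d)}.
  exact: differentiable_continuous (diff_pm y).
have c2 : {for y, continuous (@tc R d : _ -> C^o)} by exact: differentiable_continuous (tc_diff y).
have n1 : \forall x \near y, D (x *m pm R d) := c1 _ (near_open oD Dy).
have n2 : \forall x \near y, B (tc x) := c2 _ (open_nbhs_nbhs (conj oB By)).
by apply: filterS2 n1 n2 => x.
Qed.

Lemma cylmap_hol : hol_on (X := Cn R (1 + d)) (cyl D) (cylmap h).
Proof.
have h1 : hol_on (X := Cn R (1 + d)) (cyl D) (fun y : 'rV[C]_(1 + d) => h (y *m pm R d)).
  have h0 : hol_on (X := Cn R (1 + d)) (Z := Cn R d) (cyl D) (fun y : 'rV[C]_(1 + d) => y *m pm R d).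
    by apply/hol_on_diff => [|y _]; [exact: cyl_open|exact: diff_pm].
  by apply: (hol_on_comp h0 hh) => y [].
have h2 : hol_on (X := Cn R (1 + d)) (Z := Cline R) (cyl D) (@tc R d).
  by apply: (diffble_hol cyl_open) => y _; exact: tc_diff.
apply: (hol_on_comp (hol_on_pair h1 h2) hphi) => y [Dy By].
by split => //=; exact: hS.
Qed.

Lemma cylmap_W y : cyl D y -> W (cylmap h y).
Proof. by move=> [Dy By]; apply: phiW => //; exact: hS. Qed.

Lemma cyl_form y : cyl D y -> coform (co a (cyl D) (cylmap h)) y.
Proof. exact: (co_form ha cyl_open cylmap_hol cylmap_W). Qed.

Lemma diffble_em_l (F : 'rV[C]_(1 + d) -> C) (t : C) (z : 'rV[C]_d) :
  diffble F (em t z) ->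
  differentiable ((fun t : C => F (em t z)) : C^o -> C^o) t /\
  'D_1 ((fun t : C => F (em t z)) : C^o -> C^o) t = 'D_(je R d) (F : _ -> C^o) (em t z).
Proof.
move=> dF; have [h1 h2] := diff_em_l z t; split.
  exact: (differentiable_comp h1 dF).
by apply: etrans (derive_comp (1 : C^o) h1 dF) _; rewrite h2.
Qed.

Lemma diffble_em_r (F : 'rV[C]_(1 + d) -> C) (t : C) (z : 'rV[C]_d) :
  diffble F (em t z) ->
  diffble (fun z => F (em t z)) z /\
  forall u, 'D_u (fun z => F (em t z) : C^o) z = 'D_(u *m jm R d) (F : _ -> C^o) (em t z).
Proof.
move=> dF; have [h1 h2] := diff_em_r t z; split.
  exact: (differentiable_comp h1 dF).
by move=> u; apply: etrans (derive_comp u h1 dF) _; rewrite h2.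
Qed.

Lemma contD_em (F : 'rV[C]_(1 + d) -> C) z : D z ->
  (forall y, cyl D y -> diffble F y) -> contD Dc (fun t => F (em t z)).
Proof.
move=> Dz dF; apply: diff_contD => t Dt.
exact: (diffble_em_l (dF _ (cyl_em Dz (DcB Dt)))).1.
Qed.

(** Differentiation under the integral sign by [diff_intg]. The local bounds on the integrand come
    from its holomorphy on the cylinder and from the Lipschitz dependence of [em t z] on t and z. *)
Lemma htpy_diff z v : D z -> diffble (fun z => htpy D h z v) z /\
  forall u, 'D_u (fun z => htpy D h z v : C^o) z =
    intg (fun t => 'D_(u *m jm R d) (fun y => co a (cyl D) (cylmap h) y
      (consr (je R d) (v *m jm R d)) : C^o) (em t z)) t1 t2.
Proof.
move=> Dz; set V := consr _ _; pose F y := co a (cyl D) (cylmap h) y V.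
have hF y : cyl D y -> affine_hol y F by move=> /cyl_form[_ /(_ V)].
have dF y : cyl D y -> diffble F y by move=> /hF/nbhs_singleton.
have /nearP[e e0 He] := near_open oD Dz.
have DE u t : Dc t -> 'D_u (fun z => F (em t z) : C^o) z =
    'D_(u *m jm R d) (F : _ -> C^o) (em t z).
  by move=> Dt; exact: (diffble_em_r (dF _ (cyl_em Dz (DcB Dt)))).2.
have [] := @diff_intg R _ (fun t z => F (em t z)) Dc t1 t2 z mDc sDc Dt1 Dt2.
- move=> t0 Dt0; have [r [M [r0 HM]]] := hol_bounded (hF _ (cyl_em Dz (DcB Dt0))).
  have [K K0 HK] : exists2 K : R, 0 < K & forall t z', nm (em t z' - em t0 z) <=
      K * nm (t - t0) + K * nm (z' - z).
    exists (nm (je R d) + (\sum_j nm (row j (jm R d))) + 1).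
      by rewrite ltr_wpDl // addr_ge0 ?nm_ge0 // sumr_ge0 // => j _; exact: nm_ge0.
    move=> t z'; have -> : em t z' - em t0 z = (t - t0) *: je R d + (z' - z) *m jm R d.
      by rewrite /em opprD addrACA scalerBl mulmxBl.
    have l1 := nm_mulmx (z' - z) (jm R d).
    have l2 : nm ((t - t0) *: je R d) = nm (t - t0) * nm (je R d) := nmZ _ _.
    apply: le_trans (nmD _ _) _; apply: lerD.
      rewrite l2 mulrC; apply: ler_wpM2r (nm_ge0 _) _ _ _.
      rewrite -addrA lerDl addr_ge0 // sumr_ge0 // => j _; exact: nm_ge0.
    apply: le_trans l1 _; apply: ler_wpM2r (nm_ge0 _) _ _ _.
    rewrite addrAC lerDr addr_ge0 // nm_ge0 //.
  exists (r / (2 * K)), M; split; first by apply: divr_gt0 => //; apply: mulr_gt0.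
  move=> t Dt ht z' hz'; have [|h1 h2] := HM (em t z').
    apply: le_lt_trans (HK t z') _; rewrite -mulrDr.
    have E : r / (2 * K) + r / (2 * K) = r / K by field; rewrite gt_eqF.
    by rewrite mulrC -ltr_pdivlMr // -E; exact: ltrD.
  by split; [exact: (diffble_em_r h1).1|exact: h2].
- exists e => // z' hz'; exact: (contD_em (He _ hz') dF).
- move=> u; have hG y : cyl D y -> affine_hol y (fun y => 'D_(u *m jm R d) (F : _ -> C^o) y).
    by move=> /hF/(hol_derive (u *m jm R d)).
  apply: contD_eq (contD_em Dz (fun y cy => nbhs_singleton (hG y cy))) => t Dt.
  exact: esym (DE u t Dt).
move=> h1 h2; split; first exact: h1.
move=> u; have e1 := h2 u.
have e2 : intg (fun t => 'D_u (fun z => F (em t z) : C^o) z) t1 t2 =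
    intg (fun t => 'D_(u *m jm R d) (F : _ -> C^o) (em t z)) t1 t2.
  exact: (intg_ext mDc (DE u) Dt1 Dt2).
have e3 : _ = intg (fun t => 'D_(u *m jm R d) (F : _ -> C^o) (em t z)) t1 t2 := etrans e1 e2.
exact e3.
Qed.

Lemma htpy_alt z : D z -> alternating_form (htpy D h z).
Proof.
move=> Dz; set w := co a (cyl D) (cylmap h).
have dw v : contD Dc (fun t => w (em t z) (consr (je R d) (v *m jm R d))).
  apply: (contD_em (F := fun y => w y (consr (je R d) (v *m jm R d))) Dz) => y /cyl_form hy.
  exact: coform_diff hy.
have aw t : Dc t -> alternating_form (w (em t z)).
  by move=> Dt; exact: nbhs_singleton (cyl_form (cyl_em Dz (DcB Dt))).1.
split=> [A B' E k c h1 /row'_eqP h2 /row'_eqP h3|A k l kl hkl].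
  apply: etrans (intg_lin c mDc sDc (dw B') (dw E) Dt1 Dt2).
  apply: (intg_ext mDc _ Dt1 Dt2) => t Dt.
  apply: (multilin_consr (je R d) (alternating_multilin (aw t Dt)) (k := k)).
  - by rewrite !row_mul h1 mulmxDl scalemxAl.
  - by move=> j jk; rewrite !row_mul h2.
  - by move=> j jk; rewrite !row_mul h3.
have E0 : intg (fun t => 0 + 0 * t) t1 t2 = 0 :> C.
  by rewrite intg_affine !mul0r addr0.
rewrite -[RHS]E0; apply: (intg_ext mDc _ Dt1 Dt2) => t Dt.
rewrite mul0r addr0; apply: ((aw t Dt).2 _ (lift ord0 k) (lift ord0 l)).
  by rewrite (inj_eq (@lift_inj _ _)).
by rewrite !row_consr !row_mul hkl.
Qed.

End Chart.
(* The map (t, z) |-> (t, G z). *)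
Definition emap d e (G : 'rV[C]_e -> 'rV[C]_d) (y : 'rV[C]_(1 + e)) : 'rV[C]_(1 + d) :=
  em (tc y) (G (y *m pm R e)).

Lemma emapE d e (G : 'rV[C]_e -> 'rV[C]_d) y :
  emap G y = y *m (col_mx 1%:M 0 *m je R d) + G (y *m pm R e) *m jm R d.
Proof.
rewrite /emap /em mulmxA; congr (_ + _).
rewrite -{2}(hsubmxK y) mul_row_col mulmx1 mulmx0 addr0.
by rewrite (mx11_scalar (lsubmx y)) mul_scalar_mx.
Qed.

Lemma emap_diff d e (G : 'rV[C]_e -> 'rV[C]_d) y :
  differentiable G (y *m pm R e) -> differentiable (emap G) y /\
  forall u, 'D_u (emap G) y = u *m (col_mx 1%:M 0 *m je R d) +
    'd G (y *m pm R e) (u *m pm R e) *m jm R d.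
Proof.
move=> dG; have [h1 e1] := diff_mulmxr (col_mx 1%:M 0 *m je R d) y.
have [h2 e2] := diff_mulmxr (pm R e) y.
have h3 : differentiable (G \o (fun y : 'rV[C]_(1 + e) => y *m pm R e)) y.
  exact: (differentiable_comp h2 dG).
have [h4 e4] := diff_mulmx_comp (jm R d) h3.
have E : emap G = (fun y : 'rV[C]_(1 + e) => y *m (col_mx 1%:M 0 *m je R d)) +
    (fun y => (G \o (fun y : 'rV[C]_(1 + e) => y *m pm R e)) y *m jm R d).
  by apply/funext => x; exact: emapE.
have d5 : differentiable (emap G) y by rewrite E; exact: differentiableD.
split => // u; rewrite E deriveD; [|exact: diff_derivable|exact: diff_derivable].
have e5 : 'D_u (G \o (fun y : 'rV[C]_(1 + e) => y *m pm R e)) y =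
    'd G (y *m pm R e) (u *m pm R e).
  have e6 := derive_comp u h2 dG.
  by apply: etrans e6 _; rewrite e2; exact: deriveE.
by rewrite e4 e1 e5.
Qed.

(** The differential of (t, z) |-> (t, G z) fixes d/dt, so the contraction commutes with
    pullback. *)
Lemma htpy_pull d e (D : set 'rV[C]_d) (D' : set 'rV[C]_e) h h' G z v :
  open D -> open D' -> hol_on (X := Cn R d) D h -> (forall z, D z -> S (h z)) ->
  (forall z, D' z -> differentiable G z) -> (forall z, D' z -> D (G z)) ->
  (forall z, D' z -> h' z = h (G z)) -> D' z ->
  htpy D' h' z v = htpy D h (G z) (pbmx G z v).
Proof.
move=> oD oD' hh hS dG GD hh' Dz; apply: (intg_ext mDc _ Dt1 Dt2) => t Dt.
have emz : emap G (em t z) = em t (G z) by rewrite /emap tc_em em_pm.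
have dGz : differentiable G (em t z *m pm R e) by rewrite em_pm; exact: dG.
have dE y : cyl D' y -> differentiable (emap G) y.
  by move=> [Dy _]; exact: (emap_diff (dG _ Dy)).1.
have EC y : cyl D' y -> cyl D (emap G y).
  by move=> [Dy By]; rewrite /emap; apply: (cyl_em _ By); exact: GD.
have EM y : cyl D' y -> cylmap h' y = cylmap h (emap G y).
  by move=> [Dy By]; rewrite /cylmap /emap em_pm tc_em hh'.
have E := co_pull ha (consr (je R e) (v *m jm R e)) (cyl_open oD) (cyl_open oD')
  (cylmap_hol oD hh hS) (cylmap_W hS) dE EC EM (cyl_em Dz (DcB Dt)).
apply: etrans E _.
have P : pbmx (emap G) (em t z) (consr (je R e) (v *m jm R e)) =
    consr (je R d) (pbmx G z v *m jm R d).
  apply/row_matrixP => k; rewrite row_pbmx -deriveE; last exact: (emap_diff dGz).1.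
  rewrite (emap_diff dGz).2; case: (unliftP ord0 k) => [l|] ->.
    rewrite !row_consr !row_mul row_pbmx.
    have a1 : row l v *m jm R e *m (col_mx 1%:M 0 *m je R d) = 0.
      rewrite -mulmxA (mulmxA (jm R e)) {1}/jm mul_row_col mul0mx mulmx0 addr0.
      by rewrite mul0mx mulmx0.
    have a2 : row l v *m jm R e *m pm R e = row l v by rewrite -mulmxA jm_pm mulmx1.
    by rewrite a1 a2 em_pm add0r.
  rewrite !row_consr0 je_pm linear0 mul0mx addr0.
  by rewrite mulmxA {1}/je mul_row_col mulmx0 addr0 mulmx1 mul1mx.
by rewrite P emz.
Qed.

Lemma row'_consr0 k d x (A : 'M[C]_(k, d)) : row' ord0 (consr x A) = A.
Proof.
apply/row_matrixP => j; rewrite (row_row' (i := k.+1)); exact: row_consr.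
Qed.

Lemma row'_consr k d x (A : 'M[C]_(k.+1, d)) l :
  row' (lift ord0 l) (consr x A) = consr x (row' l A).
Proof.
apply/row_matrixP => j; rewrite (row_row' (i := k.+2)); case: (unliftP ord0 j) => [j'|] ->.
  rewrite row_consr (row_row' (i := k.+1)).
  by rewrite -(row_consr x A); congr row; apply/val_inj; rewrite /= /bump /= !add1n ltnS addnS.
rewrite row_consr0 (_ : lift (lift ord0 l) ord0 = ord0) ?row_consr0 //.
exact/val_inj.
Qed.

(* Since phi^* a is closed, the differential of its contraction with d/dt is the
   t-derivative of its part without dt. *)
Lemma htpy_dco d (D : set 'rV[C]_d) h z v :
  open D -> hol_on (X := Cn R d) D h -> (forall z, D z -> S (h z)) -> D z ->
  (forall y V, cyl D y -> dco (co a (cyl D) (cylmap h)) y V = 0) ->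
  dco (htpy D h) z v =
    co a D (fun x => phi (h x, t2)) z v - co a D (fun x => phi (h x, t1)) z v.
Proof.
move=> oD hh hS Dz hcl; pose w := co a (cyl D) (cylmap h).
have wf y : cyl D y -> coform w y := @cyl_form d D h oD hh hS y.
pose g (k : 'I_i.+1) t := 'D_(row k v *m jm R d)
  (fun y => w y (consr (je R d) (row' k v *m jm R d)) : C^o) (em t z).
pose f t := 'D_(je R d) (fun y => w y (v *m jm R d) : C^o) (em t z).
have dg k t : Dc t -> diffble (g k) t.
  move=> Dt; have hy := wf _ (cyl_em Dz (DcB Dt)).
  have hd := hol_derive (row k v *m jm R d) (hy.2 (consr (je R d) (row' k v *m jm R d))).
  exact: (diffble_em_l (nbhs_singleton hd)).1.
(* Closedness is evaluated on d/dt followed by the rows of v. The term of index 0 is f; in the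
   others the index is shifted by one, hence the opposite sign. *)
have fE t : Dc t -> \sum_(k < i.+1) (-1) ^+ k * g k t = f t.
  move=> Dt; have := hcl (em t z) (consr (je R d) (v *m jm R d)) (cyl_em Dz (DcB Dt)).
  rewrite /dco big_ord_recl expr0 mul1r row_consr0 row'_consr0 => /eqP.
  rewrite addr_eq0 => /eqP e1; apply: etrans (esym e1); rewrite -sumrN.
  apply: eq_bigr => k _; rewrite row_consr row'_consr /g row_mul.
  rewrite (_ : row' k (v *m jm R d) = row' k v *m jm R d); last first.
    by apply/row_matrixP => j; rewrite (row_row' (i := i.+1)) !row_mul (row_row' (i := i.+1)).
  have sg : (-1) ^+ k = - (-1) ^+ (lift ord0 k) :> C.
    by rewrite /= /bump /= add1n exprS mulN1r opprK.
  by rewrite sg mulNr.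
have e1 : dco (htpy D h) z v = \sum_(k < i.+1) (-1) ^+ k * intg (g k) t1 t2.
  apply: eq_bigr => k _; have e := (htpy_diff oD hh hS (row' k v) Dz).2 (row k v).
  by apply: (congr1 (fun x => (-1) ^+ k * x)); exact e.
have e2 := esym (intg_sum (fun k : 'I_i.+1 => (-1) ^+ k) mDc sDc Dt1 Dt2 dg).
have e3 := intg_ext mDc fE Dt1 Dt2.
have dF t : Dc t -> diffble (fun y => w y (v *m jm R d)) (em t z).
  by move=> Dt; exact: coform_diff (wf _ (cyl_em Dz (DcB Dt))).
have cf : contD Dc f.
  apply: (contD_em (D := D) (F := fun y => 'D_(je R d) (fun y => w y (v *m jm R d) : C^o) y) Dz).
  move=> y cy; exact: nbhs_singleton (hol_derive _ ((wf y cy).2 (v *m jm R d))).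
have dDF t : Dc t -> diffD Dc (fun t => w (em t z) (v *m jm R d)) t (f t).
  move=> Dt; have [h1 h2] := diffble_em_l (dF t Dt).
  have h3 := etrans (esym (deriveE (1 : C^o) h1)) h2.
  exact (eq_rect _ (fun l => diffD Dc _ t l) (diff_diffD Dc h1) _ h3).
have e4 := intg_ftc mDc sDc cf dDF Dt1 Dt2.
(* The form phi_t^* a is the restriction of phi^* a to the slice with parameter t. *)
have E t : Dc t -> co a D (fun x => phi (h x, t)) z v = w (em t z) (v *m jm R d).
  move=> Dt; have P : pbmx (em t) z v = v *m jm R d.
    apply/row_matrixP => k; have [d1 d2] := diff_em_r t z.
    by rewrite row_pbmx row_mul -(d2 (row k v)) deriveE.
  have dem x : D x -> differentiable (em t) x by move=> _; exact: (diff_em_r t x).1.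
  have em' x : D x -> cyl D (em t x) by move=> Dx; exact: cyl_em Dx (DcB Dt).
  have ee x : D x -> (fun x => phi (h x, t)) x = cylmap h (em t x).
    by rewrite /cylmap em_pm tc_em.
  have := co_pull ha v (cyl_open oD) oD (cylmap_hol oD hh hS) (cylmap_W hS) dem em' ee Dz.
  by rewrite P.
rewrite (E t1 Dt1) (E t2 Dt2).
exact: etrans e1 (etrans e2 (etrans e3 e4)).
Qed.

Definition htpy_family : hfamily X i :=
  fun M f c => htpy (ccod c) (f \o cinv c).

Lemma hol_cinv (M : manifold R) (f : M -> X) (c : chart M) :
  holomorphic f -> hol_on (X := Cn R (cdim c)) (ccod c) (f \o cinv c).
Proof. by move=> hf; apply: (hol_on_comp (@cinv_hol _ _ c) hf) => x _. Qed.

Lemma htpy_family_pull (M' M : manifold R) (g : M' -> M) (f : M -> X) :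
  holomorphic g -> maps_into S f ->
  is_pullback g (htpy_family f) (htpy_family (f \o g)).
Proof.
move=> hg [hf fS] c' c z v cz cgz G.
(* In coordinates g is defined only on this part of the chart c'. Hence [htpy_pull] is used twice:
   along G, and for the restriction from [ccod c'] to D. *)
pose D := [set y : 'rV[C]_(cdim c') | ccod c' y /\ cdom c (g (cinv c' y))].
have hgc : hol_on (X := Cn R (cdim c')) (ccod c') (g \o cinv c').
  by apply: (hol_on_comp (@cinv_hol _ _ c') hg) => x _.
have oD : open D.
  rewrite openE => y [cy cgy]; have [cont _] := hgc y cy.
  have n1 : \forall x \near y, ccod c' x := near_open (@ccod_open R M' c') cy.
  have n2 : \forall x \near y, cdom c (g (cinv c' x)).
    by apply: cont; exact: open_nbhs_nbhs (conj (@cdom_open R M c) cgy).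
  by apply: filterS2 n1 n2 => x.
have hgD : hol_on (X := Cn R (cdim c')) D (g \o cinv c') by move=> y [/hgc].
have hG : hol_on (X := Cn R (cdim c')) (Z := Cn R (cdim c)) D G.
  by apply: (hol_on_comp hgD (@cmap_hol _ _ c)) => y [].
have dG := (hol_on_diff G oD).1 hG.
have GC y : D y -> ccod c (G y) by move=> [_ /cmapK[]].
have EG y : D y -> (f \o g \o cinv c') y = (f \o cinv c) (G y).
  by move=> [_ /cmapK[_ e]]; rewrite /= e.
have Dz : D z by [].
have e1 := htpy_pull v (@ccod_open R M c) oD (hol_cinv (c := c) hf) (fun z _ => fS _) dG GC EG Dz.
have hfg : holomorphic (f \o g) by apply: (hol_on_comp hg hf) => x _.
have did (y : 'rV[C]_(cdim c')) : D y -> differentiable (fun y : 'rV[C]_(cdim c') => y) y.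
  by move=> _; exact: differentiable_idfun.
have e2 := htpy_pull v (@ccod_open R M' c') oD (hol_cinv (c := c') hfg) (fun z _ => fS _) did
  (fun y (Dy : D y) => Dy.1) (fun _ _ => erefl) Dz.
have e3 : pbmx (fun y : 'rV[C]_(cdim c') => y) z v = v by apply: pbmx_near_id; exact: filterE.
have e4 : htpy D (f \o g \o cinv c') z v = htpy (ccod c') (f \o g \o cinv c') z v.
  by apply: etrans e2 _; rewrite e3.
exact (etrans (esym e4) e1).
Qed.

Lemma htpy_family_hform : hform S htpy_family.
Proof.
split; last exact: htpy_family_pull.
move=> M f hf; have hfc c := hol_cinv (c := c) hf.1.
have fS (c : chart M) z : ccod c z -> S ((f \o cinv c) z) by move=> _; exact: hf.2.
split.
- move=> c z cz; exact (htpy_alt (@ccod_open R M c) (hfc c) (fS c) cz).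
- move=> c z v cz; apply: filterS (near_open (@ccod_open R M c) cz) => y cy.
  exact: (htpy_diff (@ccod_open R M c) (hfc c) (fS c) v cy).1.
- have hid : holomorphic (idfun : M -> M) by move=> x _; split.
  exact: (htpy_family_pull hid hf).
Qed.

Lemma htpy_family_d (M : manifold R) (f : M -> X) (c : chart M) z v :
  maps_into S f -> ccod c z ->
  (forall d (D : set 'rV[C]_d) h y V, open D -> hol_on (X := Cn R d) D h ->
    (forall z, D z -> W (h z)) -> D y -> dco (co a D h) y V = 0) ->
  dform (htpy_family f) z v =
    co a (ccod c) (fun x => phi (f (cinv c x), t2)) z v -
    co a (ccod c) (fun x => phi (f (cinv c x), t1)) z v.
Proof.
move=> [hf fS] cz hcl; have oD := @ccod_open R M c; have hfc := hol_cinv (c := c) hf.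
have fS' z' : ccod c z' -> S ((f \o cinv c) z') by move=> _; exact: fS.
have h1 y V (cy : cyl (ccod c) y) :=
  hcl _ _ _ y V (cyl_open oD) (cylmap_hol oD hfc fS') (cylmap_W fS') cy.
exact (htpy_dco v oD hfc fS' cz h1).
Qed.

End Operator.

(** * Exactness *)

Section Exactness.
Variable R : realType.
Local Notation C := (CC R).
Local Notation diffble f x := (differentiable (f : _ -> C^o) x).
Variables (X : fspace R).

Lemma maps_into_sub (U V : set X) (M : manifold R) (f : M -> X) :
  U `<=` V -> maps_into U f -> maps_into V f.
Proof. by move=> UV [hf fU]; split => // x; exact/UV/fU. Qed.

Lemma hform_sub i (U V : set X) (a : hfamily X i) :
  U `<=` V -> hform V a -> hform U a.
Proof.
move=> UV [h1 h2]; split.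
  by move=> M f fU; exact: h1 (maps_into_sub UV fU).
by move=> M' M g f hg fU; exact: h2 hg (maps_into_sub UV fU).
Qed.

Definition hadd i (a b : hfamily X i) : hfamily X i :=
  fun M f c z v => a M f c z v + b M f c z v.

Lemma hadd_hform i (U : set X) (a b : hfamily X i) :
  hform U a -> hform U b -> hform U (hadd a b).
Proof.
move=> [a1 a2] [b1 b2]; split; last first.
  move=> M' M g f hg hf c' c z v cz cgz G.
  exact (congr2 +%R (a2 M' M g f hg hf c' c z v cz cgz) (b2 M' M g f hg hf c' c z v cz cgz)).
move=> M f hf; have [al ah ap] := a1 M f hf; have [bl bh bp] := b1 M f hf; split.
- move=> c z cz; split=> [A B D k t h1 h2 h3|A k l kl h].
    rewrite /hadd ((al c z cz).1 A B D k t h1 h2 h3) ((bl c z cz).1 A B D k t h1 h2 h3).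
    by rewrite mulrDr addrACA.
  by rewrite /hadd ((al c z cz).2 A k l kl h) ((bl c z cz).2 A k l kl h) addr0.
- move=> c z v cz; apply: filterS2 (ah c z v cz) (bh c z v cz) => y dy ey.
  exact: (differentiableD dy ey).
- move=> c' c z v cz cgz G.
  exact (congr2 +%R (ap c' c z v cz cgz) (bp c' c z v cz cgz)).
Qed.

Lemma dform_hadd i (U : set X) (a b : hfamily X i) (M : manifold R) (f : M -> X)
    (c : chart M) z v : hform U a -> hform U b -> maps_into U f -> ccod c z ->
  dform (@hadd i a b M f) z v = dform (@a M f) z v + dform (@b M f) z v.
Proof.
move=> [a1 _] [b1 _] hf cz; have [_ ah _] := a1 M f hf; have [_ bh _] := b1 M f hf.
rewrite /dform -big_split; apply: eq_bigr => k _.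
rewrite -[RHS]mulrDr; apply: (congr1 (fun x => (-1) ^+ k * x)).
have da := nbhs_singleton (ah c z (row' k v) cz).
have db := nbhs_singleton (bh c z (row' k v) cz).
have E : \forall y \near z, @hadd i a b M f c y (row' k v) =
    1 * a M f c y (row' k v) + b M f c y (row' k v).
  by apply: filterE => y; rewrite mul1r.
by apply: etrans (derive_affine_comb (row k v) E da db) _; rewrite mul1r.
Qed.

Lemma hzero_hform i U : hform U (@hzero R X i).
Proof.
split=> // M f _; split => //.
  by move=> c z _; split=> // *; rewrite /hzero /form_zero mulr0 addr0.
by move=> c z v _; apply: filterE => y; exact: differentiable_cst.
Qed.

Lemma dform_zero (M : manifold R) i (c : chart M) (z : 'rV[C]_(cdim c)) v :
  dform (@form_zero R M i) z v = 0 :> C.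
Proof.
rewrite /dform big1 // => k _; rewrite (_ : 'D_(row k v) _ z = 0) ?mulr0 //.
exact: derive_cst.
Qed.

Lemma co_closed i (a : hfamily X i) (U V : set X) d (D : set 'rV[C]_d) h y w :
  hform U a ->
  (forall (M : manifold R) (f : M -> X), maps_into V f -> form_eq (hd a f) (@hzero R X _ M f)) ->
  open D -> hol_on (X := Cn R d) D h -> (forall z, D z -> (U `&` V) (h z)) -> D y ->
  dco (co a D h) y w = 0.
Proof.
move=> ha hV oD hh hUV Dy.
have hU z (Dz : D z) := (hUV z Dz).1; have hV' z (Dz : D z) := (hUV z Dz).2.
apply: etrans (esym (co_hd w ha oD hh hU Dy)) _; rewrite (coE _ _ w oD Dy).
exact (hV _ _ (sub_maps_into oD hh hV') (sub_chart oD Dy) y w Dy).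
Qed.

Lemma hd_hd i (U : set X) (a : hfamily X i) (M : manifold R) (f : M -> X)
    (c : chart M) z v : hform U a -> maps_into U f -> ccod c z ->
  hd (hd a) f z v = 0.
Proof.
move=> [a1 _] hf cz; have [al ah _] := a1 M f hf.
apply: (@ddco R i _ (@a M f c)); apply: filterS (near_open (@ccod_open R M c) cz) => y cy.
split; last by move=> w; exact: ah.
by apply: filterS (near_open (@ccod_open R M c) cy) => x cx; exact: al.
Qed.

(** * Comparison of the pullbacks of a at different parameters *)

Section Homotopy.
Variables (i : nat) (a : hfamily X i.+1) (p : X) (phi : X * C -> X).

(* phi_t2^* a - phi_t1^* a is exact as a germ at p. *)
Definition exact_between (t1 t2 : C) := exists (b : hfamily X i) (V : set X),
  [/\ open V, V p, hform V b & forall (M : manifold R) (f : M -> X), maps_into V f ->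
    forall (c : chart M) z v, ccod c z -> dform (b M f) z v =
      co a (ccod c) (fun x => phi (f (cinv c x), t2)) z v -
      co a (ccod c) (fun x => phi (f (cinv c x), t1)) z v].

Lemma exact_between_refl t : exact_between t t.
Proof.
exists (@hzero R X i), setT; split => //; [exact: openT|exact: hzero_hform|].
by move=> M f _ c z v cz; rewrite subrr; exact: dform_zero.
Qed.

Lemma exact_between_trans t1 t2 t3 :
  exact_between t1 t2 -> exact_between t2 t3 -> exact_between t1 t3.
Proof.
move=> [b [V [oV Vp hb dbE]]] [b' [V' [oV' Vp' hb' dbE']]].
have hb1 : hform (V `&` V') b by apply: hform_sub hb => x [].
have hb2 : hform (V `&` V') b' by apply: hform_sub hb' => x [].
exists (hadd b b'), (V `&` V'); split.
- exact: openI.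
- by [].
- exact: hadd_hform.
move=> M f hf c z v cz; apply: etrans (dform_hadd v hb1 hb2 hf cz) _.
have f1 : maps_into V f by apply: maps_into_sub hf => x [].
have f2 : maps_into V' f by apply: maps_into_sub hf => x [].
by rewrite (dbE M f f1 c z v cz) (dbE' M f f2 c z v cz) addrC addrA subrK.
Qed.

Variables (W U : set X) (T : set C).
Hypotheses (ha : hform W a) (oW : open W) (Wp : W p).
Hypotheses (oU : open U) (Up : U p) (oT : open (T : set C^o)).
Hypothesis hphi : hol_on (X := prod_space X (Cline R)) (U `*` T) phi.
Hypothesis phip : forall t, T t -> phi (p, t) = p.
Hypothesis hcl : forall d (D : set 'rV[C]_d) h y V, open D ->
  hol_on (X := Cn R d) D h -> (forall z, D z -> W (h z)) -> D y -> dco (co a D h) y V = 0.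

(** As phi (p, t0) = p lies in W, some product neighbourhood of (p, t0) is mapped into W, and the
    homotopy operator is defined there. This neighbourhood depends on t0, which limits the
    integration to short segments. *)
Lemma exact_between_local t0 : T t0 -> exists2 e : R, 0 < e & forall t1 t2,
  nm (t1 - t0) < e -> nm (t2 - t0) < e -> exact_between t1 t2.
Proof.
move=> Tt0; have [cphi _] := @hphi (p, t0) (conj Up Tt0).
have nW : nbhs (phi (p, t0)) W by rewrite phip //; exact: open_nbhs_nbhs.
have [[A B] [/= nA nB] AB] := cphi W nW.
have nAU : nbhs p (A `&` U) by apply: filterI nA _; exact: open_nbhs_nbhs.
have nT : \forall t \near (t0 : C^o), T t by exact: open_nbhs_nbhs.
have nBT : \forall t \near (t0 : C^o), B t /\ T t by apply: filterS2 nB nT.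
have /nearP[e e0 He] := nBT.
have e20 : 0 < e / 2 by exact: divr_gt0.
exists (e / 2) => // t1 t2 h1 h2.
pose S := (A `&` U)°; pose B' : set C := [set t | nm (t - t0 : C^o) < e].
(* The closed disc of half the radius is closed under midpoints and limits, as integration requires,
   and lies inside the open disc B' on which phi takes values in W. *)
pose Dc (t : C) := nm (t - t0 : C^o) <= e / 2.
have oS : open S by exact: open_interior.
have SAU x : S x -> (A `&` U) x by exact: interior_subset.
have oB' : open (B' : set C^o) by exact: open_nmball.
have hphi' : hol_on (X := prod_space X (Cline R)) (S `*` B') phi.
  move=> [x t] [/= /SAU[_ Ux] /He[_ Tt]]; exact: hphi.
have phiW x t : S x -> B' t -> W (phi (x, t)).
  by move=> /SAU[Ax _] /He[Bt _]; exact: (AB (x, t)).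
have DB t : Dc t -> B' t.
  by move=> h; apply: le_lt_trans h _; rewrite ltr_pdivrMr // ltr_pMr // ltr1n.
exists (htpy_family a phi B' t1 t2), S; split => //.
  exact (htpy_family_hform ha oB' hphi' phiW DB (@midclosed_cball R t0 (e / 2))
    (@seqclosed_cball R t0 (e / 2)) (ltW h1) (ltW h2)).
move=> M f hf c z v cz.
exact (htpy_family_d ha oB' hphi' phiW DB (@midclosed_cball R t0 (e / 2))
    (@seqclosed_cball R t0 (e / 2)) (ltW h1) (ltW h2) v hf cz hcl).
Qed.

(** Both the set of parameters reached from t1 and its complement in T are open by
    [exact_between_local], and t1 belongs to the first. *)
Lemma exact_between_connected t1 t2 :
  connected (T : set C^o) -> T t1 -> T t2 -> exact_between t1 t2.
Proof.
move=> cT Tt1 Tt2.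
pose E : set C^o := [set t | T t /\ exact_between t1 t].
have nT t : T t -> \forall s \near (t : C^o), T s by move=> Tt; exact: open_nbhs_nbhs.
have oE : open E.
  rewrite openE => t [Tt Et]; have [e e0 He] := exact_between_local Tt.
  have ne : \forall s \near (t : C^o), nm (s - t) < e by apply/nearP; exists e.
  apply: filterS2 (nT t Tt) ne => s Ts hs; split => //.
  by apply: exact_between_trans Et (He t s _ hs); rewrite subrr nm0.
pose N : set C^o := [set t | T t /\ ~ exact_between t1 t].
have oN : open N.
  rewrite openE => t [Tt Et]; have [e e0 He] := exact_between_local Tt.
  have ne : \forall s \near (t : C^o), nm (s - t) < e by apply/nearP; exists e.
  apply: filterS2 (nT t Tt) ne => s Ts hs; split => // Es; apply: Et.
  by apply: exact_between_trans Es (He s t hs _); rewrite subrr nm0.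
have ET : E = T.
  apply: cT.
  - by exists t1; split => //; exact: exact_between_refl.
  - by exists E => //; apply/seteqP; split=> t; [move=> [? ?]; split|move=> [_]].
  - exists (~` N); first exact: open_closedC.
    apply/seteqP; split=> t; first by move=> [Tt Et]; split => // -[].
    by move=> [Tt nN]; split => //; apply: contrapT => nE; exact: nN.
have : E t2 by rewrite ET.
by move=> [].
Qed.

End Homotopy.

Lemma co_ext i (a : hfamily X i) d (D : set 'rV[C]_d) (f f' : 'rV[C]_d -> X) z v :
  open D -> (forall y, D y -> f y = f' y) -> D z -> co a D f z v = co a D f' z v.
Proof.
move=> oD ff' Dz; rewrite (coE _ _ v oD Dz) (coE _ _ v oD Dz).
rewrite (_ : f \o @sub_val R d D = f' \o @sub_val R d D) //.
by apply/funext => x; apply: ff'; exact: sub_valP.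
Qed.

Lemma hd_eq i (a b : hfamily X i) (M : manifold R) (f : M -> X) (c : chart M) z v :
  (forall y w, ccod c y -> a M f c y w = b M f c y w) -> ccod c z ->
  hd a f z v = hd b f z v.
Proof.
move=> ab cz; apply: eq_bigr => k _; apply: (congr1 (fun x => (-1) ^+ k * x)).
have H : \forall y \near z, a M f c y (row' k v) = b M f c y (row' k v).
  by apply: filterS (near_open (@ccod_open R M c) cz) => y cy; exact: ab.
exact: near_eq_derive H.
Qed.

Lemma dimage_closed i (a : hfamily X i.+1) p :
  hstalk_dimage p a -> hstalk_eq p (hd a) (@hzero R X i.+2).
Proof.
move=> [b [[U [oU Up hb]] [V [oV Vp ab]]]]; exists (U `&` V); split => //.
  exact: openI.
move=> M f hf c z v cz.
have f1 : maps_into U f by apply: maps_into_sub hf => x [].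
have f2 : maps_into V f by apply: maps_into_sub hf => x [].
have E y w (cy : ccod c y) := esym (ab M f f2 c y w cy).
exact (etrans (hd_eq (b := hd b) v E cz) (hd_hd v hb f1 cz)).
Qed.

Hypothesis hX : reduced_complex_space X.

Lemma hd_eq0 i n (a : hfamily X i) (U : set X) (M : manifold R) (f : M -> X)
    (c : chart M) z v :
  (forall r, contains_submanifold [set: X] r -> (r <= n)%N) -> (n < i.+1)%N ->
  hform U a -> maps_into U f -> ccod c z -> hd a f z v = 0.
Proof.
move=> hn ni ha hf cz; have oD := @ccod_open R M c.
have hfc := hol_cinv (c := c) hf.1.
have fU y : ccod c y -> U ((f \o cinv c) y) by move=> _; exact: hf.2.
have fU' y : ccod c y -> U ((f \o cinv c) y) /\ [set: X] ((f \o cinv c) y).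
  by move=> _; split => //; exact: hf.2.
have E0 := natural_family_eq0 v hX hn ni (co_hd_natural ha) oD hfc fU' cz.
have E1 := co_hd v ha oD hfc fU cz.
apply: etrans _ (etrans (esym E1) E0).
apply: eq_bigr => k _; apply: (congr1 (fun x => (-1) ^+ k * x)).
have H : \forall y \near z, a M f c y (row' k v) = co a (ccod c) (f \o cinv c) y (row' k v).
  by apply: filterS (near_open oD cz) => y cy; exact (co_chart ha _ hf cy).
exact: near_eq_derive H.
Qed.

Lemma closed_dimage i m (a : hfamily X i.+1) (p : X) (Y : set X) :
  (forall r, contains_submanifold Y r -> (r <= m)%N) -> (m <= i)%N ->
  hol_contractible p Y -> hstalk p a -> hstalk_eq p (hd a) (@hzero R X i.+2) ->
  hstalk_dimage p a.
Proof.
move=> hm mi [X' [Y' [U [T [phi [[_ _ _ _ YY'] [oU Up _] [oT cT T0 T1] [hphi _]]]]]]].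
move=> [phip phiU] [Ua [oUa Uap ha]] [V [oV Vp aV]].
have oW : open (Ua `&` V) by exact: openI.
have haW : hform (Ua `&` V) a by apply: hform_sub ha => x [].
have hcl d (D : set 'rV[C]_d) h y w (oD : open D) (hh : hol_on (X := Cn R d) D h)
    (hW : forall z, D z -> (Ua `&` V) (h z)) (Dy : D y) :=
  co_closed w ha aV oD hh hW Dy.
have [b [V0 [oV0 V0p hb dbE]]] :=
  exact_between_connected haW oW (conj Uap Vp) oU Up oT hphi phip hcl cT T0 T1.
exists b; split; first by exists V0.
have [cphi _] := @hphi (p, 0) (conj Up T0).
(* The sets Y' and Y agree only near p. As phi (p, 0) = p, continuity allows the neighbourhood to be
   shrunk until phi_0 takes its values where they agree and where a is defined. *)
have nP : nbhs (phi (p, 0)) [set x | Ua x /\ (Y' x <-> Y x)].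
  by rewrite phip //; apply: filterS2 (open_nbhs_nbhs (conj oUa Uap)) YY' => x.
have [[A B] [/= nA nB] AB] := cphi _ nP.
have SA x : (A°) x -> Ua (phi (x, 0)) /\ (Y' (phi (x, 0)) <-> Y (phi (x, 0))).
  move=> /interior_subset Ax; apply: (AB (x, 0)); split => //=.
  exact: nbhs_singleton nB.
exists ((V0 `&` Ua) `&` (U `&` A°)); split.
- by apply: openI; apply: openI => //; exact: open_interior.
- by [].
move=> M f hf c z v cz.
have fV0 : maps_into V0 f by apply: maps_into_sub hf => x [[]].
have fUa : maps_into Ua f by apply: maps_into_sub hf => x [[]].
have fU x : U (f x) by have [_ []] := hf.2 x.
have fA x : (A°) (f x) by have [_ []] := hf.2 x.
have oD := @ccod_open R M c; have hfc := hol_cinv (c := c) hf.1.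
apply: etrans (dbE M f fV0 c z v cz) _.
have E1 : co a (ccod c) (fun x => phi (f (cinv c x), 1)) z v = a M f c z v.
  apply: etrans (esym (co_chart ha v fUa cz)).
  by apply: (co_ext _ _ oD _ cz) => y _; exact: (phiU _ (fU _)).1.
have h0 : hol_on (X := Cn R (cdim c)) (Z := Cline R) (ccod c) (fun=> 0).
  by apply: (diffble_hol oD) => y _; exact: differentiable_cst.
have h1 : hol_on (X := Cn R (cdim c)) (ccod c) (fun x => phi (f (cinv c x), 0)).
  apply: (hol_on_comp (hol_on_pair hfc h0) hphi) => y _.
  by split; [exact: fU|exact: T0].
have h2 y : ccod c y -> Ua (phi (f (cinv c y), 0)) /\ Y (phi (f (cinv c y), 0)).
  move=> _; have [h3 h4] := SA _ (fA (cinv c y)).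
  by split => //; apply/h4; exact: (phiU _ (fU _)).2.
have E0 := natural_family_eq0 v hX hm (leq_ltn_trans mi (ltnSn i)) (co_natural ha) oD h1 h2 cz.
by rewrite E1 E0 subr0.
Qed.

End Exactness.

Theorem theorem1p3 (R : realType) (X : fspace R)
    (hX : reduced_complex_space X) (n m : nat) (hn : has_dim [set: X] n)
    (p : X) (Y : set X) (hY : analytic_in [set: X] Y) (hm : has_dim Y m)
    (hc : hol_contractible p Y) :
  (forall i : nat, (m <= i)%N -> (i.+1 < n)%N -> hstalk_exact p i) /\
  (forall i : nat, (m <= i)%N -> i.+1 = n -> hstalk_surjective p i).
Proof.
split=> i mi hi a ha.
  split; first exact: (closed_dimage hX hm.2 mi hc ha).
  exact: dimage_closed.
apply: (closed_dimage hX hm.2 mi hc ha); have [U [oU Up hU]] := ha.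
exists U; split => // M f hf c z v cz.
by apply: (hd_eq0 hX v hn.2 _ hU hf cz); rewrite -hi.
Qed.
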